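(* Let $\mathcal{C}$ be a stably $2$-Calabi–Yau Frobenius category whose cluster-tilting subcategories determine a cluster structure, let $T^0=T^0_1\oplus\cdots\oplus T^0_m$ be a basic cluster-tilting object of $\mathcal{C}$ (with $T^0_1,\ldots,T^0_r$ the indecomposable non-projective summands and $T^0_{r+1},\ldots,T^0_m$ the indecomposable projective-injective summands), and let $T(t)=T_1(t)\oplus\cdots\oplus T_m(t)$, $t\in\mathbb{T}_r$, be the family of cluster-tilting objects obtained from $T^0$ by iterated mutation. Let $t_1,t_2$ be vertices of $\mathbb{T}_r$, put $T=T(t_1)$, $T_i=T_i(t_1)$ and $\mathcal{T}=\mathrm{add}(T)$. Then for all $1\le j\le m$ $$\mathrm{ind}_{\mathcal{T}}(T_j(t_2))=\sum_{i=1}^m g_{ij}^{t_1}(t_2)\,[T_i]\quad\text{in } K_0(\mathcal{T}),$$ where $g_{ij}^{t_1}(t_2)$ is the $i$-th coordinate of the extended $g$-vector $g_j^{t_1}(t_2)\in\mathbb{Z}^m$ with respect to the initial vertex $t_1$.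
   Context: **Categories.** $K$ is an algebraically closed field. $\mathcal{C}$ is a $K$-linear Krull–Schmidt Frobenius exact category, enriched over pseudocompact vector spaces, whose stable category $\underline{\mathcal{C}}$ is Hom-finite and $2$-Calabi–Yau (i.e. $D\,\underline{\mathcal{C}}(X,Y)\cong\underline{\mathcal{C}}(Y,\Sigma^2X)$ bifunctorially); $\mathcal{C}$ is then called stably $2$-CY. An object $X$ is rigid if $\mathrm{Ext}^1_{\mathcal{C}}(X,X)=0$. A cluster-tilting object is a basic rigid object $T$ such that each $X$ with $\mathrm{Ext}^1_{\mathcal{C}}(T,X)=0$ belongs to $\mathrm{add}(T)$. The endoquiver of $T=\bigoplus T_i$ has one vertex $i$ per indecomposable summand and $\dim \mathrm{rad}(T_i,T_j)/\mathrm{rad}^2(T_i,T_j)$ arrows $i\to j$ (assumed finite), rad being the radical of $\mathrm{add}(T)$; it is an ice quiver, with frozen vertices those with $T_i$ projective-injective. **Cluster structure** (Buan–Iyama–Reiten–Scott): for each cluster-tilting object $T$ and each non-projective indecomposable summand $T_k$ there is a unique indecomposable $T_k^*\not\cong T_k$ such that $\mu_k(T)=T_k^*\oplus\bigoplus_{i\ne k}T_i$ is cluster-tilting; there are non-split exchange conflations $T_k^*\to E\to T_k$ and $T_k\to E'\to T_k^*$ whose maps are minimal right/left $\mathrm{add}(\bigoplus_{i\neq k}T_i)$-approximations; endoquivers of cluster-tilting objects have no loops or 2-cycles; and the endoquiver of $\mu_k(T)$ is the mutation at $k$ of that of $T$ (ignoring arrows between frozen vertices). **Mutation family.** $\mathbb{T}_r$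 is the $r$-regular tree with the edges at each vertex labeled $1,\ldots,r$ and initial vertex $t_0$. $T_j(t_0)=T^0_j$; if $t,t'$ are joined by an edge labeled $i$, then $T_j(t')=T_j(t)$ for $j\ne i$ and $T_i(t')=T_i(t)^*$. $Q(t)$ is the ice quiver with $Q(t_0)$ the endoquiver of $T^0$ and $Q(t')=\mu_k(Q(t))$ for an edge labeled $k$. **Index.** $K_0(\mathcal{T})$ is the split Grothendieck group of $\mathcal{T}=\mathrm{add}(T)$. Each $X\in\mathcal{C}$ admits a conflation $T''\to T'\to X$ with $T',T''\in\mathcal{T}$, and $\mathrm{ind}_{\mathcal{T}}(X)=[T']-[T'']\in K_0(\mathcal{T})$, independent of the choice. **Extended $g$-vectors.** For an ice quiver put $b_{ij}=\#\{i\to j\}-\#\{j\to i\}$. Take $t_1$ as initial vertex. Starting at $t_1$ from the $2r\times r$ matrix with upper block $(b_{ij}(t_1))_{i,j\le r}$ (for $Q(t_1)$) and lower block the identity, matrix mutation along edges of $\mathbb{T}_r$ (at $k$: $b'_{ij}=-b_{ij}$ if $i=k$ or $j=k$, else $b'_{ij}=b_{ij}+\mathrm{sgn}(b_{ik})\max(b_{ik}b_{kj},0)$) gives at $t$ a lower block $C(t)$, whose columns are the $c$-vectors at $t$; each is non-zero with entries all $\ge0$ or all $\le0$. A vertex $k\le r$ is green at $t$ if its $c$-vector is $\ge0$ and red otherwise. Then $g^{t_1}_i(t_1)=e_i$ $(1\le i\le m)$ and, for an edge labeled $k$ between $t$ and $t'$, $g^{t_1}_i(t')=g^{t_1}_i(t)$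 for $i\neq k$, while $g^{t_1}_k(t')=-g^{t_1}_k(t)+\sum_{k\to i}g^{t_1}_i(t)$ if $k$ is green at $t$ and $g^{t_1}_k(t')=-g^{t_1}_k(t)+\sum_{i\to k}g^{t_1}_i(t)$ if $k$ is red at $t$, sums being over arrows of $Q(t)$. *)

(* Defs.v *)
From HB Require Import structures.
From mathcomp Require Import all_boot all_order all_algebra.
From mathcomp Require Import generic_quotient ring_quotient.
From mathcomp Require Import boolp.
From mathcomp Require Import freeg.

Set Implicit Arguments.
Unset Strict Implicit.
Unset Printing Implicit Defensive.
Import Order.TTheory GRing.Theory Num.Theory.
Local Open Scope ring_scope.

Reserved Notation "g \oc f" (at level 40, left associativity).
Reserved Notation "X \oplus Y" (at level 50, left associativity).
Reserved Notation "X \cong Y" (at level 70, no associativity).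

Section Subspaces.
Variables (K : fieldType) (V : lmodType K).

Definition subspace (U : V -> Prop) : Prop :=
  U 0 /\ forall (a : K) x y, U x -> U y -> U (a *: x + y).

Definition finite_codim (U : V -> Prop) : Prop :=
  exists (n : nat) (v : 'I_n -> V),
    forall x, exists c : 'I_n -> K, U (x - \sum_i c i *: v i).

(* [dim (W / U) = n], for subspaces [U <= W] *)
Definition quot_dim (W U : V -> Prop) (n : nat) : Prop :=
  exists v : 'I_n -> V,
    [/\ forall i, W (v i),
        forall x, W x -> exists c : 'I_n -> K, U (x - \sum_i c i *: v i)
      & forall c : 'I_n -> K, U (\sum_i c i *: v i) -> forall i, c i = 0].

(* A pseudocompact vector space: a linear topology, given by its open
   subspaces, that is Hausdorff and complete and whose open subspaces have
   finite codimension. *)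
Record pseudocompact (op : (V -> Prop) -> Prop) : Prop := Pseudocompact {
  pc_subspace : forall U, op U -> subspace U;
  pc_codim : forall U, op U -> finite_codim U;
  pc_full : op (fun=> True);
  pc_cap : forall U U', op U -> op U' -> op (fun x => U x /\ U' x);
  pc_up : forall U U', op U -> subspace U' -> (forall x, U x -> U' x) -> op U';
  pc_hausdorff : forall x, (forall U, op U -> U x) -> x = 0;
  pc_complete : forall x : (V -> Prop) -> V,
    (forall U U', op U -> op U' -> (forall y, U' y -> U y) -> U (x U' - x U)) ->
    exists y, forall U, op U -> U (y - x U) }.

End Subspaces.

(* Finite direct sums are chosen, over arbitrary finite index types; the empty
   one is a zero object. *)
Record addCat (K : fieldType) : Type := AddCat {
  ob :> Type;
  hom : ob -> ob -> lmodType K;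
  idm : forall X, hom X X;
  comp : forall X Y Z, hom Y Z -> hom X Y -> hom X Z;
  comp1m : forall X Y (f : hom X Y), comp (idm Y) f = f;
  compm1 : forall X Y (f : hom X Y), comp f (idm X) = f;
  compA : forall X Y Z W (h : hom Z W) (g : hom Y Z) (f : hom X Y),
    comp h (comp g f) = comp (comp h g) f;
  comp_linl : forall X Y Z (f : hom X Y) (a : K) (g g' : hom Y Z),
    comp (a *: g + g') f = a *: comp g f + comp g' f;
  comp_linr : forall X Y Z (g : hom Y Z) (a : K) (f f' : hom X Y),
    comp g (a *: f + f') = a *: comp g f + comp g f';
  dsum : forall I : finType, (I -> ob) -> ob;
  dinj : forall (I : finType) (F : I -> ob) i, hom (F i) (dsum F);
  dproj : forall (I : finType) (F : I -> ob) i, hom (dsum F) (F i);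
  dproj_inj : forall (I : finType) (F : I -> ob) i,
    comp (dproj F i) (dinj F i) = idm (F i);
  dproj_inj0 : forall (I : finType) (F : I -> ob) i j, i != j ->
    comp (dproj F j) (dinj F i) = 0;
  dsum_id : forall (I : finType) (F : I -> ob),
    \sum_i comp (dinj F i) (dproj F i) = idm (dsum F) }.

Arguments idm {K C} X : rename.
Arguments comp {K C X Y Z} g f : rename.
Arguments dsum {K C I} F : rename.
Arguments dinj {K C I} F i : rename.
Arguments dproj {K C I} F i : rename.
Notation "g \oc f" := (comp g f) : ring_scope.

Section Additive.
Variables (K : fieldType) (C : addCat K).
Implicit Types X Y Z T U : C.

Definition pairF X Y (b : bool) : C := if b then X else Y.
Definition dsum2 X Y : C := dsum (pairF X Y).

Definition is_iso X Y (f : hom X Y) : Prop :=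
  exists g : hom Y X, g \oc f = idm X /\ f \oc g = idm Y.
Definition iso X Y : Prop := exists f : hom X Y, is_iso f.

Definition is_zero X : Prop := idm X = 0.

Definition indecomposable X : Prop :=
  ~ is_zero X /\ forall Y Z, iso X (dsum2 Y Z) -> is_zero Y \/ is_zero Z.

Definition local_end X : Prop :=
  ~ is_zero X /\ forall f : hom X X, is_iso f \/ is_iso (idm X - f).

Definition krull_schmidt : Prop :=
  forall X, exists (n : nat) (F : 'I_n -> C),
    (forall i, local_end (F i)) /\ iso X (dsum F).

(* [X] is a direct summand of a finite direct sum of copies of [T]. *)
Definition in_add T X : Prop :=
  exists (n : nat) (Y : C), iso (dsum2 X Y) (dsum (fun _ : 'I_n => T)).

(* [pc_comp] says that composition factors through a continuous map on the
   completed tensor product; as open subspaces have finite codimension, this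
   amounts to joint continuity. *)
Record pc_enrichment : Type := PcEnrichment {
  pc_open : forall X Y, (hom X Y -> Prop) -> Prop;
  pc_open_pc : forall X Y, pseudocompact (@pc_open X Y);
  pc_comp : forall X Y Z (O : hom X Z -> Prop), pc_open O ->
    exists (U1 : hom Y Z -> Prop) (U2 : hom X Y -> Prop),
      [/\ pc_open U1, pc_open U2
        & forall (g : hom Y Z) (f : hom X Y), U1 g \/ U2 f -> O (g \oc f)] }.

(* The radical of [C]; restricted to [add T], it is the radical of [add T]. *)
Definition rad X Y (f : hom X Y) : Prop :=
  forall g : hom Y X, is_iso (idm X - g \oc f).

(* The square of the radical of [add T] *)
Definition rad2 T X Y (f : hom X Y) : Prop :=
  exists (n : nat) (Z : 'I_n -> C)
         (a : forall l, hom X (Z l)) (b : forall l, hom (Z l) Y),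
    [/\ forall l, in_add T (Z l),
        forall l, rad (a l) /\ rad (b l)
      & f = \sum_l b l \oc a l].

Definition left_approx U X E (f : hom X E) : Prop :=
  in_add U E /\
  forall Z (h : hom X Z), in_add U Z -> exists h' : hom E Z, h = h' \oc f.
Definition right_approx U E X (f : hom E X) : Prop :=
  in_add U E /\
  forall Z (h : hom Z X), in_add U Z -> exists h' : hom Z E, h = f \oc h'.
Definition left_minimal X E (f : hom X E) : Prop :=
  forall e : hom E E, e \oc f = f -> is_iso e.
Definition right_minimal E X (f : hom E X) : Prop :=
  forall e : hom E E, f \oc e = f -> is_iso e.

Lemma comp0m X Y Z (f : hom X Y) : (0 : hom Y Z) \oc f = 0.
Proof.
have := comp_linl f 1 (0 : hom Y Z) 0; rewrite !scale1r addr0.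
by move/(congr1 (fun x => x - (0 \oc f))); rewrite subrr addrK => <-.
Qed.

Lemma compm0 X Y Z (g : hom Y Z) : g \oc (0 : hom X Y) = 0.
Proof.
have := comp_linr g 1 (0 : hom X Y) 0; rewrite !scale1r addr0.
by move/(congr1 (fun x => x - (g \oc 0))); rewrite subrr addrK => <-.
Qed.

Lemma compDl X Y Z (f : hom X Y) (g g' : hom Y Z) :
  (g + g') \oc f = g \oc f + g' \oc f.
Proof. by have := comp_linl f 1 g g'; rewrite !scale1r. Qed.

Lemma compDr X Y Z (g : hom Y Z) (f f' : hom X Y) :
  g \oc (f + f') = g \oc f + g \oc f'.
Proof. by have := comp_linr g 1 f f'; rewrite !scale1r. Qed.

Lemma comp_suml X Y Z (I : Type) (s : seq I) (P : pred I) (G : I -> hom Y Z)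
    (f : hom X Y) :
  (\sum_(i <- s | P i) G i) \oc f = \sum_(i <- s | P i) (G i \oc f).
Proof.
by apply: (big_morph (fun g => g \oc f)) => [g g'|]; [exact: compDl | exact: comp0m].
Qed.

Lemma comp_sumr X Y Z (I : Type) (s : seq I) (P : pred I) (g : hom Y Z)
    (G : I -> hom X Y) :
  g \oc (\sum_(i <- s | P i) G i) = \sum_(i <- s | P i) (g \oc G i).
Proof.
by apply: (big_morph (fun f => g \oc f)) => [f f'|]; [exact: compDr | exact: compm0].
Qed.

Lemma biprod_iso X X' Y (i : hom X Y) (p : hom Y X) (i' : hom X' Y)
    (p' : hom Y X') :
    p \oc i = idm X -> p' \oc i' = idm X' -> p' \oc i = 0 -> p \oc i' = 0 ->
    i \oc p + i' \oc p' = idm Y ->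
  iso (dsum2 X X') Y.
Proof.
move=> pi p'i' p'i pi' ip.
pose F := pairF X X'.
pose f : hom (dsum F) Y := i \oc dproj F true + i' \oc dproj F false.
pose g : hom Y (dsum F) := dinj F true \oc p + dinj F false \oc p'.
have pr_tt : dproj F true \oc dinj F true = idm X by exact: (dproj_inj F true).
have pr_ff : dproj F false \oc dinj F false = idm X' by exact: (dproj_inj F false).
have pr_tf : (dproj F true : hom (dsum F) X) \oc (dinj F false : hom X' (dsum F)) = 0.
  exact: (dproj_inj0 F (i := false) (j := true)).
have pr_ft : (dproj F false : hom (dsum F) X') \oc (dinj F true : hom X (dsum F)) = 0.
  exact: (dproj_inj0 F (i := true) (j := false)).
have := dsum_id F; rewrite big_bool /= => dF.
exists f, g; split.
- rewrite /g /f compDl !compDr !compA.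
  rewrite -!(compA _ p) -!(compA _ p') pi p'i' pi' p'i.
  by rewrite !compm0 !comp0m !compm1 addr0 add0r.
- rewrite /g /f compDl !compDr !compA.
  rewrite -!(compA _ (dproj F true)) -!(compA _ (dproj F false)).
  rewrite pr_tt pr_ff pr_tf pr_ft.
  by rewrite !compm0 !comp0m !compm1 addr0 add0r.
Qed.

Lemma iso_trans X Y Z : iso X Y -> iso Y Z -> iso X Z.
Proof.
move=> [f [f' [f'f ff']]] [g [g' [g'g gg']]]; exists (g \oc f), (f' \oc g').
rewrite -!compA [g' \oc (_ \oc _)]compA [f \oc (_ \oc _)]compA.
by rewrite g'g ff' !comp1m.
Qed.

Lemma in_add_summand (I : finType) (F : I -> C) (i : I) :
  in_add (dsum F) (F i).
Proof.
pose F' (j : {j : I | j \in predC1 i}) : C := F (val j).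
pose F1 (_ : 'I_1) : C := dsum F.
have one1 : dinj F1 ord0 \oc dproj F1 ord0 = idm (dsum F1).
  by rewrite -(dsum_id F1) big_ord1.
pose u : hom (dsum F') (dsum F) := \sum_j dinj F (val j) \oc dproj F' j.
pose v : hom (dsum F) (dsum F') := \sum_j dinj F' j \oc dproj F (val j).
have vu : v \oc u = idm (dsum F').
  rewrite -dsum_id /v comp_suml; apply: eq_bigr => j _.
  rewrite -compA; congr (_ \oc _).
  rewrite /u comp_sumr (bigD1 j) //= compA dproj_inj comp1m big1 ?addr0 //.
  by move=> l lj; rewrite compA dproj_inj0 ?comp0m // (inj_eq val_inj).
have uv : dinj F i \oc dproj F i + u \oc v = idm (dsum F).
  rewrite -dsum_id (bigD1 i) //=; congr (_ + _).
  rewrite /u comp_suml.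
  rewrite (eq_bigr (fun j => dinj F (val j) \oc dproj F (val j))) => [|j _].
    by rewrite -(big_sub (predC1 i) (fun j => dinj F j \oc dproj F j)).
  rewrite -compA; congr (_ \oc _).
  rewrite /v comp_sumr (bigD1 j) //= compA dproj_inj comp1m big1 ?addr0 //.
  by move=> l lj; rewrite compA dproj_inj0 ?comp0m.
have iu : dproj F i \oc u = 0.
  rewrite /u comp_sumr big1 // => j _.
  by rewrite compA dproj_inj0 ?comp0m //; exact: (valP j).
have vi : v \oc dinj F i = 0.
  rewrite /v comp_suml big1 // => j _.
  by rewrite -compA dproj_inj0 ?compm0 // eq_sym; exact: (valP j).
exists 1%N, (dsum F').
apply: (@iso_trans _ (dsum F)).
  exact: (biprod_iso (dproj_inj F i) vu vi iu uv).
by exists (dinj F1 ord0), (dproj F1 ord0); split => //; exact: dproj_inj.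
Qed.

End Additive.

Notation "X \oplus Y" := (dsum2 X Y) : ring_scope.
Notation "X \cong Y" := (iso X Y) : ring_scope.

Section SplitK0.
Variables (K : fieldType) (C : addCat K) (T : C).

Definition addob : Type := {X : C | in_add T X}.

Definition fgclass (X : addob) : {freeg {classic addob} / int} :=
  << (X : {classic addob}) >>.

Definition K0_rel (x : {freeg {classic addob} / int}) : Prop :=
  (exists X Y : addob, sval X \cong sval Y /\ x = fgclass X - fgclass Y) \/
  (exists X Y Z : addob, sval Z \cong sval X \oplus sval Y /\
     x = fgclass Z - fgclass X - fgclass Y).

(* The subgroup generated by the relations [K0_rel] *)
Definition K0_null : {pred {freeg {classic addob} / int}} := fun x =>
  `[< forall H : {freeg {classic addob} / int} -> Prop,
        H 0 -> (forall y z, H y -> H z -> H (y - z)) ->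
        (forall y, K0_rel y -> H y) -> H x >].

Fact K0_null_closed : zmod_closed K0_null.
Proof.
split=> [|x y /asboolP Hx /asboolP Hy]; apply/asboolP => H H0 HB Hr.
  exact: H0.
by apply: (HB); [exact: Hx | exact: Hy].
Qed.

HB.instance Definition _ :=
  GRing.isZmodClosed.Build {freeg {classic addob} / int} K0_null K0_null_closed.

Definition K0 : zmodType := Quotient.quot K0_null.

Definition K0class (X : addob) : K0 := \pi_(Quotient.quot K0_null)%qT (fgclass X).

End SplitK0.

(* The class [F_i] in the split Grothendieck group of add (\bigoplus_i F_i) *)
Definition summand_class (K : fieldType) (C : addCat K) (I : finType)
    (F : I -> C) (i : I) : K0 (dsum F) :=
  K0class (exist _ (F i) (in_add_summand F i)).

Section ExactAxioms.
Variables (K : fieldType) (C : addCat K).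
Variable confl : forall X Y Z : C, hom X Y -> hom Y Z -> Prop.

Definition is_kernel (X Y Z : C) (f : hom X Y) (g : hom Y Z) : Prop :=
  g \oc f = 0 /\
  forall W (h : hom W Y), g \oc h = 0 -> exists! h' : hom W X, f \oc h' = h.
Definition is_cokernel (X Y Z : C) (f : hom X Y) (g : hom Y Z) : Prop :=
  g \oc f = 0 /\
  forall W (h : hom Y W), h \oc f = 0 -> exists! h' : hom Z W, h' \oc g = h.

Definition is_inflation (X Y : C) (f : hom X Y) : Prop :=
  exists Z (g : hom Y Z), confl f g.
Definition is_deflation (Y Z : C) (g : hom Y Z) : Prop :=
  exists X (f : hom X Y), confl f g.

Definition is_pushout (X Y X' Y' : C) (f : hom X Y) (a : hom X X')
    (b : hom Y Y') (f' : hom X' Y') : Prop :=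
  b \oc f = f' \oc a /\
  forall W (u : hom Y W) (v : hom X' W), u \oc f = v \oc a ->
    exists! w : hom Y' W, w \oc b = u /\ w \oc f' = v.
Definition is_pullback (Y Z Y' Z' : C) (g : hom Y Z) (a : hom Z' Z)
    (b : hom Y' Y) (g' : hom Y' Z') : Prop :=
  g \oc b = a \oc g' /\
  forall W (u : hom W Y) (v : hom W Z'), g \oc u = a \oc v ->
    exists! w : hom W Y', b \oc w = u /\ g' \oc w = v.

(* Quillen's axioms for an exact structure *)
Record exact_axioms : Prop := ExactAxioms {
  ex_ker : forall X Y Z (f : hom X Y) (g : hom Y Z),
    confl f g -> is_kernel f g /\ is_cokernel f g;
  ex_iso : forall X Y Z X' Y' Z' (f : hom X Y) (g : hom Y Z)
      (f' : hom X' Y') (g' : hom Y' Z') (a : hom X X') (b : hom Y Y')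
      (c : hom Z Z'),
    is_iso a -> is_iso b -> is_iso c -> b \oc f = f' \oc a ->
    c \oc g = g' \oc b -> confl f g -> confl f' g';
  ex_infl1 : forall X, is_inflation (idm X);
  ex_defl1 : forall X, is_deflation (idm X);
  ex_infl_comp : forall X Y Z (f : hom X Y) (g : hom Y Z),
    is_inflation f -> is_inflation g -> is_inflation (g \oc f);
  ex_defl_comp : forall X Y Z (f : hom X Y) (g : hom Y Z),
    is_deflation f -> is_deflation g -> is_deflation (g \oc f);
  ex_pushout : forall X Y X' (f : hom X Y) (a : hom X X'), is_inflation f ->
    exists Y' (b : hom Y Y') (f' : hom X' Y'),
      is_pushout f a b f' /\ is_inflation f';
  ex_pullback : forall Y Z Z' (g : hom Y Z) (a : hom Z' Z), is_deflation g ->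
    exists Y' (b : hom Y' Y) (g' : hom Y' Z'),
      is_pullback g a b g' /\ is_deflation g' }.

End ExactAxioms.

Record exactCat (K : fieldType) : Type := ExactCat {
  exact_addCat :> addCat K;
  confl : forall X Y Z : exact_addCat, hom X Y -> hom Y Z -> Prop;
  confl_axioms : exact_axioms confl }.

Arguments confl {K C X Y Z} f g : rename.

Section Frobenius.
Variables (K : fieldType) (C : exactCat K).
Implicit Types X Y Z T U : C.

Definition inflation X Y (f : hom X Y) : Prop := is_inflation (@confl K C) f.
Definition deflation Y Z (g : hom Y Z) : Prop := is_deflation (@confl K C) g.

Definition projective P : Prop :=
  forall Y Z (g : hom Y Z) (f : hom P Z), deflation g ->
    exists f' : hom P Y, g \oc f' = f.
Definition injective_ob J : Prop :=
  forall X Y (f : hom X Y) (g : hom X J), inflation f ->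
    exists g' : hom Y J, g' \oc f = g.

Definition frobenius : Prop :=
  [/\ forall X, exists (P : C) (p : hom P X), projective P /\ deflation p,
      forall X, exists (J : C) (i : hom X J), injective_ob J /\ inflation i
    & forall X, projective X <-> injective_ob X].

Definition split_epi Y Z (g : hom Y Z) : Prop :=
  exists s : hom Z Y, g \oc s = idm Z.

(* Ext^1(X, Y) = 0, for Yoneda extensions *)
Definition Ext1_zero X Y : Prop :=
  forall E (f : hom Y E) (g : hom E X), confl f g -> split_epi g.

(* Morphisms that vanish in the stable category *)
Definition stably_zero X Y (f : hom X Y) : Prop :=
  exists (P : C) (u : hom X P) (v : hom P Y), projective P /\ f = v \oc u.

Definition stably_hom_finite : Prop :=
  forall X Y, finite_codim (@stably_zero X Y).

(* A choice of conflations [X -> I X -> Sigma X] with [I X] injective *)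
Record suspension : Type := Suspension {
  sus_hull : C -> C;
  sus : C -> C;
  sus_in : forall X, hom X (sus_hull X);
  sus_out : forall X, hom (sus_hull X) (sus X);
  sus_hull_inj : forall X, injective_ob (sus_hull X);
  sus_confl : forall X, confl (sus_in X) (sus_out X) }.

(* [g] represents [Sigma f] in the stable category. *)
Definition sus_map (S : suspension) X Y (f : hom X Y)
    (g : hom (sus S X) (sus S Y)) : Prop :=
  exists h : hom (sus_hull S X) (sus_hull S Y),
    h \oc sus_in S X = sus_in S Y \oc f /\
    g \oc sus_out S X = sus_out S Y \oc h.

(* Linear isomorphisms from the stable Hom(Y, Sigma^2 X) to the dual of the
   stable Hom(X, Y), natural in X and Y. *)
Record CY2_duality (S : suspension)
    (phi : forall X Y, hom Y (sus S (sus S X)) -> hom X Y -> K) : Prop :=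
  CY2Duality {
  cy_linl : forall X Y (a : K) (h h' : hom Y (sus S (sus S X))) (f : hom X Y),
    phi _ _ (a *: h + h') f = a * phi _ _ h f + phi _ _ h' f;
  cy_linr : forall X Y (a : K) (h : hom Y (sus S (sus S X))) (f f' : hom X Y),
    phi _ _ h (a *: f + f') = a * phi _ _ h f + phi _ _ h f';
  cy_stabr : forall X Y (h : hom Y (sus S (sus S X))) (f : hom X Y),
    stably_zero f -> phi _ _ h f = 0;
  cy_stabl : forall X Y (h : hom Y (sus S (sus S X))) (f : hom X Y),
    stably_zero h -> phi _ _ h f = 0;
  cy_inj : forall X Y (h : hom Y (sus S (sus S X))),
    (forall f : hom X Y, phi _ _ h f = 0) -> stably_zero h;
  cy_surj : forall X Y (psi : hom X Y -> K),
    (forall (a : K) f f', psi (a *: f + f') = a * psi f + psi f') ->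
    (forall f, stably_zero f -> psi f = 0) ->
    exists h : hom Y (sus S (sus S X)), forall f, phi _ _ h f = psi f;
  cy_natY : forall X Y Y' (b : hom Y Y') (h : hom Y' (sus S (sus S X)))
      (f : hom X Y),
    phi _ _ (h \oc b) f = phi _ _ h (b \oc f);
  cy_natX : forall X X' Y (a : hom X X') (sa : hom (sus S X) (sus S X'))
      (ssa : hom (sus S (sus S X)) (sus S (sus S X')))
      (h : hom Y (sus S (sus S X))) (f : hom X' Y),
    sus_map a sa -> sus_map sa ssa -> phi _ _ (ssa \oc h) f = phi _ _ h (f \oc a) }.

Definition stably_2CY : Prop :=
  stably_hom_finite /\
  exists (S : suspension)
         (phi : forall X Y, hom Y (sus S (sus S X)) -> hom X Y -> K),
    CY2_duality phi.

Definition rigid X : Prop := Ext1_zero X X.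

(* [dsum F] is a basic cluster-tilting object with indecomposable summands
   [F i]. *)
Definition cluster_tilting (I : finType) (F : I -> C) : Prop :=
  [/\ forall i, indecomposable (F i),
      forall i j, i != j -> ~ F i \cong F j,
      rigid (dsum F)
    & forall X, Ext1_zero (dsum F) X -> in_add (dsum F) X].

Definition index_of T X (x : K0 T) : Prop :=
  (exists (T1 T2 : addob T) (f : hom (sval T2) (sval T1)) (g : hom (sval T1) X),
     confl f g) /\
  (forall (T1 T2 : addob T) (f : hom (sval T2) (sval T1)) (g : hom (sval T1) X),
     confl f g -> x = K0class T1 - K0class T2).

(* A quiver on 'I_m is given by its numbers [q i j] of arrows i -> j. *)
Definition endoquiver m (F : 'I_m -> C) (q : 'M[nat]_m) : Prop :=
  forall i j, quot_dim (@rad K C (F i) (F j)) (@rad2 K C (dsum F) (F i) (F j))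
                (q i j).

End Frobenius.

(* Add an arrow i -> j for each path i -> k -> j, reverse the arrows at k, and
   cancel 2-cycles (and loops). *)
Definition quiver_mut m (k : 'I_m) (q : 'M[nat]_m) : 'M[nat]_m :=
  \matrix_(i, j) if (i == k) || (j == k) then q j i
    else ((q i j + q i k * q k j) - (q j i + q j k * q k i))%N.

Definition exchange_mx m (q : 'M[nat]_m) : 'M[int]_m :=
  \matrix_(i, j) ((q i j)%:Z - (q j i)%:Z).

Definition matrix_mut r (k : 'I_r) (M : 'M[int]_(r + r, r)) : 'M[int]_(r + r, r) :=
  \matrix_(i, j) if (i == lshift r k) || (j == k) then - M i j
    else M i j + Num.sg (M i k) * Num.max (M i k * M (lshift r k) j) 0.

(* [M] is the mutated 2r x r matrix at a vertex of the tree; its lower block has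
   the c-vectors as columns. *)
Definition green r (M : 'M[int]_(r + r, r)) (k : 'I_r) : bool :=
  [forall i, 0 <= dsubmx M i k].

(* A vertex is the sequence of labels of the shortest path from the initial
   vertex t_0, which never crosses the same edge twice in a row. *)
Definition tree (r : nat) : Type :=
  {t : seq 'I_r | sorted [rel i j | i != j] t}.

Definition tree_root r : tree r := exist _ [::] isT.

Definition edge r (k : 'I_r) (t t' : tree r) : Prop :=
  sval t' = rcons (sval t) k \/ sval t = rcons (sval t') k.

(* The labels along the shortest path from [s] to [t] *)
Fixpoint labels_between r (s t : seq 'I_r) : seq 'I_r :=
  match s, t with
  | i :: s', j :: t' => if i == j then labels_between s' t' else rev s ++ t
  | _, _ => rev s ++ t
  end.

Section GVectors.
Variables r n : nat.

(* Vertices [lshift n k] are mutable, vertices [rshift r k] are frozen. *)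
Definition tree_quiver (Q0 : 'M[nat]_(r + n)) (t : tree r) : 'M[nat]_(r + n) :=
  foldl (fun q k => quiver_mut (lshift n k) q) Q0 (sval t).

Definition init_mx (q : 'M[nat]_(r + n)) : 'M[int]_(r + r, r) :=
  col_mx (ulsubmx (exchange_mx q)) 1%:M.

(* Column [j] of [G] is the extended g-vector of index [j]. *)
Definition gvec_mut (k : 'I_r) (q : 'M[nat]_(r + n)) (M : 'M[int]_(r + r, r))
    (G : 'M[int]_(r + n)) : 'M[int]_(r + n) :=
  let k' := lshift n k in
  \matrix_(i, j) if j == k' then
      - G i k' + (if green M k then \sum_l G i l *+ q k' l
                  else \sum_l G i l *+ q l k')
    else G i j.

(* The quiver Q(t), the mutated 2r x r matrix and the g-vectors at the end of
   the path with labels [s], starting from a vertex with quiver [q]. *)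
Definition seed_along (q : 'M[nat]_(r + n)) (s : seq 'I_r) :
    'M[nat]_(r + n) * 'M[int]_(r + r, r) * 'M[int]_(r + n) :=
  foldl (fun '(q, M, G) k =>
           (quiver_mut (lshift n k) q, matrix_mut k M, gvec_mut k q M G))
        (q, init_mx q, 1%:M) s.

(* g_{ij}^{t1}(t2), the i-th coordinate of the j-th vector *)
Definition gvector (Q0 : 'M[nat]_(r + n)) (t1 t2 : tree r) (i j : 'I_(r + n)) :
    int :=
  (seed_along (tree_quiver Q0 t1) (labels_between (sval t1) (sval t2))).2 i j.

End GVectors.

Section ClusterStructure.
Variables (K : fieldType) (C : exactCat K).

Definition replace m (F : 'I_m -> C) (k : 'I_m) (X : C) (i : 'I_m) : C :=
  if i == k then X else F i.

Definition rest m (F : 'I_m -> C) (k : 'I_m) : C :=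
  dsum (fun i : {i : 'I_m | i \in predC1 k} => F (val i)).

(* [X] is a possible [F_k^*]. *)
Definition mutated_summand m (F : 'I_m -> C) (k : 'I_m) (X : C) : Prop :=
  [/\ indecomposable X, ~ X \cong F k & cluster_tilting (replace F k X)].

(* A non-split conflation [X -> E -> Y] whose maps are minimal [add U]-approximations *)
Definition exchange_conflation (U X Y : C) : Prop :=
  exists (E : C) (f : hom X E) (g : hom E Y),
    [/\ confl f g, ~ split_epi g,
        left_approx U f /\ left_minimal f
      & right_approx U g /\ right_minimal g].

Record cluster_structure : Prop := ClusterStructure {
  cs_mutation : forall m (F : 'I_m -> C) k,
    cluster_tilting F -> ~ projective (F k) ->
    exists X, mutated_summand F k X /\
      forall X', mutated_summand F k X' -> X' \cong X;
  cs_exchange : forall m (F : 'I_m -> C) k X,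
    cluster_tilting F -> ~ projective (F k) -> mutated_summand F k X ->
    exchange_conflation (rest F k) X (F k) /\
    exchange_conflation (rest F k) (F k) X;
  cs_quiver : forall m (F : 'I_m -> C), cluster_tilting F ->
    exists q, [/\ endoquiver F q, forall i, q i i = 0%N
      & forall i j, q i j = 0%N \/ q j i = 0%N];
  cs_quiver_mut : forall m (F : 'I_m -> C) k X q q',
    cluster_tilting F -> ~ projective (F k) -> mutated_summand F k X ->
    endoquiver F q -> endoquiver (replace F k X) q' ->
    forall i j, ~ (projective (F i) /\ projective (F j)) ->
      q' i j = quiver_mut k q i j }.

Definition mutation_family r n (T0 : 'I_(r + n) -> C)
    (T : tree r -> 'I_(r + n) -> C) : Prop :=
  (forall j, T (tree_root r) j = T0 j) /\
  forall (t t' : tree r) (k : 'I_r), edge k t t' ->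
    (forall j, j != lshift n k -> T t' j = T t j) /\
    mutated_summand (T t) (lshift n k) (T t' (lshift n k)).

End ClusterStructure.

(* Main.v *)
Require Import Defs.
From mathcomp Require Import all_boot all_order all_algebra.
From mathcomp Require Import generic_quotient ring_quotient boolp.
Import Defs.

Set Implicit Arguments.
Unset Strict Implicit.
Unset Printing Implicit Defensive.
Import Order.TTheory GRing.Theory Num.Theory.
Local Open Scope ring_scope.

(** Write T for the cluster-tilting object at t1, and let X = T_k(t) and
    X' = T_k(t') for an edge labeled k between t and t'. The indices of the
    T_j(t) are computed along the path from t1 to t2, by comparing at each edge
    the exchange conflations X' -> E -> X and X -> E' -> X'.

    The index with respect to T is additive on conflations that Hom(T, -) keeps
    exact ([index_of_confl]). By the 2-Calabi-Yau duality and the rigidity of T,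
    at least one of the two exchange conflations has this property
    ([exchange_dichotomy]), so that ind(X) + ind(X') is ind(E) or ind(E').
    The middle terms are read off the quiver: the maps E -> X and X -> E' are
    minimal almost split in add(T(t)), because the absence of loops lets every
    radical endomorphism of X factor through the other summands
    ([rad_through_rest]); hence the multiplicity of T_l(t) in E is the number of
    arrows l -> k, and in E' it is the number of arrows k -> l ([count_arrows],
    [exchange_right], [exchange_left]). These are the two recursions for
    g-vectors.

    It remains to see that the c-vector at k selects the right one. The entry
    (i, k) of the lower block turns out to be the coefficient of T_k(t) in the
    coindex of T_i = T_i(t1) with respect to T(t), that is, in [U1] - [U2] for a
    conflation T_i -> U1 -> U2 with terms in add(T(t)). If every map T_i -> X
    factors through E, then U1 can be chosen without X, so this coefficient is
    some -c <= 0, and replacing the c copies of X in U2 by E - X' gives the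
    coindex of T_i with respect to T(t'). This is [coindex_mutation]; it shows
    that k is red, and that the coindices mutate like the columns of the matrix.
    If the other conflation is exact under Hom(T, -), the same lemma applies
    with the roles of t and t' exchanged, and k is green. The two cases exclude
    each other because the c-vectors remain linearly independent, hence nonzero.

    All of this is carried along the path as the invariant [seed_at]. *)

(** * Morphisms in additive categories *)

Section Additive.
Variables (K : fieldType) (C : addCat K).
Implicit Types A X Y Z T U : C.

Lemma compNl X Y Z (g : hom Y Z) (f : hom X Y) : (- g) \oc f = - (g \oc f).
Proof. by have := comp_linl f (-1) g 0; rewrite !scaleN1r comp0m !addr0. Qed.

Lemma compNr X Y Z (g : hom Y Z) (f : hom X Y) : g \oc (- f) = - (g \oc f).
Proof. by have := comp_linr g (-1) f 0; rewrite !scaleN1r compm0 !addr0. Qed.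

Lemma compBl X Y Z (g g' : hom Y Z) (f : hom X Y) :
  (g - g') \oc f = g \oc f - g' \oc f.
Proof. by rewrite compDl compNl. Qed.

Lemma compBr X Y Z (g : hom Y Z) (f f' : hom X Y) :
  g \oc (f - f') = g \oc f - g \oc f'.
Proof. by rewrite compDr compNr. Qed.

Lemma compZl X Y Z (a : K) (g : hom Y Z) (f : hom X Y) :
  (a *: g) \oc f = a *: (g \oc f).
Proof. by have := comp_linl f a g 0; rewrite comp0m !addr0. Qed.

Lemma compZr X Y Z (a : K) (g : hom Y Z) (f : hom X Y) :
  g \oc (a *: f) = a *: (g \oc f).
Proof. by have := comp_linr g a f 0; rewrite compm0 !addr0. Qed.

Lemma is_iso_id X : is_iso (idm X).
Proof. by exists (idm X); rewrite comp1m. Qed.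

Lemma iso_refl X : X \cong X.
Proof. by exists (idm X); exact: is_iso_id. Qed.

Lemma iso_sym X Y : X \cong Y -> Y \cong X.
Proof. by case=> f [g [gf fg]]; exists g, f. Qed.

Lemma is_iso_comp X Y Z (g : hom Y Z) (f : hom X Y) :
  is_iso g -> is_iso f -> is_iso (g \oc f).
Proof.
move=> [g' [g'g gg']] [f' [f'f ff']]; exists (f' \oc g').
rewrite compA -(compA f') g'g compm1 f'f.
by rewrite compA -(compA g) ff' compm1 gg'.
Qed.

Lemma is_iso_inverses X Y (f : hom X Y) (g g' : hom Y X) :
  g \oc f = idm X -> f \oc g' = idm Y -> is_iso f.
Proof.
move=> gf fg'; exists g; split=> //; suff -> : g = g' by [].
by rewrite -[g]compm1 -fg' compA gf comp1m.
Qed.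

Lemma is_isoZ X Y (a : K) (f : hom X Y) : a != 0 -> is_iso f -> is_iso (a *: f).
Proof.
move=> a0 [g [gf fg]]; exists (a^-1 *: g).
by rewrite !compZl !compZr gf fg !scalerA mulVf // mulfV // !scale1r.
Qed.

Lemma is_iso0 X Y : is_iso (0 : hom X Y) -> is_zero X.
Proof. by case=> g [gf _]; rewrite /is_zero -gf compm0. Qed.

(** Jacobson's trick: if [w] inverts [1 - fg], then [1 + gwf] inverts [1 - gf].
    It makes the radical left-right symmetric. *)
Lemma is_iso_1Bcomp X Y (g : hom Y X) (f : hom X Y) :
  is_iso (idm Y - f \oc g) -> is_iso (idm X - g \oc f).
Proof.
case=> w [wl wr].
have wl' : w = idm Y + w \oc f \oc g.
  by rewrite -wl compBr compm1 compA subrK.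
have wr' : w = idm Y + f \oc g \oc w.
  by rewrite -wr compBl comp1m subrK.
have e : g \oc f + g \oc w \oc f \oc g \oc f = g \oc w \oc f.
  by rewrite {2}wl' compDr compm1 compDl !compA.
have e' : g \oc f + g \oc f \oc g \oc w \oc f = g \oc w \oc f.
  by rewrite {2}wr' compDr compm1 compDl !compA.
exists (idm X + g \oc w \oc f); split.
  rewrite compBr compm1 compDl comp1m compA e.
  by rewrite addrK.
rewrite compDr compm1 compBl comp1m !compA -{1}e' addrK.
by rewrite subrK.
Qed.

(** * Local endomorphism rings and the radical *)

Lemma local_iso X Y : X \cong Y -> local_end X -> local_end Y.
Proof.
move=> [f [g [gf fg]]] [nz loc]; split=> [z|h].
  by apply: nz; rewrite /is_zero -gf -[g]compm1 z compm0 comp0m.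
have key (u : hom X X) : is_iso u -> is_iso (f \oc u \oc g).
  by move=> iu; do 2?apply: is_iso_comp => //; [exists g | exists f].
case: (loc (g \oc h \oc f)) => /key i; [left|right].
  by move: i; rewrite !compA fg comp1m -compA fg compm1.
by move: i; rewrite compBr compm1 compBl fg !compA fg comp1m -compA fg compm1.
Qed.

(** The idempotent [f g] of [X] is invertible or [1 - f g] is, and the latter
    would force [f = 0]. *)
Lemma local_retract X Y (f : hom Y X) (g : hom X Y) :
  local_end X -> ~ is_zero Y -> g \oc f = idm Y -> is_iso f.
Proof.
move=> [_ loc] nzY gf; case: (loc (f \oc g)) => -[w [wl wr]].
  by apply: (@is_iso_inverses _ _ _ g (g \oc w)); rewrite // compA.
case: nzY; rewrite /is_zero -gf.
suff -> : f = 0 by rewrite compm0.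
by rewrite -[f]comp1m -wl -compA compBl -compA gf compm1 comp1m subrr compm0.
Qed.

Lemma local_add X (f g : hom X X) :
  local_end X -> is_iso (f + g) -> is_iso f \/ is_iso g.
Proof.
move=> [_ loc] [w [wl wr]].
have iw : is_iso (f + g) by exists w.
have back (h : hom X X) : is_iso (w \oc h) -> is_iso h.
  move=> /(is_iso_comp iw); by rewrite compA wr comp1m.
case: (loc (w \oc f)) => i; [left|right]; apply: back => //.
by rewrite -wl compDr addrAC subrr add0r in i.
Qed.

Lemma local_sum X (I : Type) (s : seq I) (f : I -> hom X X) :
  local_end X -> is_iso (\sum_(i <- s) f i) -> exists i, is_iso (f i).
Proof.
move=> loc; elim: s => [|i s IHs]; first by rewrite big_nil => /is_iso0; case: loc.
by rewrite big_cons => /(local_add loc) [?|/IHs//]; exists i.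
Qed.

Lemma rad_compl X Y Z (h : hom Y Z) (f : hom X Y) : rad f -> rad (h \oc f).
Proof. by move=> rf g; rewrite compA. Qed.

Lemma rad_compr X Y Z (f : hom Y Z) (h : hom X Y) : rad f -> rad (f \oc h).
Proof. by move=> rf g; rewrite compA; apply: is_iso_1Bcomp; rewrite compA. Qed.

Lemma radD X Y (f f' : hom X Y) : rad f -> rad f' -> rad (f + f').
Proof.
move=> rf rf' g.
have [w [wl wr]] := rf g.
suff -> : idm X - g \oc (f + f') =
    (idm X - g \oc f) \oc (idm X - (w \oc g) \oc f').
  by apply: is_iso_comp; [exact: rf | exact: rf'].
by rewrite compBr compm1 !compA wr comp1m compDr opprD addrA.
Qed.

Lemma radZ X Y (a : K) (f : hom X Y) : rad f -> rad (a *: f).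
Proof.
move=> rf; have -> : a *: f = (a *: idm Y) \oc f by rewrite compZl comp1m.
exact: rad_compl.
Qed.

Lemma radN X Y (f : hom X Y) : rad f -> rad (- f).
Proof. by move=> rf; rewrite -scaleN1r; exact: radZ. Qed.

Lemma rad0 X Y : rad (0 : hom X Y).
Proof. by move=> g; rewrite compm0 subr0; exact: is_iso_id. Qed.

Lemma rad_sum X Y (I : Type) (s : seq I) (f : I -> hom X Y) :
  (forall i, rad (f i)) -> rad (\sum_(i <- s) f i).
Proof. by move=> rf; apply: big_ind => //; [exact: rad0 | exact: radD]. Qed.

Lemma rad_not_iso X (u : hom X X) : ~ is_zero X -> rad u -> ~ is_iso u.
Proof.
move=> nz ru [w [wu _]]; apply/nz/(@is_iso0 X X).
by have := ru w; rewrite wu subrr.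
Qed.

Lemma rad_local X (u : hom X X) : local_end X -> ~ is_iso u -> rad u.
Proof.
move=> loc nu g; have [_ /(_ (g \oc u))[i|//]] := loc.
case: nu; have [w [wgu _]] := i.
by apply: (local_retract (g := w \oc g)) => //; [case: loc | rewrite -compA].
Qed.


Lemma rad_not_split_epi X Z (h : hom Z X) :
  local_end X -> ~ (exists s, h \oc s = idm X) -> rad h.
Proof.
move=> [_ loc] ns g; apply: is_iso_1Bcomp.
have [[w [_ wr]]|//] := loc (h \oc g).
by case: ns; exists (g \oc w); rewrite compA.
Qed.

Lemma rad_not_split_mono X Z (h : hom X Z) :
  local_end X -> ~ (exists s, s \oc h = idm X) -> rad h.
Proof.
move=> [_ loc] ns g; have [[w [wl _]]|//] := loc (g \oc h).
by case: ns; exists (w \oc g); rewrite -compA.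
Qed.

Lemma rad_endoP X (u : hom X X) : local_end X -> is_iso u \/ rad u.
Proof.
move=> loc; have [i|ni] := pselect (is_iso u); first by left.
by right; apply: rad_local.
Qed.

Lemma rad_noniso X Y (f : hom X Y) :
  local_end X -> local_end Y -> ~ X \cong Y -> rad f.
Proof.
move=> lX lY nXY g; have [_ /(_ (g \oc f))[i|//]] := lX.
case: nXY; exists f; have [w [wgf _]] := i.
by apply: (local_retract (g := w \oc g)) => //; [case: lX | rewrite -compA].
Qed.

End Additive.

(** * Finite direct sums *)

Section DirectSums.
Variables (K : fieldType) (C : addCat K).
Implicit Types A X Y Z T U : C.

Definition inj1 X Y : hom X (X \oplus Y) := dinj (pairF X Y) true.
Definition inj2 X Y : hom Y (X \oplus Y) := dinj (pairF X Y) false.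
Definition prj1 X Y : hom (X \oplus Y) X := dproj (pairF X Y) true.
Definition prj2 X Y : hom (X \oplus Y) Y := dproj (pairF X Y) false.

Lemma prj1_inj1 X Y : prj1 X Y \oc inj1 X Y = idm X.
Proof. exact: (dproj_inj (pairF X Y) true). Qed.
Lemma prj2_inj2 X Y : prj2 X Y \oc inj2 X Y = idm Y.
Proof. exact: (dproj_inj (pairF X Y) false). Qed.
Lemma prj1_inj2 X Y : prj1 X Y \oc inj2 X Y = 0.
Proof. exact: (dproj_inj0 (pairF X Y) (i := false) (j := true)). Qed.
Lemma prj2_inj1 X Y : prj2 X Y \oc inj1 X Y = 0.
Proof. exact: (dproj_inj0 (pairF X Y) (i := true) (j := false)). Qed.
Lemma dsum2_id X Y :
  inj1 X Y \oc prj1 X Y + inj2 X Y \oc prj2 X Y = idm (X \oplus Y).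
Proof. by have := dsum_id (pairF X Y); rewrite big_bool. Qed.

Lemma comp_prj1_inj1 X Y Z (g : hom X Z) : g \oc prj1 X Y \oc inj1 X Y = g.
Proof. by rewrite -compA prj1_inj1 compm1. Qed.
Lemma comp_prj2_inj2 X Y Z (g : hom Y Z) : g \oc prj2 X Y \oc inj2 X Y = g.
Proof. by rewrite -compA prj2_inj2 compm1. Qed.
Lemma comp_prj1_inj2 X Y Z (g : hom X Z) : g \oc prj1 X Y \oc inj2 X Y = 0.
Proof. by rewrite -compA prj1_inj2 compm0. Qed.
Lemma comp_prj2_inj1 X Y Z (g : hom Y Z) : g \oc prj2 X Y \oc inj1 X Y = 0.
Proof. by rewrite -compA prj2_inj1 compm0. Qed.

Definition bipE := (compDl, compDr, compBl, compBr, compNl, compNr, compA,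
  comp0m, compm0, comp1m, compm1,
  prj1_inj1, prj2_inj2, prj1_inj2, prj2_inj1, comp_prj1_inj1, comp_prj2_inj2,
  comp_prj1_inj2, comp_prj2_inj1, add0r, addr0, subr0, sub0r).

Lemma dsum2P X Y Z : Z \cong X \oplus Y ->
  exists (i1 : hom X Z) (p1 : hom Z X) (i2 : hom Y Z) (p2 : hom Z Y),
    [/\ p1 \oc i1 = idm X, p2 \oc i2 = idm Y, p2 \oc i1 = 0, p1 \oc i2 = 0
      & i1 \oc p1 + i2 \oc p2 = idm Z].
Proof.
case=> f [g [gf fg]].
exists (g \oc inj1 X Y), (prj1 X Y \oc f), (g \oc inj2 X Y), (prj2 X Y \oc f).
split; rewrite ?compA -?(compA _ f g) ?fg ?bipE //.
by rewrite -compDl -!(compA g) -compDr dsum2_id compm1 gf.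
Qed.

Lemma dsum2_iso X X' Y Y' :
  X \cong X' -> Y \cong Y' -> X \oplus Y \cong X' \oplus Y'.
Proof.
move=> [f [f' [f'f ff']]] [g [g' [g'g gg']]].
apply: (@biprod_iso _ _ _ _ _ (inj1 X' Y' \oc f) (f' \oc prj1 X' Y')
  (inj2 X' Y' \oc g) (g' \oc prj2 X' Y')); rewrite ?bipE //.
by rewrite -(compA _ f) ff' -(compA _ g) gg' !compm1 dsum2_id.
Qed.

Lemma dsum2C X Y : X \oplus Y \cong Y \oplus X.
Proof.
apply: (@biprod_iso _ _ _ _ _ (inj2 Y X) (prj2 Y X) (inj1 Y X) (prj1 Y X));
  by rewrite ?bipE // addrC dsum2_id.
Qed.

Lemma dsum2A X Y Z : (X \oplus Y) \oplus Z \cong X \oplus (Y \oplus Z).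
Proof.
pose i1 := inj1 X (Y \oplus Z) \oc prj1 X Y
         + inj2 X (Y \oplus Z) \oc inj1 Y Z \oc prj2 X Y.
pose p1 := inj1 X Y \oc prj1 X (Y \oplus Z)
         + inj2 X Y \oc prj1 Y Z \oc prj2 X (Y \oplus Z).
apply: (@biprod_iso _ _ _ _ _ i1 p1 (inj2 X (Y \oplus Z) \oc inj2 Y Z)
   (prj2 Y Z \oc prj2 X (Y \oplus Z))); rewrite /i1 /p1 ?bipE //.
- by rewrite dsum2_id.
- rewrite -addrA -!(compA (inj2 _ _)) -compDr -!compA.
  rewrite !(compA (inj1 Y Z)) !(compA (inj2 Y Z)).
  by rewrite -compDl dsum2_id comp1m dsum2_id.
Qed.

Definition zero_ob : C := dsum (fun i : void => match i return C with end).

Lemma zero_obP : is_zero zero_ob.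
Proof. by rewrite /is_zero -dsum_id big1 // => -[]. Qed.

Lemma zero_to X Y (f : hom X Y) : is_zero X -> f = 0.
Proof. by move=> z; rewrite -[f]compm1 z compm0. Qed.

Lemma zero_iso X Y : is_zero X -> is_zero Y -> X \cong Y.
Proof. by move=> zX zY; exists 0, 0; rewrite !comp0m zX zY. Qed.

Lemma iso_zero X Y : X \cong Y -> is_zero X -> is_zero Y.
Proof. by case=> f [g [gf fg]] z; rewrite /is_zero -fg (zero_to f z) comp0m. Qed.

Lemma dsum2_zero X Y : is_zero Y -> X \oplus Y \cong X.
Proof.
move=> z; apply: (@biprod_iso _ _ _ _ _ (idm X) (idm X) 0 0);
  by rewrite ?bipE.
Qed.

Section Reindex.
Variables (I J : finType) (F : I -> C) (h : J -> I).

Definition dincl : hom (dsum (F \o h)) (dsum F) :=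
  \sum_j dinj F (h j) \oc dproj (F \o h) j.
Definition drest : hom (dsum F) (dsum (F \o h)) :=
  \sum_j dinj (F \o h) j \oc dproj F (h j).

Lemma drest_incl : injective h -> drest \oc dincl = idm _.
Proof.
move=> inj_h; rewrite -dsum_id /drest comp_suml; apply: eq_bigr => j _.
rewrite -compA; congr (_ \oc _).
rewrite /dincl comp_sumr (bigD1 j) //= compA dproj_inj comp1m big1 ?addr0 //.
by move=> l lj; rewrite compA dproj_inj0 ?comp0m // (inj_eq inj_h).
Qed.

Lemma dincl_rest : injective h ->
  dincl \oc drest = \sum_j dinj F (h j) \oc dproj F (h j).
Proof.
move=> inj_h; rewrite /dincl comp_suml; apply: eq_bigr => j _.
rewrite -compA; congr (_ \oc _).
rewrite /drest comp_sumr (bigD1 j) //= compA dproj_inj comp1m big1 ?addr0 //.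
by move=> l lj; rewrite compA dproj_inj0 ?comp0m // (inj_eq inj_h).
Qed.
End Reindex.

Lemma drest_incl0 (I J J' : finType) (F : I -> C) (h : J -> I) (h' : J' -> I) :
  (forall j j', h j != h' j') -> drest F h \oc dincl F h' = 0.
Proof.
move=> dis; rewrite /drest comp_suml big1 // => j _.
rewrite /dincl comp_sumr big1 // => j' _.
by rewrite compA -(compA _ (dproj F _)) dproj_inj0 ?compm0 ?comp0m // eq_sym.
Qed.

Lemma dsum_split n m (F : 'I_(n + m) -> C) :
  dsum (F \o lshift m) \oplus dsum (F \o @rshift n m) \cong dsum F.
Proof.
apply: (@biprod_iso _ _ _ _ _ (dincl F (lshift m)) (drest F (lshift m))
  (dincl F (@rshift n m)) (drest F (@rshift n m))).
- by apply: drest_incl; exact: lshift_inj.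
- by apply: drest_incl; exact: rshift_inj.
- by apply: drest_incl0 => i j; rewrite eq_rlshift.
- by apply: drest_incl0 => i j; rewrite eq_lrshift.
- rewrite dincl_rest; last exact: lshift_inj.
  rewrite dincl_rest; last exact: rshift_inj.
  by rewrite -dsum_id big_split_ord.
Qed.

Lemma dsum_ord1 (F : 'I_1 -> C) : dsum F \cong F ord0.
Proof.
exists (dproj F ord0), (dinj F ord0); split; last exact: dproj_inj.
by rewrite -dsum_id big_ord1.
Qed.

Lemma dsum_ordS n (F : 'I_n.+1 -> C) :
  dsum F \cong F ord0 \oplus dsum (fun i => F (lift ord0 i)).
Proof.
apply: iso_trans (iso_sym (@dsum_split 1 n F)) _.
apply: dsum2_iso.
  apply: iso_trans (dsum_ord1 _) _ => /=.
  by rewrite (_ : lshift n ord0 = ord0); [exact: iso_refl | exact: val_inj].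
rewrite (_ : (fun i => F (lift ord0 i)) = F \o @rshift 1 n); first exact: iso_refl.
by apply: funext => i /=; congr F; apply: val_inj.
Qed.

(** Being a retract of copies of [T], with no complement asked for: easier to
    transport than [in_add], and it suffices for Krull-Schmidt decompositions
    by [add_sum_over]. *)
Definition add_factor T X : Prop := exists n (a : 'I_n -> hom X T)
  (b : 'I_n -> hom T X), \sum_i b i \oc a i = idm X.

Lemma in_add_factor T X : in_add T X -> add_factor T X.
Proof.
move=> [n [Y /iso_sym /dsum2P[i1 [p1 [i2 [p2 [p1i1 _ _ _ _]]]]]]].
exists n, (fun i => dproj _ i \oc i1), (fun i => p1 \oc dinj _ i).
rewrite -p1i1 -[in RHS](compm1 p1) -dsum_id comp_sumr comp_suml.
by apply: eq_bigr => i _; rewrite !compA.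
Qed.

Lemma add_factor_retract T X Y (f : hom X Y) (g : hom Y X) :
  g \oc f = idm X -> add_factor T Y -> add_factor T X.
Proof.
move=> gf [n [a [b ba]]]; exists n, (fun i => a i \oc f), (fun i => g \oc b i).
rewrite -gf -[in RHS](compm1 g) -ba comp_sumr comp_suml.
by apply: eq_bigr => i _; rewrite !compA.
Qed.

Lemma in_add_iso T X Y : X \cong Y -> in_add T X -> in_add T Y.
Proof.
move=> XY [n [Z XZ]]; exists n, Z; apply: iso_trans XZ.
by apply: dsum2_iso; [exact: iso_sym | exact: iso_refl].
Qed.

Lemma in_add_dsum2 T X Y : in_add T X -> in_add T Y -> in_add T (X \oplus Y).
Proof.
move=> [n [Z XZ]] [m [W YW]]; exists (n + m)%N, (Z \oplus W).
apply: iso_trans (@dsum_split n m (fun _ => T)).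
apply: iso_trans (dsum2_iso XZ YW).
apply: iso_trans (dsum2A _ _ _) _; apply: iso_trans (iso_sym (dsum2A _ _ _)).
apply: dsum2_iso; first exact: iso_refl.
apply: iso_trans (iso_sym (dsum2A _ _ _)) _.
apply: iso_trans (dsum2A _ _ _).
by apply: dsum2_iso; [exact: dsum2C | exact: iso_refl].
Qed.

Lemma in_add_zero T X : is_zero X -> in_add T X.
Proof.
move=> z; exists 0%N, zero_ob.
apply: iso_trans (dsum2_zero _ zero_obP) _; apply: zero_iso => //.
by rewrite /is_zero -dsum_id big_ord0.
Qed.

Lemma in_add_self T : in_add T T.
Proof.
exists 1%N, zero_ob; apply: iso_trans (dsum2_zero _ zero_obP) _.
exact: iso_sym (dsum_ord1 _).
Qed.

(** * Krull-Schmidt decompositions *)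

(** Lists of indices allow induction on the number of summands, and turn
    multiplicities into [count_mem]. *)
Definition sum_over (I : Type) (F : I -> C) (s : seq I) : C :=
  foldr (fun i X => F i \oplus X) zero_ob s.

Lemma in_add_sum_over (I : eqType) (F : I -> C) U (s : seq I) :
  (forall i, i \in s -> in_add U (F i)) -> in_add U (sum_over F s).
Proof.
elim: s => [|i s IHs] Fs; first exact: in_add_zero zero_obP.
apply: in_add_dsum2; first by apply: Fs; rewrite mem_head.
by apply: IHs => j js; apply: Fs; rewrite in_cons js orbT.
Qed.

Lemma sum_over_summand (I : eqType) (F : I -> C) (s : seq I) i : i \in s ->
  exists (f : hom (F i) (sum_over F s)) (g : hom (sum_over F s) (F i)),
    g \oc f = idm (F i).
Proof.
elim: s => //= j s IHs; rewrite in_cons => /predU1P[->|/IHs[f [g gf]]].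
  by exists (inj1 _ _), (prj1 _ _); rewrite prj1_inj1.
by exists (inj2 _ _ \oc f), (g \oc prj2 _ _); rewrite ?bipE.
Qed.

Lemma indecomposable_local X : krull_schmidt C -> indecomposable X -> local_end X.
Proof.
move=> KS [nz ind]; have [[|n] [F [loc XF]]] := KS X.
  by case: nz; apply: (iso_zero (iso_sym XF)); rewrite /is_zero -dsum_id big_ord0.
have XF' := iso_trans XF (dsum_ordS F).
case: (ind _ _ XF') => [z|z]; first by case: (loc ord0).
apply: local_iso (loc ord0); apply: iso_sym.
exact: iso_trans XF' (dsum2_zero _ z).
Qed.

(** The identity of [X] is a sum of endomorphisms that pass through the [F i];
    as End(X) is local, one of them is invertible. *)
Lemma add_local_summand (I : finType) (F : I -> C) X :
  (forall i, local_end (F i)) -> local_end X -> add_factor (dsum F) X ->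
  exists i, X \cong F i.
Proof.
move=> locF locX [n [a [b ba]]].
have : is_iso (\sum_l \sum_i b l \oc dinj F i \oc (dproj F i \oc a l)).
  rewrite (_ : \sum_l _ = idm X); first exact: is_iso_id.
  rewrite -ba; apply: eq_bigr => l _; rewrite -[in RHS](compm1 (b l)) -dsum_id.
  by rewrite comp_sumr comp_suml; apply: eq_bigr => i _; rewrite !compA.
move=> /(local_sum locX)[l] /(local_sum locX)[i [w [wl wr]]]; exists i.
exists (dproj F i \oc a l).
apply: (local_retract (g := w \oc (b l \oc dinj F i))) => //; first by case: locX.
by rewrite -compA.
Qed.

Lemma add_sum_over (I : finType) (F : I -> C) X : krull_schmidt C ->
  (forall i, local_end (F i)) -> add_factor (dsum F) X ->
  exists s, X \cong sum_over F s.
Proof.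
move=> KS locF; have [n [G [locG XG]]] := KS X.
move=> addX; have addG j : exists i, G j \cong F i.
  apply: add_local_summand => //.
  have [f [g [gf fg]]] := XG.
  apply: (add_factor_retract (f := g \oc dinj G j) (g := dproj G j \oc f)) addX.
  by rewrite -compA (compA f) fg comp1m dproj_inj.
suff [s Gs] : exists s, dsum G \cong sum_over F s.
  by exists s; apply: iso_trans XG Gs.
elim: n => [|n IHn] in G {locG XG} addG *.
  by exists [::]; apply: zero_iso; [rewrite /is_zero -dsum_id big_ord0 | exact: zero_obP].
have [s Gs] := IHn (fun i => G (lift ord0 i)) (fun i => addG (lift ord0 i)).
have [i Gi] := addG ord0; exists (i :: s).
apply: iso_trans (dsum_ordS G) _; exact: dsum2_iso.
Qed.

End DirectSums.

(** * Dimensions of quotients *)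

Section Quotients.
Variables (K : fieldType) (V : lmodType K).
Implicit Types W U : V -> Prop.

Lemma subspaceD U x y : subspace U -> U x -> U y -> U (x + y).
Proof. by move=> [_ sU] Ux Uy; rewrite -[x]scale1r; exact: sU. Qed.

Lemma subspaceZ U (a : K) x : subspace U -> U x -> U (a *: x).
Proof. by move=> [U0 sU] Ux; rewrite -[a *: x]addr0; exact: sU. Qed.

Lemma subspaceB U x y : subspace U -> U x -> U y -> U (x - y).
Proof.
by move=> sU Ux Uy; apply: subspaceD => //; rewrite -scaleN1r; exact: subspaceZ.
Qed.

Lemma subspace_sum U (I : Type) (s : seq I) (F : I -> V) :
  subspace U -> (forall i, U (F i)) -> U (\sum_(i <- s) F i).
Proof.
move=> sU UF; apply: big_ind => //; first by case: sU.
by move=> x y; exact: subspaceD.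
Qed.

Lemma quot_dim_leq W U n m :
  subspace U -> quot_dim W U n -> quot_dim W U m -> (n <= m)%N.
Proof.
move=> sU [v [Wv genv freev]] [w [Ww genw _]].
have [a Ha] := choice (fun i => genw _ (Wv i)).
have [b Hb] := choice (fun j => genv _ (Ww j)).
pose A := \matrix_(i < n, j < m) a i j; pose B := \matrix_(j < m, i < n) b j i.
suff : A *m B = 1%:M by exact: mulmx1_min.
apply/matrixP => i k.
have : U (\sum_k' ((i == k')%:R - (A *m B) i k') *: v k').
  rewrite (_ : \sum_k' _ = (v i - \sum_j a i j *: w j)
      + \sum_j a i j *: (w j - \sum_k' b j k' *: v k')).
    by apply: subspaceD => //; apply: subspace_sum => // j; exact: subspaceZ.
  rewrite [X in _ + X](eq_bigr (fun j => a i j *: w j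
      - \sum_k' (a i j * b j k') *: v k')); last first.
    move=> j _; rewrite scalerBr scaler_sumr; congr (_ - _).
    by apply: eq_bigr => k' _; rewrite scalerA.
  rewrite big_split /= addrA subrK sumrN exchange_big /=.
  under eq_bigr => k' _ do rewrite scalerBl.
  rewrite big_split /= sumrN; congr (_ - _).
    rewrite (bigD1 i) //= eqxx scale1r big1 ?addr0 // => k' k'i.
    by rewrite eq_sym (negbTE k'i) scale0r.
  apply: eq_bigr => k' _; rewrite mxE scaler_suml.
  by apply: eq_bigr => j _; rewrite !mxE.
by move/freev/(_ k)/subr0_eq => <-; rewrite mxE.
Qed.

Lemma quot_dim_uniq W U n m :
  subspace U -> quot_dim W U n -> quot_dim W U m -> n = m.
Proof.
by move=> sU dn dm; apply/eqP; rewrite eqn_leq !(quot_dim_leq (W := W) sU).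
Qed.

(** The given generators need not lie in [W]. By induction on their number: an
    element of [W] whose last coordinate is nonzero is one of the new
    generators, and subtracting multiples of it removes the last old one. *)
Lemma subspace_fingen W U n (v : 'I_n -> V) : subspace U -> subspace W ->
  (forall x, W x -> exists c : 'I_n -> K, U (x - \sum_i c i *: v i)) ->
  exists m (w : 'I_m -> V), (forall i, W (w i)) /\
    forall x, W x -> exists c : 'I_m -> K, U (x - \sum_i c i *: w i).
Proof.
move=> sU; elim: n => [|n IHn] in v W * => sW genv.
  exists 0%N, (fun _ => 0); split=> [[]//|x /genv[c]]; rewrite !big_ord0 => Ux.
  by exists c; rewrite big_ord0.
pose W' x := W x /\ exists c : 'I_n -> K, U (x - \sum_i c i *: v (widen_ord (leqnSn n) i)).
have sW' : subspace W'.
  split; first split; first by case: sW.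
    by exists (fun _ => 0); rewrite big1 ?subr0; [case: sU | move=> i _; rewrite scale0r].
  move=> a x y [Wx [c Uc]] [Wy [d Ud]]; split; first by case: sW => _; apply.
  exists (fun i => a * c i + d i).
  have : U (a *: (x - \sum_i c i *: v (widen_ord (leqnSn n) i))
            + (y - \sum_i d i *: v (widen_ord (leqnSn n) i))) by case: sU => _; apply.
  rewrite scalerBr scaler_sumr addrACA -opprD -big_split /=.
  by under eq_bigr => i _ do rewrite scalerA -scalerDl.
have [m [w [W'w genw]]] := IHn _ W' sW' (fun x W'x => W'x.2).
have [[x0 [Wx0 [c [cn Uc]]]]|no] := pselect (exists x0, W x0 /\
    exists c : 'I_n.+1 -> K, c ord_max != 0 /\ U (x0 - \sum_i c i *: v i)).
  exists m.+1, (fun i => if unlift ord_max i is Some j then w j else x0).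
  split=> [i|x Wx]; first by case: unliftP => // j _; case: (W'w j).
  have [d Ud] := genv _ Wx.
  have [e Ue] : exists e : 'I_m -> K,
      U (x - (d ord_max / c ord_max) *: x0 - \sum_i e i *: w i).
    apply: genw; split.
      rewrite -scaleNr addrC; by case: sW => _; apply.
    exists (fun i => d (widen_ord (leqnSn n) i)
      - d ord_max / c ord_max * c (widen_ord (leqnSn n) i)).
    have := subspaceB sU Ud (subspaceZ (d ord_max / c ord_max) sU Uc).
    rewrite !big_ord_recr /= scalerBr scalerDr scalerA divfK // scaler_sumr.
    under [X in _ -> U (_ - X)]eq_bigr => i _ do rewrite scalerBl -scalerA.
    rewrite big_split /= sumrN -scaler_sumr.
    set s1 := \sum_(i < n) d _ *: _; set s2 := \sum_(i < n) c _ *: _.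
    rewrite scaler_sumr; under eq_bigr => i _ do rewrite scalerA.
    set s3 := \sum_(i < n) _; set y := _ *: x0; set z := _ *: v _.
    rewrite opprB opprD [x + (- s1 - z)]addrA [s3 + z]addrC -(addrA z) subrKA [s3 - y]addrC addrACA.
    by rewrite opprB [- s1 + _]addrC.
  exists (fun i => if unlift ord_max i is Some j then e j else d ord_max / c ord_max).
  rewrite big_ord_recr /= unlift_none.
  have liftE (i : 'I_m) : widen_ord (leqnSn m) i = lift ord_max i.
    by apply: val_inj; rewrite /= /bump leqNgt ltn_ord.
  under eq_bigr => i _ do rewrite liftE liftK.
  by rewrite [_ + _ *: x0]addrC opprD addrA.
exists m, w; split=> [i|x Wx]; first by case: (W'w i).
apply: genw; split=> //; have [d Ud] := genv _ Wx.
exists (fun i => d (widen_ord (leqnSn n) i)).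
have d0 : d ord_max = 0.
  by apply/eqP/negP => /negP dn; apply: no; exists x; split=> //; exists d.
by move: Ud; rewrite big_ord_recr /= d0 scale0r addr0.
Qed.

End Quotients.

(** * Residue fields *)

Section ResidueField.
Variables (K : fieldType) (C : addCat K).
Implicit Types A X Y Z T U E : C.

(** The residue division ring End(A)/rad of the local ring End(A) is [K]. *)
Definition split_local A : Prop :=
  local_end A /\ forall d : hom A A, exists a : K, rad (d - a *: idm A).

Definition endo_pow A (d : hom A A) (n : nat) : hom A A := iter n (comp d) (idm A).

Definition endo_poly A (d : hom A A) (p : {poly K}) : hom A A :=
  \sum_(i < size p) p`_i *: endo_pow d i.

Lemma endo_poly_widen A (d : hom A A) (p : {poly K}) n : (size p <= n)%N ->
  endo_poly d p = \sum_(i < n) p`_i *: endo_pow d i.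
Proof.
move=> pn; rewrite /endo_poly (big_ord_widen n (fun i => p`_i *: endo_pow d i)) //.
rewrite big_mkcond; apply: eq_bigr => i _; case: ltnP => // /(nth_default 0) ->.
by rewrite scale0r.
Qed.

Lemma endo_polyZ A (d : hom A A) (a : K) (p : {poly K}) :
  endo_poly d (a *: p) = a *: endo_poly d p.
Proof.
rewrite (endo_poly_widen d (size_scale_leq a p)) /endo_poly scaler_sumr.
by apply: eq_bigr => i _; rewrite coefZ scalerA.
Qed.

(** Factoring a polynomial into linear factors factors the endomorphism. *)
Lemma endo_poly_XsubC A (d : hom A A) (a : K) (p : {poly K}) :
  endo_poly d (('X - a%:P) * p) = (d - a *: idm A) \oc endo_poly d p.
Proof.
have le : (size (('X - a%:P) * p)%R <= (size p).+1)%N.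
  by apply: leq_trans (size_polyMleq _ _) _; rewrite size_XsubC.
rewrite (endo_poly_widen d le) compBl compZl comp1m.
under eq_bigr => i _ do rewrite mulrBl coefB coefXM coefCM scalerBl.
rewrite big_split /= sumrN; congr (_ - _).
  rewrite big_ord_recl /= scale0r add0r /endo_poly comp_sumr.
  by apply: eq_bigr => i _; rewrite compZr.
rewrite (endo_poly_widen d (leqnSn (size p))) scaler_sumr.
by apply: eq_bigr => i _; rewrite scalerA.
Qed.

Lemma subspace_rad2 U X Y : subspace (@rad2 K C U X Y).
Proof.
split; first by exists 0%N, (fun _ => zero_ob C), (fun _ => 0), (fun _ => 0);
  split=> [[]//|[]//|]; rewrite big_ord0.
move=> c f g [n [Z [a [b [Zadd rab ->]]]]] [m [W [a' [b' [Wadd rab' ->]]]]].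
pose S (i : 'I_n + 'I_m) := match i with inl j => Z j | inr j => W j end.
pose al (i : 'I_n + 'I_m) : hom X (S i) :=
  match i with inl j => a j | inr j => a' j end.
pose be (i : 'I_n + 'I_m) : hom (S i) Y :=
  match i with inl j => c *: b j | inr j => b' j end.
exists (n + m)%N, (fun i => S (split i)), (fun i => al (split i)), (fun i => be (split i)).
split=> [i|i|]; first by case: (split i).
  by case: (split i) => j /=; [case: (rab j) | case: (rab' j)] => // ra rb;
    split=> //; apply: radZ.
rewrite big_split_ord /= scaler_sumr; congr (_ + _); apply: eq_bigr => i _.
  by rewrite (unsplitK (inl i)) /= compZl.
by rewrite (unsplitK (inr i)).
Qed.

Lemma rad2_comp U X Z Y (b : hom Z Y) (a : hom X Z) :
  in_add U Z -> rad a -> rad b -> rad2 U (b \oc a).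
Proof.
move=> Zadd ra rb.
by exists 1%N, (fun _ => Z), (fun _ => a), (fun _ => b); split; rewrite ?big_ord1.
Qed.

Lemma subspace_rad X Y : subspace (@rad K C X Y).
Proof. by split; [exact: rad0 | move=> a x y rx ry; apply: radD => //; exact: radZ]. Qed.

(** * Multiplicities of a local summand *)

(** [A] occurs [c] times in a Krull-Schmidt decomposition of [X]: after [c]
    copies of [A] are split off, every endomorphism of [A] through the rest is
    radical. *)
Definition mult A X (c : nat) : Prop :=
  exists (s : 'I_c -> hom A X) (p : 'I_c -> hom X A),
    (forall i j, p i \oc s j = if i == j then idm A else 0) /\
    forall (u : hom A X) (v : hom X A),
      rad (v \oc (idm X - \sum_i s i \oc p i) \oc u).

(** Modulo the radical, the identity matrix of size [c] factors through a space
    of dimension [c']. *)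
Lemma mult_leq A X c c' : split_local A -> mult A X c -> mult A X c' -> (c <= c')%N.
Proof.
move=> [[nz loc] spl] [s [p [ps _]]] [s' [p' [_ radr]]].
have [res resP] := choice spl.
have res_uniq d a : rad (d - a *: idm A) -> res d = a.
  move=> ra; apply/eqP; rewrite -subr_eq0; apply/negP => /negP ne.
  apply: (rad_not_iso (u := (res d - a) *: idm A)) => //; last first.
    by apply: is_isoZ => //; exact: is_iso_id.
  rewrite (_ : _ *: _ = (d - a *: idm A) - (d - res d *: idm A)).
    by apply: radD => //; exact: radN.
  by rewrite opprB [RHS]addrC subrKA scalerBl.
pose M := \matrix_(i < c, j < c') res (p i \oc s' j).
pose N := \matrix_(j < c', i < c) res (p' j \oc s i).
suff : M *m N = 1%:M by exact: mulmx1_min.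
apply/matrixP => i k; rewrite !mxE.
have -> : (i == k)%:R = res (p i \oc s k).
  apply/esym/res_uniq; rewrite ps; case: eqP => _; last by rewrite scale0r subrr; exact: rad0.
  by rewrite scale1r subrr; exact: rad0.
apply/esym/res_uniq.
pose t j := (p i \oc s' j - res (p i \oc s' j) *: idm A) \oc (p' j \oc s k)
  + res (p i \oc s' j) *: (p' j \oc s k - res (p' j \oc s k) *: idm A).
rewrite (_ : _ - _ = p i \oc (idm X - \sum_j s' j \oc p' j) \oc s k + \sum_j t j).
  apply: radD; first exact: radr.
  apply: rad_sum => j; apply: radD; first exact: rad_compr.
  exact: radZ.
rewrite compBr compm1 compBl -addrA; congr (_ + _).
rewrite comp_sumr comp_suml -sumrN scaler_suml -!sumrN -big_split /=.
apply: eq_bigr => j _; rewrite !mxE /t compBl compZl comp1m scalerBr !compA scalerA.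
by rewrite subrKA addKr.
Qed.

Lemma mult_uniq A X c c' : split_local A -> mult A X c -> mult A X c' -> c = c'.
Proof. by move=> sA m m'; apply/eqP; rewrite eqn_leq !(mult_leq (X := X) sA). Qed.

Lemma mult_iso A X Y c : X \cong Y -> mult A X c -> mult A Y c.
Proof.
move=> [f [g [gf fg]]] [s [p [ps radr]]].
exists (fun i => f \oc s i), (fun i => p i \oc g); split=> [i j|u v].
  by rewrite compA -(compA (p i)) gf compm1 ps.
suff -> : idm Y - \sum_i (f \oc s i) \oc (p i \oc g)
    = f \oc (idm X - \sum_i s i \oc p i) \oc g.
  by rewrite !compA -(compA _ g u); exact: radr.
rewrite compBr compm1 compBl fg comp_sumr comp_suml; congr (_ - _).
by apply: eq_bigr => i _; rewrite !compA.
Qed.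

Lemma mult_dsum2 A X Y c c' : mult A X c -> mult A Y c' -> mult A (X \oplus Y) (c + c').
Proof.
move=> [s [p [ps radr]]] [s' [p' [ps' radr']]].
exists (fun i => match split i with inl j => inj1 X Y \oc s j
                                  | inr j => inj2 X Y \oc s' j end).
exists (fun i => match split i with inl j => p j \oc prj1 X Y
                                  | inr j => p' j \oc prj2 X Y end).
split=> [i j|u v].
  case: (split_ordP i) => i' ->; case: (split_ordP j) => j' ->.
  - by rewrite eq_lshift ?bipE ps.
  - by rewrite eq_lrshift ?bipE.
  - by rewrite eq_rlshift ?bipE.
  - by rewrite eq_rshift ?bipE ps'.
set r := _ - _.
have -> : r = inj1 X Y \oc (idm X - \sum_i s i \oc p i) \oc prj1 X Y
            + inj2 X Y \oc (idm Y - \sum_i s' i \oc p' i) \oc prj2 X Y.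
  rewrite /r big_split_ord /= !compBr !compBl !compm1 addrACA dsum2_id -opprD.
  congr (_ - (_ + _)); rewrite comp_sumr comp_suml; apply: eq_bigr => i _.
    by rewrite (unsplitK (inl i)) /= !compA.
  by rewrite (unsplitK (inr i)) /= !compA.
rewrite compDr compDl !compA; apply: radD.
  by rewrite -(compA _ (prj1 _ _)); apply: radr.
by rewrite -(compA _ (prj2 _ _)); apply: radr'.
Qed.

Lemma mult_self A : mult A A 1.
Proof.
exists (fun _ => idm A), (fun _ => idm A); split=> [i j|u v].
  by rewrite !ord1 eqxx comp1m.
by rewrite big_ord1 comp1m subrr compm0 comp0m; exact: rad0.
Qed.

Lemma mult_zero A X : is_zero X -> mult A X 0.
Proof.
move=> z; exists (fun _ => 0), (fun _ => 0); split=> [[]//|u v].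
by rewrite (zero_to v z) !comp0m; exact: rad0.
Qed.

Lemma mult_noniso A X : local_end A -> local_end X -> ~ A \cong X -> mult A X 0.
Proof.
move=> lA lX nAX; exists (fun _ => 0), (fun _ => 0); split=> [[]//|u v].
by apply: rad_compl; exact: rad_noniso.
Qed.

Lemma mult_sum_over (I : eqType) (F : I -> C) (s : seq I) k :
  (forall i, local_end (F i)) -> (forall i j, i != j -> ~ F i \cong F j) ->
  mult (F k) (sum_over F s) (count_mem k s).
Proof.
move=> locF noniso; elim: s => [|i s IHs]; first exact: mult_zero (zero_obP C).
apply: mult_dsum2 => //=; have [->|ik] := eqVneq i k; first exact: mult_self.
by apply: mult_noniso => //; apply: noniso; rewrite eq_sym.
Qed.

End ResidueField.

(** * Counting arrows *)

Section CountArrows.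
Variables (K : closedFieldType) (C : addCat K).
Implicit Types A X Y Z T U E : C.

Lemma endo_poly_root A (d : hom A A) (p : {poly K}) :
  p != 0 -> ~ is_iso (endo_poly d p) -> exists a : K, ~ is_iso (d - a *: idm A).
Proof.
move=> p0 np; apply: contra_notP np => /forallNP iso_d.
have [s ->] := closed_field_poly_normal p.
rewrite endo_polyZ; apply: is_isoZ; first by rewrite lead_coef_eq0.
elim: s => [|a s IHs].
  rewrite big_nil /endo_poly size_poly1 big_ord1 coef1 scale1r; exact: is_iso_id.
rewrite big_cons endo_poly_XsubC; apply: is_iso_comp => //.
by apply: contrapT; exact: iso_d.
Qed.

(** For [d] in End(A), the images under [L] of the powers of [d] are linearly
    dependent modulo [U]; so some nonzero polynomial in [d] is not invertible,
    and neither is one of its linear factors [d - a]. *)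
Lemma split_local_functional A (V : lmodType K) (U : V -> Prop)
    (L : hom A A -> V) n (v : 'I_n -> V) :
  local_end A -> subspace U ->
  (forall a x y, L (a *: x + y) = a *: L x + L y) ->
  (forall x, exists c : 'I_n -> K, U (L x - \sum_i c i *: v i)) ->
  (forall x, U (L x) -> ~ is_iso x) ->
  split_local A.
Proof.
move=> lA sU linL genv nisoU; split=> // d.
suff [a na] : exists a : K, ~ is_iso (d - a *: idm A).
  by exists a; apply: rad_local.
have [c Uc] := choice (fun i => genv (endo_pow d i)).
pose M := \matrix_(i < n.+1, j < n) c (nat_of_ord i) j.
have /rowV0Pn[w /sub_kermxP wM w0] : kermx M != 0.
  rewrite -mxrank_eq0 mxrank_ker subn_eq0 -ltnNge.
  exact: leq_trans (rank_leq_col M) _.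
pose p := \poly_(i < n.+1) w 0 (inord i).
apply: (@endo_poly_root _ _ p).
  apply: contra_neq w0 => p0; apply/rowP => i; rewrite mxE.
  by have := coef_poly n.+1 (fun i => w 0 (inord i)) i;
    rewrite -/p p0 coef0 ltn_ord inord_val.
apply: nisoU.
have L0 : L 0 = 0.
  by have := linL 1 0 0; rewrite scale1r addr0 scale1r => /(congr1 (fun x => x - L 0));
    rewrite subrr addrK.
have LD x y : L (x + y) = L x + L y by have := linL 1 x y; rewrite !scale1r.
have LZ a x : L (a *: x) = a *: L x by have := linL a x 0; rewrite L0 !addr0.
rewrite (endo_poly_widen d (size_poly _ _)) (big_morph L LD L0).
rewrite (_ : \sum_(i < n.+1) _ =
    \sum_(i < n.+1) w 0 i *: (L (endo_pow d i) - \sum_j c i j *: v j)).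
  by apply: subspace_sum => // i; exact: subspaceZ.
under [RHS]eq_bigr => i _ do rewrite scalerBr scaler_sumr.
rewrite big_split /= sumrN exchange_big /= [X in _ - X]big1 => [|j _].
  rewrite subr0; apply: eq_bigr => i _.
  by rewrite coef_poly ltn_ord inord_val LZ.
under eq_bigr => i _ do rewrite scalerA.
have e := congr1 (fun N : 'rV_n => N 0 j) wM; rewrite !mxE in e.
rewrite -scaler_suml (eq_bigr (fun i => w 0 i * M i j)) ?e ?scale0r // => i _.
by rewrite mxE.
Qed.

(** The components of [g] at the copies of [A] in [E] form a basis of the space
    of irreducible maps [A -> X]: they span because radical maps factor through
    [g], and a nontrivial combination in the square of the radical would
    contradict the minimality of [g]. If [A] occurs in [E] at all, then
    End(A)/rad embeds into that space by [e |-> g s e]; being finite-dimensional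
    over an algebraically closed field, it is [K], even if [A] is
    projective. *)
Lemma count_arrows U A X E (g : hom E X) c q :
  local_end A -> in_add U A -> in_add U E -> rad g -> right_minimal g ->
  (forall Z (h : hom Z X), in_add U Z -> rad h -> exists h', h = g \oc h') ->
  mult A E c -> quot_dim (@rad K C A X) (@rad2 K C U A X) q -> c = q.
Proof.
move=> lA addA addE rg ming lift_g [s [p [ps radr]]] dimq.
have srad2 := @subspace_rad2 K C U A X.
(* Through [g], elements of the squared radical come from radical maps [A -> E];
   minimality of [g] then separates them from maps that are split. *)
have nrad2 (f : hom A E) : (exists p' : hom E A, is_iso (p' \oc f)) -> ~ rad2 U (g \oc f).
  move=> [p' [w [wpf _]]] [n [Z [a [b [Zadd rab gf]]]]].
  pose b' l := sval (cid (lift_g _ (b l) (Zadd l) (rab l).2)).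
  have Hb' l : b l = g \oc b' l by rewrite /b'; case: cid.
  pose t := \sum_l b' l \oc a l.
  have gt : g \oc (f - t) = 0.
    rewrite compBr gf comp_sumr -sumrB big1 // => l _.
    by rewrite {1}Hb' compA subrr.
  have rt : rad t by apply: rad_sum => l; apply: rad_compl; case: (rab l).
  have [z [zl _]] := rt (w \oc p').
  have rho : z \oc w \oc p' \oc (f - t) = idm A.
    by rewrite -!compA (compA w) compBr -compA wpf.
  have [e' [e'e _]] : is_iso (idm E - (f - t) \oc (z \oc w \oc p')).
    by apply: ming; rewrite compBr compA gt comp0m subr0 compm1.
  have ft0 : f - t = 0.
    rewrite -[f - t]comp1m -e'e -compA compBl comp1m.
    by rewrite -(compA (f - t)) rho compm1 subrr compm0.
  by case: lA => nz _; apply: nz; rewrite /is_zero -rho ft0 compm0.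
have spl : 'I_c -> split_local A.
  move=> i; have [v [_ genv _]] := dimq.
  apply: (split_local_functional (L := fun e => g \oc s i \oc e) (v := v) lA srad2).
  - by move=> a x y; rewrite compDr compZr.
  - by move=> x; apply: genv; do 2!apply: rad_compr.
  - move=> x Ux ix; apply: (nrad2 (s i \oc x)); last by rewrite compA.
    by exists (p i); rewrite compA ps eqxx comp1m.
suff : quot_dim (@rad K C A X) (@rad2 K C U A X) c.
  by move=> dimc; apply: quot_dim_uniq dimc dimq.
exists (fun i => g \oc s i); split=> [i|h rh|a Ua i].
- exact: rad_compr.
- have [h' hh'] := lift_g A h addA rh.
  have [a Ha] := choice (fun i => (spl i).2 (p i \oc h')).
  exists a; rewrite hh'.
  pose r := idm E - \sum_i s i \oc p i.
  have rr : rad (r \oc h').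
    move=> v; have [w ww] := radr h' v (idm A).
    by exists w; move: ww; rewrite comp1m compA.
  rewrite (_ : _ - _ = g \oc (r \oc h'
      + \sum_i s i \oc (p i \oc h' - a i *: idm A))).
    apply: rad2_comp => //; apply: radD => //; apply: rad_sum => i.
    exact: rad_compl.
  rewrite compDr compA /r compBr compm1 compBl -addrA; congr (_ + _).
  rewrite comp_sumr comp_suml comp_sumr -!sumrN -big_split /=.
  apply: eq_bigr => i _.
  by rewrite !compBr !compA compZr compm1 addKr.
- apply/eqP/negP => /negP ai; case: (nrad2 (\sum_i a i *: s i)).
    exists (p i); rewrite comp_sumr (bigD1 i) //= compZr ps eqxx big1 => [|j ji].
      by rewrite addr0; apply: is_isoZ => //; exact: is_iso_id.
    by rewrite compZr ps eq_sym (negbTE ji) scaler0.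
  by rewrite comp_sumr; under eq_bigr => j _ do rewrite compZr.
Qed.

End CountArrows.

(** * Opposite categories *)

(** Left approximations, coindices and arrows out of a vertex are treated as
    right approximations, indices and arrows into it in the opposite
    category. *)
Section OppositeAdditive.
Variables (K : fieldType) (C : addCat K).

Fact op_dproj_inj0 (I : finType) (F : I -> C) i j : i != j ->
  dproj F i \oc dinj F j = 0.
Proof. by move=> ij; rewrite dproj_inj0 // eq_sym. Qed.

Definition op_add : addCat K := @AddCat K (ob C) (fun X Y => @hom K C Y X)
  (fun X => idm X) (fun X Y Z g f => f \oc g)
  (fun X Y f => compm1 f) (fun X Y f => comp1m f)
  (fun X Y Z W h g f => esym (compA f g h))
  (fun X Y Z f a g g' => comp_linr f a g g')
  (fun X Y Z g a f f' => comp_linl g a f f')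
  (fun I F => dsum F) (fun I F i => dproj F i) (fun I F i => dinj F i)
  (fun I F i => dproj_inj F i) op_dproj_inj0 (fun I F => dsum_id F).

Lemma op_is_iso X Y (f : @hom K C X Y) : @is_iso K op_add Y X f <-> @is_iso K C X Y f.
Proof. by split; case=> g [gf fg]; exists g; split. Qed.

Lemma op_iso X Y : @iso K op_add X Y <-> @iso K C X Y.
Proof.
split=> -[f [g [gf fg]]]; first by exists g, f.
by exists g; exists f.
Qed.

Lemma op_in_add T X : @in_add K op_add T X <-> @in_add K C T X.
Proof. by split; case=> n [Y /op_iso]; exists n, Y. Qed.

Lemma op_rad X Y (f : @hom K C X Y) : @rad K op_add Y X f <-> @rad K C X Y f.
Proof.
split=> rf g.
  apply: is_iso_1Bcomp; apply/op_is_iso; exact: (rf g).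
apply/op_is_iso; exact: (is_iso_1Bcomp (rf g)).
Qed.

Lemma op_rad2 U X Y (f : @hom K C X Y) : @rad2 K op_add U Y X f <-> @rad2 K C U X Y f.
Proof.
split=> -[n [Z [a [b [Zadd rab ->]]]]]; exists n, Z, b, a;
  split=> // l; try by apply/op_in_add.
  by have [ra rb] := rab l; split; apply/op_rad.
by have [ra rb] := rab l; split; apply/op_rad.
Qed.

Lemma op_local X : @local_end K op_add X <-> @local_end K C X.
Proof.
by split=> -[nz loc]; split=> // f; have [i|i] := loc f; [left|right|left|right];
  apply/op_is_iso.
Qed.

Lemma op_mult A X c : @mult K op_add A X c <-> @mult K C A X c.
Proof.
split=> -[s [p [ps radr]]]; exists p, s; split=> [i j|u v].
- by rewrite eq_sym; exact: ps.
- by rewrite -compA; apply/op_rad; exact: (radr v u).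
- by rewrite eq_sym; exact: ps.
- by apply/op_rad; rewrite /= compA; exact: (radr v u).
Qed.

Lemma op_quot_dim_arrows U A X q :
  quot_dim (@rad K C X A) (@rad2 K C U X A) q ->
  quot_dim (@rad K op_add A X) (@rad2 K op_add U A X) q.
Proof.
have -> : @rad K op_add A X = @rad K C X A.
  by apply: funext => f; apply/propext/op_rad.
have -> : @rad2 K op_add U A X = @rad2 K C U X A.
  by apply: funext => f; apply/propext/op_rad2.
exact.
Qed.

End OppositeAdditive.

Section CountArrowsLeft.
Variables (K : closedFieldType) (C : addCat K).

Lemma count_arrows_left (U A X E : C) (f : hom X E) c q :
  local_end A -> in_add U A -> in_add U E -> rad f -> left_minimal f ->
  (forall Z (h : hom X Z), in_add U Z -> rad h -> exists h', h = h' \oc f) ->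
  mult A E c -> quot_dim (@rad K C X A) (@rad2 K C U X A) q -> c = q.
Proof.
move=> lA addA addE rf minf lift_f mA dimq.
apply: (@count_arrows K (op_add C) U A X E f).
- exact/op_local.
- exact/op_in_add.
- exact/op_in_add.
- exact/op_rad.
- by move=> e ef; apply/op_is_iso; exact: minf.
- move=> Z h addZ rh; apply: lift_f; [exact/op_in_add | exact/op_rad].
- exact/op_mult.
- exact: op_quot_dim_arrows.
Qed.

End CountArrowsLeft.

Section OppositeExact.
Variables (K : fieldType) (C : exactCat K).

Definition op_confl (X Y Z : op_add C) (f : hom X Y) (g : hom Y Z) : Prop :=
  @confl K C Z Y X g f.

Fact confl_iso_inv X Y Z X' Y' Z' (f : @hom K C X Y) (g : @hom K C Y Z)
    (f' : @hom K C X' Y') (g' : @hom K C Y' Z') (a : @hom K C X' X)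
    (b : @hom K C Y' Y) (c : @hom K C Z' Z) :
  is_iso a -> is_iso b -> is_iso c -> f \oc a = b \oc f' -> g \oc b = c \oc g' ->
  confl f g -> confl f' g'.
Proof.
move=> [a' [a'a aa']] [b' [b'b bb']] [c' [c'c cc']] fa gb fg.
apply: (@ex_iso _ _ _ (confl_axioms C) X Y Z X' Y' Z' f g f' g' a' b' c') => //.
- by exists a.
- by exists b.
- by exists c.
- by rewrite -[f]compm1 -aa' (compA f) fa compA (compA b') b'b comp1m.
- by rewrite -[g]compm1 -bb' (compA g) gb compA (compA c') c'c comp1m.
Qed.

Fact op_exact_axioms : exact_axioms op_confl.
Proof.
have ax := confl_axioms C; split.
- move=> X Y Z f g fg; have [[gf0 ker] [_ coker]] := ex_ker ax fg.
  by split; split.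
- move=> X Y Z X' Y' Z' f g f' g' a b c /op_is_iso ia /op_is_iso ib /op_is_iso ic.
  by move=> bf cg fg; apply: (confl_iso_inv ic ib ia) fg.
- by move=> X; have [Z [g fg]] := ex_defl1 ax X; exists Z, g.
- by move=> X; have [Z [g fg]] := ex_infl1 ax X; exists Z, g.
- by move=> X Y Z f g df dg; exact: (ex_defl_comp ax dg df).
- by move=> X Y Z f g df dg; exact: (ex_infl_comp ax dg df).
- move=> X Y X' f a df; have [Y' [b [f' [[e pb] df']]]] := ex_pullback ax a df.
  by exists Y', b, f'; split=> //; split=> // W u v uv; exact: pb.
- move=> Y Z Z' g a ig; have [Y' [b [g' [[e po] ig']]]] := ex_pushout ax a ig.
  by exists Y', b, g'; split=> //; split=> // W u v uv; exact: po.
Qed.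

Definition op : exactCat K := ExactCat op_exact_axioms.

Lemma op_projective X : @projective K op X <-> @injective_ob K C X.
Proof.
split=> inj Y Z f g i; first by have [h e] := inj Z Y f g i; exists h.
by have [h e] := inj Z Y f g i; exists h.
Qed.

Lemma op_injective X : @injective_ob K op X <-> @projective K C X.
Proof.
split=> inj Y Z f g i; first by have [h e] := inj Z Y f g i; exists h.
by have [h e] := inj Z Y f g i; exists h.
Qed.

Lemma op_frobenius : frobenius C -> frobenius op.
Proof.
move=> [enough_p enough_i pi]; split=> X.
- have [J [i [inj infl]]] := enough_i X; exists J, i; split=> //.
  exact/op_projective.
- have [P [p [proj defl]]] := enough_p X; exists P, p; split=> //.
  exact/op_injective.
- by split=> [/op_projective/pi/op_injective|/op_injective/pi/op_projective].
Qed.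

Lemma op_stably_zero X Y (f : @hom K C X Y) : frobenius C ->
  @stably_zero K op Y X f <-> @stably_zero K C X Y f.
Proof.
move=> [_ _ pi]; split=> -[P [u [v [proj ->]]]]; exists P, v, u; split=> //.
  exact/pi/op_projective.
exact/op_projective/pi.
Qed.

Lemma op_stably_hom_finite : frobenius C ->
  stably_hom_finite C -> stably_hom_finite op.
Proof.
move=> frob fin X Y; have [n [v genv]] := fin Y X; exists n, v => x.
by have [c /(op_stably_zero _ frob)] := genv x; exists c.
Qed.

End OppositeExact.

(** * Exact categories *)

Section Exact.
Variables (K : fieldType) (C : exactCat K).
Implicit Types A X Y Z W T U E : C.

Lemma confl_deflation X Y Z (f : hom X Y) (g : hom Y Z) : confl f g -> deflation g.
Proof. by move=> fg; exists X, f. Qed.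

Lemma confl_inflation X Y Z (f : hom X Y) (g : hom Y Z) : confl f g -> inflation f.
Proof. by move=> fg; exists Z, g. Qed.

Lemma confl_comp0 X Y Z (f : hom X Y) (g : hom Y Z) : confl f g -> g \oc f = 0.
Proof. by move/(ex_ker (confl_axioms C)) => [[]]. Qed.

Lemma confl_lift X Y Z (f : hom X Y) (g : hom Y Z) W (h : hom W Y) :
  confl f g -> g \oc h = 0 -> exists h', f \oc h' = h.
Proof.
move/(ex_ker (confl_axioms C)) => [[_ ker] _] /ker[h' [e _]]; by exists h'.
Qed.

Lemma confl_mono X Y Z (f : hom X Y) (g : hom Y Z) W (h h' : hom W X) :
  confl f g -> f \oc h = f \oc h' -> h = h'.
Proof.
move=> fg e; have [[gf ker] _] := ex_ker (confl_axioms C) fg.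
have [|k [_ uk]] := ker _ (f \oc h); first by rewrite compA gf comp0m.
by rewrite -(uk h) // -(uk h').
Qed.

Lemma confl_desc X Y Z (f : hom X Y) (g : hom Y Z) W (h : hom Y W) :
  confl f g -> h \oc f = 0 -> exists h', h' \oc g = h.
Proof.
move/(ex_ker (confl_axioms C)) => [_ [_ coker]] /coker[h' [e _]]; by exists h'.
Qed.

Lemma confl_epi X Y Z (f : hom X Y) (g : hom Y Z) W (h h' : hom Z W) :
  confl f g -> h \oc g = h' \oc g -> h = h'.
Proof.
move=> fg e; have [_ [gf coker]] := ex_ker (confl_axioms C) fg.
have [|k [_ uk]] := coker _ (h \oc g); first by rewrite -compA gf compm0.
by rewrite -(uk h) // -(uk h').
Qed.

(** A deflation forms a conflation with each of its kernels, as these are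
    isomorphic. *)
Lemma kernel_confl X Y Z (f : hom X Y) (g : hom Y Z) :
  is_kernel f g -> deflation g -> confl f g.
Proof.
move=> [gf ker] [X0 [f0 f0g]].
have [a fa] := confl_lift f0g gf.
have [b [f0b _]] := ker _ _ (confl_comp0 f0g).
have ab : a \oc b = idm X0.
  by apply: (confl_mono f0g); rewrite compA fa f0b compm1.
have ba : b \oc a = idm X.
  have [k [_ uk]] := ker _ _ gf.
  by rewrite -(uk (idm X)) ?compm1 // -(uk (b \oc a)) // compA f0b fa.
apply: (@ex_iso _ _ _ (confl_axioms C) X0 Y Z X Y Z f0 g f g b (idm Y) (idm Z)) => //.
- by exists a.
- exact: is_iso_id.
- exact: is_iso_id.
- by rewrite comp1m f0b.
- by rewrite comp1m compm1.
Qed.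

Lemma deflation_iso X Y Z (g : hom Y Z) (b : hom X Y) :
  is_iso b -> deflation g -> deflation (g \oc b).
Proof.
move=> [c [cb bc]] [W [f fg]]; exists W, (c \oc f).
apply: (@ex_iso _ _ _ (confl_axioms C) _ _ _ _ _ _ f g _ _ (idm W) c (idm Z)) => //.
- exact: is_iso_id.
- by exists b.
- exact: is_iso_id.
- by rewrite compm1.
- by rewrite comp1m -compA bc compm1.
Qed.

Lemma pullback_deflation Y Z Y' Z' (g : hom Y Z) (a : hom Z' Z) (b : hom Y' Y)
    (g' : hom Y' Z') :
  is_pullback g a b g' -> deflation g -> deflation g'.
Proof.
move=> [e pb] dg; have [Y1 [b1 [g1 [[e1 pb1] dg1]]]] := ex_pullback (confl_axioms C) a dg.
have [w [[bw gw] _]] := pb _ _ _ e1.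
have [w1 [[bw1 gw1] _]] := pb1 _ _ _ e.
suff iw1 : is_iso w1 by rewrite -gw1; exact: deflation_iso.
exists w; split.
  have [k [_ uk]] := pb _ _ _ e; rewrite -(uk (idm Y')) ?compm1 // -(uk (w \oc w1)) //.
  by rewrite !compA bw gw.
have [k [_ uk]] := pb1 _ _ _ e1; rewrite -(uk (idm Y1)) ?compm1 // -(uk (w1 \oc w)) //.
by rewrite !compA bw1 gw1.
Qed.

Lemma pullback_confl X Y Z Y' Z' (f : hom X Y) (g : hom Y Z) (a : hom Z' Z)
    (b : hom Y' Y) (g' : hom Y' Z') :
  is_pullback g a b g' -> confl f g ->
  exists f' : hom X Y', confl f' g' /\ b \oc f' = f.
Proof.
move=> pb fg; have dg' : deflation g' by apply: pullback_deflation pb _; exists X, f.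
have [e up] := pb.
have [|f' [[bf' gf'] _]] := up X f 0; first by rewrite compm0 (confl_comp0 fg).
exists f'; split=> //; apply: kernel_confl => //; split=> // W h gh.
have [k fk] : exists k, f \oc k = b \oc h.
  by apply: (confl_lift fg); rewrite compA e -compA gh compm0.
exists k; split=> [|k' f'k'].
  have [|l [_ ul]] := up W (b \oc h) (g' \oc h); first by rewrite !compA e.
  rewrite -(ul h) // -(ul (f' \oc k)) //.
  by rewrite !compA bf' gf' gh comp0m fk.
by apply: (confl_mono fg); rewrite fk -f'k' compA bf'.
Qed.

Lemma pullback_sym Y Z Y' Z' (g : hom Y Z) (a : hom Z' Z) (b : hom Y' Y)
    (g' : hom Y' Z') : is_pullback g a b g' -> is_pullback a g g' b.
Proof.
move=> [e up]; split=> // W u v uv.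
have [k [[bk gk] uk]] := up _ _ _ (esym uv).
by exists k; split=> // k' [? ?]; apply: uk.
Qed.

Lemma pullback_ex X Y Z Z' (f : hom X Y) (g : hom Y Z) (a : hom Z' Z) :
  confl f g -> exists Y' (b : hom Y' Y) (f' : hom X Y') (g' : hom Y' Z'),
    [/\ is_pullback g a b g', confl f' g' & b \oc f' = f].
Proof.
move=> fg; have [|Y' [b [g' [pb dg']]]] := ex_pullback (confl_axioms C) a (_ : is_deflation _ g).
  by exists X, f.
have [f' [f'g' bf']] := pullback_confl pb fg.
by exists Y', b, f', g'.
Qed.

(** * Split conflations *)

Lemma split_epi_mono X Y Z (f : hom X Y) (g : hom Y Z) (t : hom Z Y) :
  confl f g -> g \oc t = idm Z ->
  exists s : hom Y X, s \oc f = idm X /\ f \oc s = idm Y - t \oc g.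
Proof.
move=> fg gt; have [s fs] : exists s, f \oc s = idm Y - t \oc g.
  by apply: (confl_lift fg); rewrite compBr compm1 compA gt comp1m subrr.
exists s; split=> //; apply: (confl_mono fg).
by rewrite compA fs compBl comp1m -compA (confl_comp0 fg) compm0 subr0 compm1.
Qed.

Lemma split_mono_epi X Y Z (f : hom X Y) (g : hom Y Z) (s : hom Y X) :
  confl f g -> s \oc f = idm X ->
  exists t : hom Z Y, g \oc t = idm Z /\ t \oc g = idm Y - f \oc s.
Proof.
move=> fg sf; have [t tg] : exists t, t \oc g = idm Y - f \oc s.
  by apply: (confl_desc fg); rewrite compBl comp1m -compA sf compm1 subrr.
exists t; split=> //; apply: (confl_epi fg).
by rewrite -compA tg compBr compm1 compA (confl_comp0 fg) comp0m subr0 comp1m.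
Qed.

Lemma split_confl_iso X Y Z (f : hom X Y) (g : hom Y Z) :
  confl f g -> split_epi g -> Y \cong X \oplus Z.
Proof.
move=> fg [t gt]; have [s [sf fs]] := split_epi_mono fg gt; apply: iso_sym.
apply: (@biprod_iso _ _ _ _ _ f s t g) => //; first exact: confl_comp0 fg.
  apply: (confl_mono fg).
  by rewrite compA fs compBl comp1m -compA gt compm1 subrr compm0.
by rewrite fs subrK.
Qed.

Lemma deflation_to_zero X Z : is_zero Z -> deflation (0 : hom X Z).
Proof.
move=> z; have [Z0 [g fg]] := ex_infl1 (confl_axioms C) X.
have z0 : is_zero Z0.
  apply: (confl_epi fg); rewrite comp1m comp0m.
  by have := confl_comp0 fg; rewrite compm1.
exists X, (idm X); apply: (@ex_iso _ _ _ (confl_axioms C) _ _ _ _ _ _ (idm X) g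
  _ _ (idm X) (idm X) 0) => //; try exact: is_iso_id.
- by exists 0; rewrite !compm0 z z0.
- by rewrite comp0m comp0m.
Qed.

Lemma confl_dsum2 X Y : confl (inj1 X Y) (prj2 X Y).
Proof.
apply: kernel_confl; last first.
  apply: (@pullback_deflation X (zero_ob C) _ _ 0 0 (prj1 X Y)).
    split; first by rewrite !comp0m.
    move=> W u v _; exists (inj1 X Y \oc u + inj2 X Y \oc v); split.
      by rewrite ?bipE.
    by move=> w [<- <-]; rewrite !compA -compDl dsum2_id comp1m.
  exact: deflation_to_zero (zero_obP C).
split; first exact: prj2_inj1.
move=> W h ph; exists (prj1 X Y \oc h); split.
  by rewrite -[RHS]comp1m -dsum2_id compDl -!compA ph compm0 addr0.
by move=> h' <-; rewrite ?bipE.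
Qed.

(** With the projections [V + Y -> Y] and [V + Z -> Z], the maps [id + g] and [g]
    form a pullback square. *)
Lemma confl_add_id V X Y Z (f : hom X Y) (g : hom Y Z) : confl f g ->
  confl (inj2 V Y \oc f)
    (inj1 V Z \oc prj1 V Y + inj2 V Z \oc g \oc prj2 V Y).
Proof.
move=> fg; set h := (X in confl _ X).
have pb : is_pullback g (prj2 V Z) (prj2 V Y) h.
  split; first by rewrite /h ?bipE.
  move=> W u v uv; exists (inj1 V Y \oc (prj1 V Z \oc v) + inj2 V Y \oc u); split.
    rewrite /h ?bipE; split=> //; rewrite -(compA (inj2 V Z)) uv.
    by rewrite compA -compDl dsum2_id comp1m.
  move=> w [<- <-]; rewrite /h ?bipE.
  by rewrite -compDl dsum2_id comp1m.

have [f' [f'h <-]] := pullback_confl pb fg.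
suff {1}<- : f' = inj2 V Y \oc (prj2 V Y \oc f') by [].
have p1f' : prj1 V Y \oc f' = 0.
  by have := congr1 (comp (prj1 V Z)) (confl_comp0 f'h); rewrite /h ?bipE.
by rewrite -[LHS]comp1m -dsum2_id compDl -!compA p1f' compm0 add0r.
Qed.

End Exact.

(** * Vanishing of extensions *)

Section Extensions.
Variables (K : fieldType) (C : exactCat K).
Implicit Types A X Y Z W T U E V : C.

Lemma ext_lift X Y E Z (f : hom Y E) (g : hom E Z) (h : hom X Z) :
  Ext1_zero X Y -> confl f g -> exists h', g \oc h' = h.
Proof.
move=> ext fg; have [W [b [f' [g' [[e _] f'g' _]]]]] := pullback_ex h fg.
have [t gt] := ext _ _ _ f'g'; exists (b \oc t).
by rewrite compA e -compA gt compm1.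
Qed.

(** The right square of a morphism of conflations that is invertible on the left
    terms is a pullback: [z] splits the conflation pulled back along [h]. *)
Lemma lift_of_confl_map X Y Z E F W T (f : hom X E) (g : hom E Z) (f1 : hom Y F)
    (g1 : hom F W) (u : hom X Y) (s : hom E F) (w : hom Z W) (h : hom T Z)
    (z : hom T F) :
  confl f g -> confl f1 g1 -> is_iso u -> s \oc f = f1 \oc u ->
  w \oc g = g1 \oc s -> w \oc h = g1 \oc z -> exists h', g \oc h' = h.
Proof.
move=> fg fg1 [u' [u'u _]] sf wg wh.
have [E1 [b [f' [g' [[e _] f'g' bf']]]]] := pullback_ex h fg.
have [rho Hrho] : exists rho, f1 \oc rho = s \oc b - z \oc g'.
  apply: (confl_lift fg1); rewrite compBr !compA -wg -wh -!compA e.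
  by rewrite subrr.
have rf : rho \oc f' = u.
  apply: (confl_mono fg1); rewrite compA Hrho compBl -!compA (confl_comp0 f'g').
  by rewrite compm0 subr0 bf' sf.
have [|t [gt _]] := split_mono_epi (s := u' \oc rho) f'g'.
  by rewrite -compA rf.
by exists (b \oc t); rewrite compA e -compA gt compm1.
Qed.

(** * Approximations and presentations *)

(** Up to the automorphism of [A + X] that adds [v], this is [id + p] followed by
    the projection to [X]. *)
Lemma deflation_copair A X P (v : hom A X) (p : hom P X) : deflation p ->
  deflation (v \oc prj1 A P + p \oc prj2 A P).
Proof.
move=> [N [k kp]].
have d1 : deflation (v \oc prj1 A X + prj2 A X).
  have -> : v \oc prj1 A X + prj2 A X
      = prj2 A X \oc (idm _ + inj2 A X \oc v \oc prj1 A X).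
    by rewrite ?bipE addrC.
  apply: deflation_iso; last by exists A, (inj1 A X); exact: confl_dsum2.
  exists (idm _ - inj2 A X \oc v \oc prj1 A X).
  by rewrite ?bipE addrK subrK.
have -> : v \oc prj1 A P + p \oc prj2 A P = (v \oc prj1 A X + prj2 A X) \oc
    (inj1 A X \oc prj1 A P + inj2 A X \oc p \oc prj2 A P).
  by rewrite ?bipE.
apply: (ex_defl_comp (confl_axioms C)) d1; exists N, (inj2 A P \oc k).
exact: confl_add_id.
Qed.

Lemma in_add_copies A n : in_add A (dsum (fun _ : 'I_n => A)).
Proof. by exists n, (zero_ob C); exact: dsum2_zero (zero_obP C). Qed.

(** Finitely many maps [A -> X] generate all of them modulo those that factor
    through projectives; the latter lift along a deflation [P -> X] with [P]
    projective. So a sum of [P] and copies of [A] serves. *)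
Lemma deflation_approx A X : frobenius C -> stably_hom_finite C ->
  (forall P : C, projective P -> in_add A P) ->
  exists A' (g : hom A' X),
    [/\ in_add A A', deflation g & forall h : hom A X, exists h', g \oc h' = h].
Proof.
move=> [enough_p _ _] fin addP; have [P [p [projP dp]]] := enough_p X.
have [n [v genv]] := fin A X.
pose An := dsum (fun _ : 'I_n => A).
pose w : hom An X := \sum_i v i \oc dproj (fun _ : 'I_n => A) i.
exists (An \oplus P), (w \oc prj1 An P + p \oc prj2 An P); split.
- by apply: in_add_dsum2; [exact: in_add_copies | exact: addP].
- exact: deflation_copair.
move=> h; have [c [Q [a [b [projQ hab]]]]] := genv h.
have [b' pb'] := projQ _ _ p b dp.
exists (inj1 An P \oc (\sum_i c i *: dinj (fun _ : 'I_n => A) i) + inj2 An P \oc (b' \oc a)).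
rewrite ?bipE pb' -hab addrC -[RHS](subrK (\sum_i c i *: v i)); congr (_ + _).
rewrite comp_sumr; apply: eq_bigr => i _; rewrite compZr; congr (_ *: _).
rewrite /w comp_suml (bigD1 i) //= -compA dproj_inj compm1 big1 ?addr0 // => j ji.
by rewrite -compA dproj_inj0 ?compm0 // eq_sym.
Qed.

(** Schanuel's lemma, with vanishing extensions in place of projectivity: the
    pullback of [g] and [g'] splits in two ways. *)
Lemma schanuel A1 A2 B1 B2 X (f : hom A2 A1) (g : hom A1 X) (f' : hom B2 B1)
    (g' : hom B1 X) :
  confl f g -> confl f' g' -> Ext1_zero B1 A2 -> Ext1_zero A1 B2 ->
  A2 \oplus B1 \cong B2 \oplus A1.
Proof.
move=> fg fg' ext ext'.
have [W [b [k [q [pb kq _]]]]] := pullback_ex g' fg.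
have [k' [kb' _]] := pullback_confl (pullback_sym pb) fg'.
apply: iso_trans (iso_sym (split_confl_iso kq (ext _ _ _ kq))) _.
exact: split_confl_iso kb' (ext' _ _ _ kb').
Qed.

Lemma confl_comp_kernel X Z B D Y (i : hom X B) (d : hom B D) (j : hom Z D)
    (e : hom D Y) : confl i d -> confl j e ->
  exists N (k : hom X N) (q : hom N Z) (b : hom N B),
    confl k q /\ confl b (e \oc d).
Proof.
move=> id je; have [N [b [k [q [[E up] kq bk]]]]] := pullback_ex j id.
exists N, k, q, b; split=> //; apply: kernel_confl; last first.
  by apply: (ex_defl_comp (confl_axioms C)); [exists X, i | exists Z, j].
split; first by rewrite -compA E compA (confl_comp0 je) comp0m.
move=> W h; rewrite -compA => /(confl_lift je)[h' jh'].
have [w [[bw qw] uw]] := up _ h h' (esym jh').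
exists w; split=> // w' bw'; apply: uw; split=> //.
by apply: (confl_mono je); rewrite compA -E -compA bw' jh'.
Qed.

(** A horseshoe lemma. Because of the lift [l], the pullback of [g] along
    [Z1 -> Z] is [Z1 + X], so that [Z1 + X -> Y] is a deflation with kernel
    [Z2]; composed with [Z1 + X1 -> Z1 + X], its kernel becomes an extension of
    [Z2] by [X2]. *)
Lemma horseshoe X Y Z X1 X2 Z1 Z2 (f : hom X Y) (g : hom Y Z) (fx : hom X2 X1)
    (gx : hom X1 X) (fz : hom Z2 Z1) (gz : hom Z1 Z) (l : hom Z1 Y) :
  confl f g -> confl fx gx -> confl fz gz -> g \oc l = gz -> Ext1_zero Z2 X2 ->
  exists N (k : hom N (Z1 \oplus X1)) (q : hom (Z1 \oplus X1) Y),
    N \cong X2 \oplus Z2 /\ confl k q.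
Proof.
move=> fg fgx fgz gl ext.
pose d := l \oc prj1 Z1 X + f \oc prj2 Z1 X.
have pb : is_pullback gz g (prj1 Z1 X) d.
  split; first by rewrite /d ?bipE gl (confl_comp0 fg) comp0m addr0.
  move=> W u v uv; have [m fm] : exists m, f \oc m = v - l \oc u.
    by apply: (confl_lift fg); rewrite compBr compA gl uv subrr.
  exists (inj1 Z1 X \oc u + inj2 Z1 X \oc m); split.
    by rewrite /d ?bipE fm addrC subrK.
  move=> w [uw dw]; rewrite -[RHS]comp1m -dsum2_id compDl -!compA uw.
  congr (_ + _ \oc _); apply: (confl_mono fg); rewrite fm -dw -uw /d compDl !compA.
  by rewrite addrAC subrr add0r.
have [j [jd _]] := pullback_confl pb fgz.
have [N [k [q [b [kq bed]]]]] := confl_comp_kernel (confl_add_id Z1 fgx) jd.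
exists N, b, (d \oc (inj1 Z1 X \oc prj1 Z1 X1 + inj2 Z1 X \oc gx \oc prj2 Z1 X1)).
by split=> //; apply: split_confl_iso kq (ext _ _ _ kq).
Qed.

(** The copresentation is pulled back along [V + E -> V + X], a deflation with
    kernel [X']; the new middle term is an extension of [W] by [X']. *)
Lemma copresentation_trade Y W Z V X X' E (a : hom Y W) (b : hom W Z)
    (f : hom X' E) (g : hom E X) :
  confl a b -> Z \cong V \oplus X -> confl f g -> Ext1_zero W X' ->
  exists W' (a' : hom Y W') (b' : hom W' (V \oplus E)),
    W' \cong X' \oplus W /\ confl a' b'.
Proof.
move=> ab /iso_sym[phi iphi] fg ext.
pose d := inj1 V X \oc prj1 V E + inj2 V X \oc g \oc prj2 V E.
have fd : confl (inj2 V E \oc f) (phi \oc d).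
  apply: (@ex_iso _ _ _ (confl_axioms C) _ _ _ _ _ _ (inj2 V E \oc f) d _ _
    (idm X') (idm _) phi); rewrite ?comp1m ?compm1 //; try exact: is_iso_id.
  exact: confl_add_id.
have [W' [k [a' [b' [pb ab' _]]]]] := pullback_ex (phi \oc d) ab.
have [j [jk _]] := pullback_confl (pullback_sym pb) fd.
by exists W', a', b'; split=> //; exact: split_confl_iso jk (ext _ _ _ jk).
Qed.

End Extensions.

Section OppositeExtensions.
Variables (K : fieldType) (C : exactCat K).

Lemma op_ext1_zero X Y : @Ext1_zero K (op C) X Y <-> @Ext1_zero K C Y X.
Proof.
split=> ext E f g fg.
  have [s gs] := ext E g f fg.
  by have [t [gt _]] := split_mono_epi fg gs; exists t.
have [t gt] := ext E g f fg.
have fg' : @confl K C _ _ _ g f := fg.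
by have [s [sf _]] := split_epi_mono fg' gt; exists s.
Qed.

Lemma ext_extend (X Y E Z : C) (f : hom Z E) (g : hom E X) (h : hom Z Y) :
  Ext1_zero X Y -> confl f g -> exists h', h' \oc f = h.
Proof.
move=> ext fg.
exact: (@ext_lift K (op C) Y X E Z g f h (proj2 (op_ext1_zero Y X) ext) fg).
Qed.

(** This is the end of the exact sequence
    Hom(T, A) -> Hom(T, X) -> Ext^1(T, N) -> Ext^1(T, A). *)
Lemma ext_approx_kernel (T N A X : C) (k : hom N A) (g : hom A X) :
  confl k g -> Ext1_zero T A -> (forall h : hom T X, exists h', g \oc h' = h) ->
  Ext1_zero T N.
Proof.
move=> kg ext lift_g E i p ip.
have [e ei] := ext_extend k ext ip.
have [l lp] : exists l, l \oc p = g \oc e.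
  by apply: (confl_desc ip); rewrite -compA ei (confl_comp0 kg).
have [l' gl'] := lift_g l.
have [s ks] : exists s, k \oc s = e - l' \oc p.
  by apply: (confl_lift kg); rewrite compBr compA gl' lp subrr.
have [|t [gt _]] := split_mono_epi (s := s) ip; last by exists t.
apply: (confl_mono kg).
by rewrite compA ks compBl -compA (confl_comp0 ip) compm0 subr0 compm1.
Qed.

End OppositeExtensions.

(** * The Calabi-Yau property *)

Section CalabiYau.
Variables (K : fieldType) (C : exactCat K).
Implicit Types A X Y Z W T U E V : C.
Hypothesis frob : frobenius C.
Variables (S : suspension C)
  (phi : forall X Y, hom Y (sus S (sus S X)) -> hom X Y -> K).
Hypothesis cy : CY2_duality phi.

Lemma stably_zero_sus X Y (h : hom X (sus S Y)) :
  stably_zero h <-> exists z, sus_out S Y \oc z = h.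
Proof.
split=> [[P [u [v [projP ->]]]]|[z <-]].
  have [v' <-] := projP _ _ (sus_out S Y) v (confl_deflation (sus_confl S Y)).
  by exists (v' \oc u); rewrite compA.
exists (sus_hull S Y), z, (sus_out S Y); split=> //.
by case: frob => _ _ ->; exact: sus_hull_inj.
Qed.

Lemma stably_zero_compl X Y Z (h : hom Y Z) (f : hom X Y) :
  stably_zero f -> stably_zero (h \oc f).
Proof. by move=> [P [u [v [projP ->]]]]; exists P, u, (h \oc v); rewrite compA. Qed.

(** The class in the stable Hom(Z, Sigma X) of a conflation [X -> E -> Z] *)
Lemma confl_class X E Z (f : hom X E) (g : hom E Z) : confl f g ->
  exists (s : hom E (sus_hull S X)) (w : hom Z (sus S X)),
    s \oc f = sus_in S X /\ w \oc g = sus_out S X \oc s.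
Proof.
move=> fg; have [s sf] := sus_hull_inj (sus_in S X) (confl_inflation fg).
exists s; have [w wg] : exists w, w \oc g = sus_out S X \oc s.
  by apply: (confl_desc fg); rewrite -compA sf (confl_comp0 (sus_confl S X)).
by exists w.
Qed.

Lemma ext1_zeroP X Y : Ext1_zero X Y <-> forall h : hom X (sus S Y), stably_zero h.
Proof.
split=> [ext h|stz E f g fg].
  by apply/stably_zero_sus; exact: ext_lift ext (sus_confl S Y).
have [s [w [sf wg]]] := confl_class fg.
have /stably_zero_sus[z zw] := stz w.
have [t gt] : exists t, g \oc t = idm X; last by exists t.
by apply: (lift_of_confl_map fg (sus_confl S Y) (is_iso_id Y) _ wg (z := z));
  rewrite compm1.
Qed.

Lemma sus_map_ex X Y (f : hom X Y) : exists g : hom (sus S X) (sus S Y), sus_map f g.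
Proof.
have [h hi] := sus_hull_inj (sus_in S Y \oc f)
  (confl_inflation (sus_confl S X)).
have [g go] : exists g, g \oc sus_out S X = sus_out S Y \oc h.
  apply: (confl_desc (sus_confl S X)).
  by rewrite -compA hi compA (confl_comp0 (sus_confl S Y)) comp0m.
by exists g, h.
Qed.

Lemma sus_map_comp X Y Z (f : hom X Y) (f' : hom Y Z)
    (g : hom (sus S X) (sus S Y)) (g' : hom (sus S Y) (sus S Z)) :
  sus_map f g -> sus_map f' g' -> sus_map (f' \oc f) (g' \oc g).
Proof.
move=> [h [hi go]] [h' [hi' go']]; exists (h' \oc h); split.
  by rewrite -compA hi compA hi' compA.
by rewrite -compA go compA go' compA.
Qed.

(** The suspension is faithful on the stable category. *)
Lemma sus_faithful X Y (f : hom X Y) (g : hom (sus S X) (sus S Y)) :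
  sus_map f g -> stably_zero g -> stably_zero f.
Proof.
move=> [h [hi go]] /stably_zero_sus[k ok].
have [m im] : exists m, sus_in S Y \oc m = h - k \oc sus_out S X.
  by apply: (confl_lift (sus_confl S Y)); rewrite compBr compA ok go subrr.
exists (sus_hull S X), (sus_in S X), m; split.
  by case: frob => _ _ ->; exact: sus_hull_inj.
apply: (confl_mono (sus_confl S Y)); rewrite compA im compBl hi -compA.
by rewrite (confl_comp0 (sus_confl S X)) compm0 subr0.
Qed.

Lemma cy_pair_neq0 X Y (h : hom Y (sus S (sus S X))) :
  ~ stably_zero h -> exists f, phi h f != 0.
Proof.
move=> nz; apply: contra_notP nz => /forallNP phi0; apply: (cy_inj cy) => f.
by apply/eqP/negPn/negP; exact: phi0.
Qed.

(** Ext^1(Y, X) = Hom(Y, Sigma X) embeds by Sigma into Hom(Sigma Y, Sigma^2 X),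
    which the duality pairs with Hom(X, Sigma Y) = Ext^1(X, Y). *)
Lemma ext1_zero_sym X Y : Ext1_zero X Y -> Ext1_zero Y X.
Proof.
move=> /ext1_zeroP ext; apply/ext1_zeroP => h; have [sh hsh] := sus_map_ex h.
apply: (sus_faithful hsh); apply: contrapT => /cy_pair_neq0[f /eqP]; apply.
exact/(cy_stabr cy)/ext.
Qed.

Lemma ext1_zero_addl T X Y : add_factor T X -> Ext1_zero T Y -> Ext1_zero X Y.
Proof.
move=> [n [a [b ba]]] /ext1_zeroP ext; apply/ext1_zeroP => h.
have Hz i : exists z, sus_out S Y \oc z = h \oc b i by apply/stably_zero_sus.
have [z oz] := choice Hz.
apply/stably_zero_sus; exists (\sum_i z i \oc a i).
rewrite -[h]compm1 -ba !comp_sumr; apply: eq_bigr => i _.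
by rewrite !compA oz.
Qed.

Lemma ext1_zero_add T U X Y : in_add T X -> in_add U Y -> Ext1_zero T U ->
  Ext1_zero X Y.
Proof.
move=> /in_add_factor TX /in_add_factor UY ext.
apply: ext1_zero_addl TX _; apply/ext1_zero_sym.
exact: ext1_zero_addl UY (ext1_zero_sym ext).
Qed.

(** Only one of the two exchange conflations can fail to be exact under
    Hom(T, -). If [h : T -> X] does not lift to [E], its image in
    Ext^1(T, X') is paired nontrivially by the duality with some
    [w : X' -> Sigma T], so that [e = Sigma h . w] is a nonzero class in
    Ext^1(X', X). Up to an endomorphism [u] of [X] this is the class of the
    second conflation, and [u] is invertible since [e] is nonzero. But [e] kills
    every map [T -> X'], because it factors through [Sigma T] and [T] is
    rigid. *)
Lemma exchange_dichotomy T X X' E E' (f : hom X' E) (g : hom E X) (f' : hom X E')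
    (g' : hom E' X') :
  confl f g -> confl f' g' -> rigid T -> Ext1_zero E' X ->
  (forall u : hom X X, is_iso u \/ exists u', u = u' \oc f') ->
  (forall h : hom T X, exists k, g \oc k = h) \/
  (forall h : hom T X', exists k, g' \oc k = h).
Proof.
move=> fg fg' rigT extE'X endX.
have [|/existsNP[h nh]] := pselect (forall h : hom T X, exists k, g \oc k = h).
  by left.
right=> h'.
have [s [al [sf alg]]] := confl_class fg.
have nzal : ~ stably_zero (al \oc h).
  move=> /stably_zero_sus[z oz]; apply: nh.
  by apply: (lift_of_confl_map fg (sus_confl S X') (is_iso_id X') _ alg (esym oz));
    rewrite compm1.
have [sh Hsh] := sus_map_ex h; have [sal Hsal] := sus_map_ex al.
have nzs : ~ stably_zero (sal \oc sh).
  by move=> nz; apply: nzal; exact: sus_faithful (sus_map_comp Hsh Hsal) nz.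
have [w] := cy_pair_neq0 nzs; rewrite (cy_natY cy) => nzw.
have nze : ~ stably_zero (sh \oc w).
  by move=> /(cy_stabr cy) => /(_ sal) z0; rewrite z0 eqxx in nzw.
have [z oz] : exists z, sus_out S X \oc z = sh \oc w \oc g'.
  by apply/stably_zero_sus; exact: (proj1 (ext1_zeroP E' X) extE'X).
(* [z] and [u] make [e] the class of the conflation pushed out along [u]. *)
have [u iu] : exists u, sus_in S X \oc u = z \oc f'.
  by apply: (confl_lift (sus_confl S X)); rewrite compA oz -compA (confl_comp0 fg') compm0.
case: (endX u) => [isou|[u' uu']].
  have /stably_zero_sus[y oy] : stably_zero (sh \oc w \oc h').
    rewrite -compA; apply: stably_zero_compl; exact: (proj1 (ext1_zeroP T T) rigT).
  exact: (lift_of_confl_map fg' (sus_confl S X) isou (esym iu) (esym oz) (esym oy)).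
have [z' z'g'] : exists z', z' \oc g' = z - sus_in S X \oc u'.
  by apply: (confl_desc fg'); rewrite compBl -iu uu' -compA subrr.
case: nze; apply/stably_zero_sus; exists z'; apply: (confl_epi fg').
by rewrite -compA z'g' compBr oz compA (confl_comp0 (sus_confl S X)) comp0m subr0.
Qed.

End CalabiYau.

(** * The split Grothendieck group *)

Section SplitGrothendieckGroup.
Variables (K : fieldType) (C : addCat K) (T : C).
Implicit Types X Y Z : addob T.

Local Notation piK0 := (\pi_(Quotient.quot (@K0_null K C T)))%qT.

Lemma pi_K0_rel x : K0_rel x -> piK0 x = 0.
Proof.
move=> rx; rewrite -(raddf0 piK0); apply/eqP.
rewrite -Quotient.idealrBE subr0.
by apply/asboolP => H H0 HB Hr; exact: Hr.
Qed.

Lemma K0class_dsum2 X Y Z : sval Z \cong sval X \oplus sval Y ->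
  K0class Z = K0class X + K0class Y.
Proof.
move=> XYZ; apply/eqP; rewrite -subr_eq0 opprD addrA /K0class -!raddfB.
by apply/eqP/pi_K0_rel; right; exists X, Y, Z.
Qed.

Lemma K0class_zero X : is_zero (sval X) -> K0class X = 0.
Proof.
move=> z; have /K0class_dsum2 : sval X \cong sval X \oplus sval X.
  exact: iso_sym (dsum2_zero _ z).
by move/(congr1 (fun x => x - K0class X)); rewrite subrr addrK.
Qed.

End SplitGrothendieckGroup.

Section ZeroConflations.
Variables (K : fieldType) (C : exactCat K).
Implicit Types X Z : C.

Lemma confl_id_zero X Z : is_zero Z -> confl (idm X) (0 : hom X Z).
Proof.
move=> z; apply: kernel_confl; last exact: deflation_to_zero.
split; first by rewrite comp0m.
by move=> W h _; exists h; split; rewrite ?comp1m // => h'; rewrite comp1m.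
Qed.

End ZeroConflations.

Lemma confl_zero_id (K : fieldType) (C : exactCat K) (X Z : C) :
  is_zero Z -> confl (0 : hom Z X) (idm X).
Proof. exact: (@confl_id_zero K (op C) X Z). Qed.

(** * Indices *)

Section Index.
Variables (K : fieldType) (C : exactCat K).
Hypothesis frob : frobenius C.
Variables (S : suspension C)
  (phi : forall X Y, hom Y (sus S (sus S X)) -> hom X Y -> K).
Hypothesis cy : CY2_duality phi.
Variable T : C.
Hypothesis rigT : rigid T.
Implicit Types X Y Z : C.

Let ext_add X Y : in_add T X -> in_add T Y -> Ext1_zero X Y.
Proof. by move=> TX TY; exact: (ext1_zero_add frob cy TX TY rigT). Qed.

Lemma index_of_intro X (T1 T2 : addob T) (f : hom (sval T2) (sval T1))
    (g : hom (sval T1) X) : confl f g -> index_of X (K0class T1 - K0class T2).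
Proof.
move=> fg; split=> [|U1 U2 f' g' fg']; first by exists T1, T2, f, g.
have add_sum : in_add T (sval T2 \oplus sval U1).
  by apply: in_add_dsum2; [exact: svalP T2 | exact: svalP U1].
pose N : addob T := exist _ _ add_sum.
have := schanuel fg fg' (ext_add (svalP U1) (svalP T2)) (ext_add (svalP T1) (svalP U2)).
move=> N'.
have e := @K0class_dsum2 _ _ _ T2 U1 N (iso_refl _).
have e' := @K0class_dsum2 _ _ _ U2 T1 N N'.
by apply/eqP; rewrite subr_eq addrAC eq_sym subr_eq addrC -e e' addrC.
Qed.

Lemma index_of_uniq X x y : index_of (T := T) X x -> index_of X y -> x = y.
Proof. by move=> [[T1 [T2 [f [g fg]]]] ux] [_ uy]; rewrite (ux _ _ _ _ fg) (uy _ _ _ _ fg). Qed.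

(** The index is additive on conflations that Hom(T, -) keeps exact, as
    [horseshoe] applies to them. *)
Lemma index_of_confl X Y Z x z (f : hom X Y) (g : hom Y Z) : confl f g ->
  (forall h : hom T Z, exists h', g \oc h' = h) ->
  index_of (T := T) X x -> index_of Z z -> index_of Y (x + z).
Proof.
move=> fg lift_g [[X1 [X2 [fx [gx fgx]]]] ux] [[Z1 [Z2 [fz [gz fgz]]]] uz].
rewrite (ux _ _ _ _ fgx) (uz _ _ _ _ fgz).
have [l gl] : exists l, g \oc l = gz.
  have [n [a [b ba]]] := in_add_factor (svalP Z1).
  have [c gc] := choice (fun i => lift_g (gz \oc b i)).
  exists (\sum_i c i \oc a i); rewrite comp_sumr -[RHS]compm1 -ba comp_sumr.
  by apply: eq_bigr => i _; rewrite !compA gc.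
have [N [k [q [NXZ kq]]]] := horseshoe fg fgx fgz gl (ext_add (svalP Z2) (svalP X2)).
have addN : in_add T N.
  apply: in_add_iso (iso_sym NXZ) _.
  by apply: in_add_dsum2; [exact: svalP X2 | exact: svalP Z2].
have addM : in_add T (sval Z1 \oplus sval X1).
  by apply: in_add_dsum2; [exact: svalP Z1 | exact: svalP X1].
have := index_of_intro (T1 := exist _ _ addM) (T2 := exist _ _ addN) kq.
rewrite (@K0class_dsum2 _ _ _ Z1 X1 (exist _ _ addM) (iso_refl _)).
rewrite (@K0class_dsum2 _ _ _ X2 Z2 (exist _ N addN) NXZ).
by rewrite [_ + K0class X1]addrC opprD addrACA.
Qed.

Lemma index_of_iso X Y x : X \cong Y -> index_of (T := T) X x -> index_of Y x.
Proof.
move=> [p ip] [[T1 [T2 [f [g fg]]]] ux]; rewrite (ux _ _ _ _ fg).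
apply: (index_of_intro (f := f) (g := p \oc g)).
apply: (@ex_iso _ _ _ (confl_axioms C) _ _ _ _ _ _ f g _ _ (idm _) (idm _) p) => //;
  by rewrite ?comp1m ?compm1 //; exact: is_iso_id.
Qed.

Lemma index_of_add (X : addob T) : index_of (sval X) (K0class X).
Proof.
pose N : addob T := exist _ _ (in_add_zero T (zero_obP C)).
have N0 : K0class N = 0 by apply: K0class_zero; exact: zero_obP.
rewrite -[K0class X]subr0 -N0.
exact: (index_of_intro (T1 := X) (T2 := N) (confl_zero_id _ (zero_obP C))).
Qed.

Lemma index_of_zero X : is_zero X -> index_of (T := T) X 0.
Proof.
move=> z; have addX := in_add_zero T z.
rewrite -(@K0class_zero _ _ _ (exist _ X addX) z); exact: (index_of_add (exist _ X addX)).
Qed.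

Lemma index_of_sum_over (I : finType) (F : I -> C) (x : I -> K0 T) (s : seq I) :
  (forall i, index_of (F i) (x i)) ->
  index_of (sum_over F s) (\sum_i x i *+ count_mem i s).
Proof.
move=> indF; elim: s => [|i s IHs].
  by rewrite big1 => [|i _]; [exact/index_of_zero/zero_obP | rewrite mulr0n].
suff -> : \sum_j x j *+ count_mem j (i :: s) = x i + \sum_j x j *+ count_mem j s.
  apply: (index_of_confl (confl_dsum2 (F i) (sum_over F s)) _ (indF i) IHs).
  by move=> h; exists (inj2 _ _ \oc h); rewrite ?bipE.
under eq_bigr => j _ do rewrite /= mulrnDr.
rewrite big_split /= (bigD1 i) //= eqxx mulr1n big1 ?addr0 // => j ji.
by rewrite eq_sym (negbTE ji).
Qed.

End Index.

(** * Radical endomorphisms *)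

Section Nakayama.
Variables (K : fieldType) (C : addCat K) (A : C).
Variable R : hom A A -> Prop.
Hypotheses (sR : subspace R)
  (R_compl : forall u v : hom A A, R u -> R (v \oc u)).

(** The ideal [rad^2 + R] of End(A) *)
Definition rad_square_mod (u : hom A A) : Prop :=
  exists n (b a : 'I_n -> hom A A),
    (forall l, rad (b l) /\ rad (a l)) /\ R (u - \sum_l b l \oc a l).

Lemma rad_square_modD u v :
  rad_square_mod u -> rad_square_mod v -> rad_square_mod (u + v).
Proof.
move=> [n [b [a [rab Ru]]]] [m [b' [a' [rab' Rv]]]].
exists (n + m)%N.
exists (fun i => match split i with inl j => b j | inr j => b' j end).
exists (fun i => match split i with inl j => a j | inr j => a' j end); split.
  by move=> i; case: (split i).
rewrite big_split_ord /=; have := subspaceD sR Ru Rv.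
rewrite addrACA -opprD; congr (R (_ - (_ + _))); apply: eq_bigr => i _.
  by rewrite (unsplitK (inl i)).
by rewrite (unsplitK (inr i)).
Qed.

Lemma rad_square_mod_id u : R u -> rad_square_mod u.
Proof.
move=> Ru; exists 0%N, (fun _ => 0), (fun _ => 0); split=> [[]//|].
by rewrite big_ord0 subr0.
Qed.

Lemma rad_square_mod_comp (b a : hom A A) : rad b -> rad a -> rad_square_mod (b \oc a).
Proof.
move=> rb ra; exists 1%N, (fun _ => b), (fun _ => a); split=> //.
by rewrite big_ord1 subrr; case: sR.
Qed.

(** Nakayama's lemma, by induction on the number of generators of [rad] modulo
    [R] as a left ideal: writing the last one as a combination with coefficients
    [d i] in [rad], the invertibility of [1 - d ord_max] expresses it through
    the others. *)
Lemma nakayama_gens n (v : 'I_n -> hom A A) :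
  (forall u, rad u -> rad_square_mod u) -> (forall i, rad (v i)) ->
  (forall u, rad u -> exists c : 'I_n -> hom A A, R (u - \sum_i c i \oc v i)) ->
  forall u, rad u -> R u.
Proof.
move=> sq; elim: n => [|n IHn] in v * => rv genv.
  by move=> u /genv[c]; rewrite big_ord0 subr0.
pose v' i := v (widen_ord (leqnSn n) i); pose vn := v ord_max.
have [m [b [a [rba Rvn]]]] := sq _ (rv ord_max).
have [c Rc] := choice (fun l => genv _ (rba l).2).
pose d i := \sum_l b l \oc c l i.
have Rd : R (vn - \sum_i d i \oc v i).
  have -> : vn - \sum_i d i \oc v i
      = (vn - \sum_l b l \oc a l) + \sum_l b l \oc (a l - \sum_i c l i \oc v i).
    suff -> : \sum_l b l \oc (a l - \sum_i c l i \oc v i)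
        = \sum_l b l \oc a l - \sum_i d i \oc v i by rewrite addrA subrK.
    under eq_bigr => l _ do rewrite compBr comp_sumr.
    rewrite big_split /= sumrN exchange_big /=; congr (_ - _); apply: eq_bigr => i _.
    by rewrite comp_suml; apply: eq_bigr => l _; rewrite compA.
  by apply: subspaceD => //; apply: subspace_sum => // l; exact: R_compl.
have rd i : rad (d i) by apply: rad_sum => l; apply: rad_compr; case: (rba l).
have [w [wl _]] : is_iso (idm A - d ord_max).
  by have := rd ord_max (idm A); rewrite comp1m.
have Rw : R (vn - \sum_i w \oc d (widen_ord (leqnSn n) i) \oc v' i).
  have := R_compl w Rd; rewrite big_ord_recr /= -/vn opprD addrA addrAC.
  rewrite -[X in X - _ - _]comp1m -compBl compBr compA wl comp1m comp_sumr.
  by congr (R (_ - _)); apply: eq_bigr => i _; exact: compA.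
apply: (IHn v') => [i|u /genv[e Re]]; first exact: rv.
exists (fun i => e (widen_ord (leqnSn n) i) + e ord_max \oc w \oc d (widen_ord (leqnSn n) i)).
have := subspaceD sR Re (R_compl (e ord_max) Rw); congr R.
rewrite big_ord_recr /= compBr opprD [u + (_ - _)]addrA subrKA -addrA -opprD.
congr (_ - _); rewrite comp_sumr -big_split /=; apply: eq_bigr => i _.
by rewrite compDl !compA.
Qed.

End Nakayama.

Section StablyZero.
Variables (K : fieldType) (C : exactCat K).
Implicit Types X Y P Q : C.

Lemma projective_dsum2 P Q : projective P -> projective Q -> projective (P \oplus Q).
Proof.
move=> projP projQ Y Z g f dg.
have [u gu] := projP _ _ g (f \oc inj1 P Q) dg.
have [v gv] := projQ _ _ g (f \oc inj2 P Q) dg.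
exists (u \oc prj1 P Q + v \oc prj2 P Q).
by rewrite compDr !compA gu gv -!(compA f) -compDr dsum2_id compm1.
Qed.

Lemma projective_retract P Q (f : hom P Q) (g : hom Q P) :
  g \oc f = idm P -> projective Q -> projective P.
Proof.
move=> gf projQ Y Z e h de; have [k ek] := projQ _ _ e (h \oc g) de.
by exists (k \oc f); rewrite compA ek -compA gf compm1.
Qed.

Lemma subspace_stably_zero X Y : projective (zero_ob C) ->
  subspace (@stably_zero K C X Y).
Proof.
move=> proj0; split; first by exists (zero_ob C), 0, 0; rewrite compm0.
move=> a x y [P [u [v [projP ->]]]] [Q [u' [v' [projQ ->]]]].
exists (P \oplus Q), (inj1 P Q \oc u + inj2 P Q \oc u').
exists (a *: v \oc prj1 P Q + v' \oc prj2 P Q); split; first exact: projective_dsum2.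
by rewrite ?bipE compZl.
Qed.

Lemma projective_zero : projective (zero_ob C).
Proof. by move=> Y Z g f _; exists 0; rewrite compm0 (zero_to f (zero_obP C)). Qed.

Lemma ext1_zero_projective X Y : projective X -> Ext1_zero X Y.
Proof.
move=> projX E f g fg.
by have [t gt] := projX _ _ g (idm X) (confl_deflation fg); exists t.
Qed.

End StablyZero.

(** * Cluster-tilting objects *)

Section Tilting.
Variables (K : closedFieldType) (C : exactCat K).
Hypotheses (KS : krull_schmidt C) (frob : frobenius C) (fin : stably_hom_finite C).
Variables (S : suspension C)
  (phi : forall X Y, hom Y (sus S (sus S X)) -> hom X Y -> K).
Hypothesis cy : CY2_duality phi.
Implicit Types X Y Z W V E : C.

(** The stable endomorphism ring of [A] is finite-dimensional over an
    algebraically closed field, and isomorphisms are not stably zero. *)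
Lemma nonprojective_split_local (A : C) :
  local_end A -> ~ projective A -> split_local A.
Proof.
move=> lA nA; have [n [v genv]] := fin A A.
apply: (split_local_functional (L := id) (U := @stably_zero K C A A) (v := v)) => //.
  exact: subspace_stably_zero (@projective_zero K C).
move=> x [P [u [w [projP xE]]]] [y [yx _]]; apply: nA.
by apply: (projective_retract (f := u) (g := y \oc w)) => //; rewrite -compA -xE.
Qed.

Section OneObject.
Variables (m : nat) (F : 'I_m -> C).
Hypothesis tilt : cluster_tilting F.

Lemma tilting_local i : local_end (F i).
Proof. by case: tilt => ind _ _ _; exact: indecomposable_local. Qed.

Lemma tilting_ext X Y : in_add (dsum F) X -> in_add (dsum F) Y -> Ext1_zero X Y.
Proof. by case: tilt => _ _ rig _ TX TY; exact: (ext1_zero_add frob cy TX TY rig). Qed.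

Lemma projective_in_add (P : C) : projective P -> in_add (dsum F) P.
Proof.
case: tilt => _ _ _ add projP; apply: add.
exact: (ext1_zero_sym frob cy (ext1_zero_projective projP)).
Qed.

Lemma in_add_rest k l : l != k -> in_add (rest F k) (F l).
Proof.
move=> lk.
exact: (in_add_summand (fun i : {i : 'I_m | i \in predC1 k} => F (val i))
  (exist _ l lk)).
Qed.

Lemma in_add_rest_sum_over k (s : seq 'I_m) : k \notin s -> in_add (rest F k) (sum_over F s).
Proof.
move=> ks; apply: in_add_sum_over => i si; apply: in_add_rest.
by apply: contraNneq ks => <-.
Qed.

Lemma add_rest_sum_over k X : in_add (rest F k) X ->
  exists s : seq 'I_m, k \notin s /\ X \cong sum_over F s.
Proof.
move=> /in_add_factor /(add_sum_over KS)[i|s Xs]; first exact: tilting_local.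
exists (map val s); split.
  by apply/negP => /mapP[[i ik] _ /= ki]; move: ik; rewrite -ki inE eqxx.
suff -> : sum_over F (map val s) = sum_over (F \o val) s by [].
by elim: s {Xs} => //= i s ->.
Qed.

Lemma projective_in_add_rest k (P : C) : ~ projective (F k) -> projective P ->
  in_add (rest F k) P.
Proof.
move=> nk projP.
have [s Ps] := add_sum_over KS tilting_local (in_add_factor (projective_in_add projP)).
apply: in_add_iso (iso_sym Ps) _; apply: in_add_rest_sum_over.
apply/negP => /(sum_over_summand F)[f [g gf]]; apply: nk.
have [p [p' [p'p pp']]] := Ps.
apply: (projective_retract (f := p' \oc f) (g := g \oc p)) => //.
by rewrite -compA (compA p) pp' comp1m.
Qed.

Lemma dsum_res_id Z n (a : 'I_n -> hom Z (dsum F)) (b : 'I_n -> hom (dsum F) Z) :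
  \sum_l b l \oc a l = idm Z ->
  \sum_l \sum_i (b l \oc dinj F i) \oc (dproj F i \oc a l) = idm Z.
Proof.
move<-; apply: eq_bigr => l _; rewrite -[in RHS](compm1 (b l)) -dsum_id.
by rewrite comp_sumr comp_suml; apply: eq_bigr => i _; rewrite !compA.
Qed.

Definition through_rest k (u : hom (F k) (F k)) : Prop :=
  exists Z (a : hom (F k) Z) (b : hom Z (F k)), in_add (rest F k) Z /\ u = b \oc a.

Lemma subspace_through_rest k : subspace (@through_rest k).
Proof.
split.
  exists (zero_ob C), 0, 0; rewrite compm0; split=> //.
  exact: in_add_zero (zero_obP C).
move=> c x y [Z [a [b [Za ->]]]] [W [a' [b' [Wa ->]]]].
exists (Z \oplus W), (inj1 Z W \oc a + inj2 Z W \oc a').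
exists (c *: b \oc prj1 Z W + b' \oc prj2 Z W); split; first exact: in_add_dsum2.
by rewrite ?bipE compZl.
Qed.

(** In the absence of loops, radical endomorphisms of [F k] factor through the
    other summands: modulo these, the radical of End(F k) equals its square, and
    Nakayama's lemma applies because the stable endomorphism ring is
    finite-dimensional. *)
Lemma rad_through_rest k : ~ projective (F k) ->
  (forall u : hom (F k) (F k), rad u -> rad2 (dsum F) u) ->
  forall u : hom (F k) (F k), rad u -> through_rest u.
Proof.
move=> nk noloop.
have sR := @subspace_through_rest k.
have Rl (u v : hom (F k) (F k)) : through_rest u -> through_rest (v \oc u).
  by move=> [Z [a [b [Za ->]]]]; exists Z, a, (v \oc b); rewrite compA.
have [n [v genv]] := fin (F k) (F k).
have [N [w [radw genw]]] := @subspace_fingen K _ (@rad K C (F k) (F k))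
  (@through_rest k) n v sR (@subspace_rad K C _ _) (fun x _ =>
   let: ex_intro c cP := genv x in ex_intro _ c
    (let: ex_intro P (ex_intro a (ex_intro b (conj projP e))) := cP in
     ex_intro _ P (ex_intro _ a (ex_intro _ b
       (conj (projective_in_add_rest nk projP) e))))).
apply: (nakayama_gens sR Rl (v := w)) => // [u /noloop|u /genw[c Rc]]; last first.
  exists (fun i => c i *: idm _).
  by under eq_bigr => i _ do rewrite compZl comp1m.
move=> [q [Z [a [b [Zadd rab ->]]]]].
have D := rad_square_modD sR.
apply: big_ind => //; first by apply: rad_square_mod_id; case: sR.
move=> l _; have [ra rb] := rab l.
have [p [x [y yx]]] := in_add_factor (Zadd l).
rewrite -[b l]compm1 -(dsum_res_id yx) comp_sumr comp_suml.
apply: big_ind => // [|i _]; first by apply: rad_square_mod_id; case: sR.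
rewrite comp_sumr comp_suml; apply: big_ind => // [|j _].
  by apply: rad_square_mod_id; case: sR.
rewrite compA -compA; have [jk|jk] := eqVneq j k.
  rewrite jk; apply: rad_square_mod_comp => //.
    exact: rad_compr.
  exact: rad_compl.
apply: rad_square_mod_id; exists (F j), (dproj F j \oc x i \oc a l), (b l \oc (y i \oc dinj F j)).
by split=> //; exact: in_add_rest.
Qed.

Lemma lift_rad_right X E (g : hom E X) :
  (forall i (h : hom (F i) X), rad h -> exists h', h = g \oc h') ->
  forall Z (h : hom Z X), in_add (dsum F) Z -> rad h -> exists h', h = g \oc h'.
Proof.
move=> lift_g Z h /in_add_factor[n [a [b ba]]] rh.
have H l i : exists h', h \oc (b l \oc dinj F i) = g \oc h'.
  by apply: lift_g; exact: rad_compr.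
exists (\sum_l \sum_i sval (cid (H l i)) \oc (dproj F i \oc a l)).
rewrite -[LHS]compm1 -(dsum_res_id ba) !comp_sumr; apply: eq_bigr => l _.
rewrite !comp_sumr; apply: eq_bigr => i _; rewrite compA.
by case: cid => h' /= ->; rewrite !compA.
Qed.

Lemma lift_rad_left X E (f : hom X E) :
  (forall i (h : hom X (F i)), rad h -> exists h', h = h' \oc f) ->
  forall Z (h : hom X Z), in_add (dsum F) Z -> rad h -> exists h', h = h' \oc f.
Proof.
move=> lift_f Z h /in_add_factor[n [a [b ba]]] rh.
have H l i : exists h', (dproj F i \oc a l) \oc h = h' \oc f.
  by apply: lift_f; exact: rad_compl.
exists (\sum_l \sum_i (b l \oc dinj F i) \oc sval (cid (H l i))).
rewrite -[LHS]comp1m -(dsum_res_id ba) !comp_suml; apply: eq_bigr => l _.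
rewrite !comp_suml; apply: eq_bigr => i _; rewrite -compA.
by case: cid => h' /= ->; rewrite !compA.
Qed.

End OneObject.

End Tilting.

(** * Exchange conflations *)

(** The maps [E -> F k] and [F k -> E'] of the exchange conflations are minimal
    almost split in add(T), as radical endomorphisms of [F k] factor through the
    other summands; so the middle terms are read off the quiver. *)
Section Exchange.
Variables (K : closedFieldType) (C : exactCat K).
Hypotheses (KS : krull_schmidt C) (frob : frobenius C) (fin : stably_hom_finite C).
Variables (S : suspension C)
  (phi : forall X Y, hom Y (sus S (sus S X)) -> hom X Y -> K).
Hypothesis cy : CY2_duality phi.
Implicit Types X Y Z W V E : C.
Variables (m : nat) (F : 'I_m -> C).
Hypothesis tilt : cluster_tilting F.
Variables (q : 'M[nat]_m) (k : 'I_m).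
Hypotheses (endo : endoquiver F q) (noloop : q k k = 0%N) (nk : ~ projective (F k)).

Let locF i : local_end (F i) := tilting_local KS tilt i.
Let noniso i j : i != j -> ~ F i \cong F j.
Proof. by case: tilt => _ + _ _; exact. Qed.

Lemma in_add_rest_dsum Z : in_add (rest F k) Z -> in_add (dsum F) Z.
Proof.
move=> /(add_rest_sum_over KS tilt)[s [_ Zs]]; apply: in_add_iso (iso_sym Zs) _.
by apply: in_add_sum_over => i _; exact: in_add_summand.
Qed.

Lemma rad_endo_through_rest (u : hom (F k) (F k)) : rad u -> through_rest u.
Proof.
apply: (rad_through_rest KS frob fin cy tilt nk) => {}u ru.
have := endo k k; rewrite noloop => -[v [_ /(_ u ru)[c]]].
by rewrite big_ord0 subr0.
Qed.

Lemma exchange_right X : exchange_conflation (rest F k) X (F k) ->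
  exists E (f : hom X E) (g : hom E (F k)) (s : seq 'I_m),
    [/\ confl f g, k \notin s, E \cong sum_over F s
      & forall l, count_mem l s = q l k].
Proof.
move=> [E [f [g [fg nsplit _ [[addE appr] ming]]]]].
have [s [ks Es]] := add_rest_sum_over KS tilt addE.
exists E, f, g, s; split=> // l.
apply: (@count_arrows K C (dsum F) (F l) (F k) E g) => //.
- exact: in_add_summand.
- exact: in_add_rest_dsum.
- exact: rad_not_split_epi.
- apply: lift_rad_right => i h rh.
  have [ik|ik] := eqVneq i k; last by apply: appr; exact: in_add_rest.
  subst i; have [Z [a [b [Za ->]]]] := rad_endo_through_rest rh.
  by have [b' ->] := appr _ b Za; exists (b' \oc a); rewrite compA.
- by apply: (mult_iso (iso_sym Es)); exact: mult_sum_over.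
Qed.

Lemma exchange_left X : exchange_conflation (rest F k) (F k) X ->
  exists E (f : hom (F k) E) (g : hom E X) (s : seq 'I_m),
    [/\ confl f g, k \notin s, E \cong sum_over F s,
        forall l, count_mem l s = q k l
      & forall u : hom (F k) (F k), is_iso u \/ exists u', u = u' \oc f].
Proof.
move=> [E [f [g [fg nsplit [[addE appr] minf] _]]]].
have [s [ks Es]] := add_rest_sum_over KS tilt addE.
have lift_endo (u : hom (F k) (F k)) : rad u -> exists u', u = u' \oc f.
  move=> /rad_endo_through_rest[Z [a [b [Za ->]]]].
  by have [a' ->] := appr _ a Za; exists (b \oc a'); rewrite compA.
exists E, f, g, s; split=> // [l|u]; last first.
  by have [|/lift_endo] := rad_endoP u (locF k); [left | right].
apply: (@count_arrows_left K C (dsum F) (F l) (F k) E f) => //.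
- exact: in_add_summand.
- exact: in_add_rest_dsum.
- apply: rad_not_split_mono => // -[t tf]; apply: nsplit.
  by have [t' [gt' _]] := split_mono_epi fg tf; exists t'.
- apply: lift_rad_left => i h rh.
  have [ik|ik] := eqVneq i k; last by apply: appr; exact: in_add_rest.
  by subst i; exact: lift_endo.
- by apply: (mult_iso (iso_sym Es)); exact: mult_sum_over.
Qed.

End Exchange.

(** * Coindices *)

Section Coindex.
Variables (K : fieldType) (C : exactCat K).
Implicit Types A U X Y Z W V E : C.

(** [z] is the coefficient of [A] in the coindex of [Y] with respect to add U,
    that is, in [U1] - [U2] for a copresentation [Y -> U1 -> U2]. *)
Definition coindex_coef U A Y (z : int) : Prop :=
  exists U1 U2 (f : hom Y U1) (g : hom U1 U2) a b,
    [/\ confl f g, in_add U U1, in_add U U2, mult A U1 a /\ mult A U2 b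
      & z = a%:Z - b%:Z].

(** [schanuel] in the opposite category *)
Lemma coschanuel Y U1 U2 V1 V2 (f : hom Y U1) (g : hom U1 U2) (f' : hom Y V1)
    (g' : hom V1 V2) :
  confl f g -> confl f' g' -> Ext1_zero U2 V1 -> Ext1_zero V2 U1 ->
  U2 \oplus V1 \cong V2 \oplus U1.
Proof.
move=> fg fg' ext ext'; apply/op_iso.
apply: (@schanuel K (op C) U1 U2 V1 V2 Y g f g' f' fg fg').
  exact/op_ext1_zero.
exact/op_ext1_zero.
Qed.

Lemma coindex_coef_uniq U A Y z z' :
  (forall X Z, in_add U X -> in_add U Z -> Ext1_zero X Z) -> split_local A ->
  coindex_coef U A Y z -> coindex_coef U A Y z' -> z = z'.
Proof.
move=> rig sA [U1 [U2 [f [g [a [b [fg U1U U2U [ma mb] ->]]]]]]].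
move=> [V1 [V2 [f' [g' [a' [b' [fg' V1U V2U [ma' mb'] ->]]]]]]].
have UV := coschanuel fg fg' (rig _ _ U2U V1U) (rig _ _ V2U U1U).
have := mult_uniq sA (mult_iso UV (mult_dsum2 mb ma')) (mult_dsum2 mb' ma).
move=> e; apply/eqP; rewrite subr_eq addrAC eq_sym subr_eq -!PoszD.
by rewrite eqz_nat addnC e addnC.
Qed.

Lemma sum_over_extract (I : eqType) (F : I -> C) k (s : seq I) :
  sum_over F s \cong
    sum_over F (filter (predC1 k) s) \oplus sum_over F (nseq (count_mem k s) k).
Proof.
elim: s => [|i s IHs] /=; first exact: iso_sym (dsum2_zero _ (zero_obP C)).
have IH := dsum2_iso (iso_refl (F i)) IHs.
have [ik|ik] := eqVneq i k; apply: iso_trans IH _ => /=.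
  rewrite {1}ik; set V := sum_over F _; set W := sum_over F _.
  apply: iso_trans (iso_sym (dsum2A _ _ _)) _; apply: iso_trans (dsum2A _ _ _).
  by apply: dsum2_iso; [exact: dsum2C | exact: iso_refl].
by rewrite add0n /=; exact: iso_sym (dsum2A _ _ _).
Qed.

(** [copresentation_trade] for each of [c] copies of [F k]; the multiplicities
    tell the new terms to be [W + c X'] and [V + c E]. *)
Lemma copresentation_trade_copies U' X' E (I : Type) (F : I -> C) k
    (f : hom X' E) (g : hom E (F k)) c :
  (forall Y Z, in_add U' Y -> in_add U' Z -> Ext1_zero Y Z) ->
  in_add U' X' -> in_add U' E -> confl f g ->
  forall V W Y Z (a : hom Y W) (b : hom W Z), confl a b ->
  Z \cong V \oplus sum_over F (nseq c k) -> in_add U' W -> in_add U' V ->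
  exists W' V' (a' : hom Y W') (b' : hom W' V'),
    [/\ confl a' b', in_add U' W', in_add U' V'
      & forall A w v x e, mult A W w -> mult A V v -> mult A X' x -> mult A E e ->
          mult A W' (w + c * x) /\ mult A V' (v + c * e)].
Proof.
move=> rig addX' addE fg; elim: c => [|c IHc] V W Y Z a b ab ZV addW addV.
  have [p ip] : Z \cong V.
    by apply: iso_trans ZV _; exact: dsum2_zero (zero_obP C).
  exists W, V, a, (p \oc b); split=> // [|A w v x e mw mv _ _]; last by rewrite !mul0n !addn0.
  apply: (@ex_iso _ _ _ (confl_axioms C) _ _ _ _ _ _ a b _ _ (idm _) (idm _) p) => //;
    by rewrite ?comp1m ?compm1 //; exact: is_iso_id.
have ZV' : Z \cong (V \oplus sum_over F (nseq c k)) \oplus F k.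
  apply: iso_trans ZV _ => /=; apply: iso_trans (iso_sym (dsum2A _ _ _)).
  by apply: dsum2_iso; [exact: iso_refl | exact: dsum2C].
have [W1 [a1 [b1 [W1W ab1]]]] :=
  copresentation_trade ab ZV' fg (rig _ _ addW addX').
have ZV1 : (V \oplus sum_over F (nseq c k)) \oplus E
    \cong (V \oplus E) \oplus sum_over F (nseq c k).
  apply: iso_trans (dsum2A _ _ _) _; apply: iso_trans (iso_sym (dsum2A _ _ _)).
  by apply: dsum2_iso; [exact: iso_refl | exact: dsum2C].
have [|W' [V' [a' [b' [ab' addW' addV' mWV']]]]] := IHc _ _ _ _ _ _ ab1 ZV1 _ (in_add_dsum2 addV addE).
  by apply: in_add_iso (iso_sym W1W) _; exact: in_add_dsum2.
exists W', V', a', b'; split=> // A w v x e mw mv mx me.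
have [|mW mV] := mWV' A (x + w)%N (v + e)%N x e _ (mult_dsum2 mv me) mx me.
  exact: mult_iso (iso_sym W1W) (mult_dsum2 mx mw).
by rewrite mulSn (addnA w) (addnC w) mulSn (addnA v).
Qed.

End Coindex.

Section CoindexMutation.
Variables (K : closedFieldType) (C : exactCat K).
Hypotheses (KS : krull_schmidt C) (frob : frobenius C) (fin : stably_hom_finite C).
Variables (S : suspension C)
  (phi : forall X Y, hom Y (sus S (sus S X)) -> hom X Y -> K).
Hypothesis cy : CY2_duality phi.
Implicit Types X Y Z W V E : C.

Lemma inflation_approx (A Y : C) :
  (forall P : C, projective P -> in_add A P) ->
  exists A' (f : hom Y A'),
    [/\ in_add A A', inflation f & forall h : hom Y A, exists h', h' \oc f = h].
Proof.
move=> addP.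
have [|A' [f [addA' df lift_f]]] := @deflation_approx K (op C) A Y (op_frobenius frob)
    (op_stably_hom_finite frob fin).
  by move=> P /op_projective injP; apply/op_in_add/addP; case: frob => _ _ ->.
by exists A', f; split=> //; exact/op_in_add.
Qed.

Variables (m : nat) (F : 'I_m -> C) (k : 'I_m) (X' : C).
Let F' := replace F k X'.
Hypotheses (tilt : cluster_tilting F) (tilt' : cluster_tilting F').
Hypothesis nk : ~ projective (F k).

Let locF i : local_end (F i) := tilting_local KS tilt i.
Let locF' i : local_end (F' i) := tilting_local KS tilt' i.
Let noniso i j : i != j -> ~ F i \cong F j.
Proof. by case: tilt => _ + _ _; exact. Qed.
Let noniso' i j : i != j -> ~ F' i \cong F' j.
Proof. by case: tilt' => _ + _ _; exact. Qed.

Lemma sum_over_replace (s : seq 'I_m) : k \notin s -> sum_over F' s = sum_over F s.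
Proof.
elim: s => //= i s IHs; rewrite in_cons negb_or => /andP[ki /IHs->].
by rewrite /F' /replace eq_sym (negbTE ki).
Qed.

Lemma replace_rest : rest F' k = rest F k.
Proof.
congr (dsum _); apply: funext => -[i ik] /=; rewrite /F' /replace.
by rewrite inE /= in ik; rewrite (negbTE ik).
Qed.

(** Coindices under mutation. If every map from [Y] to [F k] factors through
    [E], then [Y] has a copresentation [Y -> U1 -> U2] with [F k] absent from
    [U1], and a copresentation with respect to the mutated object results from
    replacing [F k] in [U2] by [E] - [X']. *)
Lemma coindex_mutation E (f : hom X' E) (g : hom E (F k))
    (s : seq 'I_m) Y :
  confl f g -> k \notin s -> E \cong sum_over F s ->
  (forall h : hom Y (F k), exists h', g \oc h' = h) ->
  exists c : nat,
    [/\ coindex_coef (dsum F) (F k) Y (- c%:Z),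
        coindex_coef (dsum F') X' Y c%:Z
      & forall j, j != k -> exists z,
          coindex_coef (dsum F) (F j) Y z /\
          coindex_coef (dsum F') (F j) Y (z - (c * count_mem j s)%:Z)].
Proof.
move=> fg ks Es lift_g.
have addE : in_add (rest F k) E.
  by apply: in_add_iso (iso_sym Es) _; exact: in_add_rest_sum_over.
have [A' [a [addA' [N [b ab]] lift_a]]] :=
  inflation_approx Y (fun P => projective_in_add_rest KS frob cy tilt nk (P := P)).
have extU := tilting_ext frob cy tilt.
have extU' := tilting_ext frob cy tilt'.
have addA'F := in_add_rest_dsum KS tilt addA'.
have lift_add Z (h : hom Y Z) : in_add (rest F k) Z -> exists h', h' \oc a = h.
  move=> /in_add_factor[n [x [y yx]]].
  have [z za] := choice (fun i => lift_a (x i \oc h)).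
  exists (\sum_i y i \oc z i); rewrite comp_suml -[RHS]comp1m -yx comp_suml.
  by apply: eq_bigr => i _; rewrite -!compA za.
have lift_F (h : hom Y (dsum F)) : exists h', h' \oc a = h.
  have H i : exists h', h' \oc a = dproj F i \oc h.
    have [ik|ik] := eqVneq i k; last by apply: lift_add; exact: in_add_rest.
    subst i; have [h1 gh1] := lift_g (dproj F k \oc h).
    by have [h2 h2a] := lift_add _ h1 addE; exists (g \oc h2); rewrite -compA h2a.
  exists (\sum_i dinj F i \oc sval (cid (H i))).
  rewrite comp_suml -[RHS]comp1m -dsum_id comp_suml; apply: eq_bigr => i _.
  by case: cid => z /= za; rewrite -!compA za.
have addN : in_add (dsum F) N.
  case: (tilt) => _ _ _; apply; apply: (ext1_zero_sym frob cy); apply/op_ext1_zero.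
  apply: (@ext_approx_kernel K (op C) (dsum F) N A' Y b a ab) => //.
  by apply/op_ext1_zero; apply: extU => //; exact: in_add_self.
have [t' [kt' A't]] := add_rest_sum_over KS tilt addA'.
have [t Nt] : exists t : seq 'I_m, N \cong sum_over F t.
  exact: add_sum_over KS locF (in_add_factor addN).
pose c := count_mem k t; exists c.
have Nt' := iso_trans Nt (sum_over_extract F k t).
pose t0 := filter (predC1 k) t.
have kt0 : k \notin t0 by rewrite mem_filter /= eqxx.
have addr u : k \notin u -> in_add (dsum F') (sum_over F u).
  move=> ku; apply: (in_add_rest_dsum KS tilt' (k := k)).
  by rewrite replace_rest; exact: in_add_rest_sum_over.
have [||||W' [V' [a' [b' [ab' addW' addV' mWV]]]]] :=
    @copresentation_trade_copies K C (dsum F') X' E _ F k f g c extU' _ _ fg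
      _ _ _ _ a b ab Nt' _ _.
- have -> : X' = F' k by rewrite /F' /replace eqxx.
  exact: in_add_summand.
- by apply: in_add_iso (iso_sym Es) _; exact: addr.
- by apply: in_add_iso (iso_sym A't) _; exact: addr.
- exact: addr.
have mF j u : mult (F j) (sum_over F u) (count_mem j u) by exact: mult_sum_over.
have X'k : X' = F' k by rewrite /F' /replace eqxx.
have mX' u : k \notin u -> mult X' (sum_over F u) 0.
  move=> ku; rewrite {1}X'k -(sum_over_replace ku) -(count_memPn ku).
  exact: mult_sum_over.
split.
- exists A', N, a, b, 0%N, c; split=> //; last by rewrite sub0r.
  split; last exact: mult_iso (iso_sym Nt) (mF k t).
  rewrite -(count_memPn kt'); exact: mult_iso (iso_sym A't) (mF k t').
- have [mW mV] := mWV X' 0%N 0%N 1%N 0%N (mult_iso (iso_sym A't) (mX' _ kt'))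
    (mX' _ kt0) (mult_self X') (mult_iso (iso_sym Es) (mX' _ ks)).
  exists W', V', a', b', (0 + c * 1)%N, (0 + c * 0)%N; split=> //.
  by rewrite muln0 muln1 subr0.
move=> j jk; exists ((count_mem j t')%:Z - (count_mem j t)%:Z); split.
  exists A', N, a, b, (count_mem j t'), (count_mem j t); split=> //.
  by split; [exact: mult_iso (iso_sym A't) (mF j t') | exact: mult_iso (iso_sym Nt) (mF j t)].
have mX'j : mult (F j) X' 0.
  have Fj : F j = F' j by rewrite /F' /replace (negbTE jk).
  by rewrite Fj X'k; apply: mult_noniso => //; exact: noniso'.
have [mW mV] := mWV (F j) _ _ _ _ (mult_iso (iso_sym A't) (mF j t')) (mF j t0) mX'j
  (mult_iso (iso_sym Es) (mF j s)).
have e : count_mem j t0 = count_mem j t.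
  rewrite /t0 count_filter; apply: eq_count => i /=.
  by have [->|//] := eqVneq i j; rewrite jk.
exists W', V', a', b', (count_mem j t' + c * 0)%N, (count_mem j t0 + c * count_mem j s)%N.
by split=> //; rewrite muln0 addn0 e PoszD opprD addrA.
Qed.

End CoindexMutation.

(** * Combinatorics of mutation *)

Lemma sgz_max_mul (x y : int) :
  Num.sg x * Num.max (x * y) 0 = x * Num.max (if 0 <= x then y else - y) 0.
Proof.
have [x0|x0|->] := ltrgtP x 0; last by rewrite sgr0 !mul0r.
  have := @maxr_pMr _ (- x) (- y) 0; rewrite oppr_ge0 (ltW x0) mulrNN mulr0.
  by move=> <- //; rewrite ltr0_sg // mulN1r mulNr opprK.
have := @maxr_pMr _ x y 0; rewrite (ltW x0) mulr0 => <- //.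
by rewrite gtr0_sg // mul1r.
Qed.

Lemma max_arrows (a b : nat) : a = 0%N \/ b = 0%N -> Num.max (a%:Z - b%:Z) 0 = a%:Z.
Proof.
by case=> ->; rewrite ?sub0r ?subr0; [apply/max_idPr; rewrite oppr_le0 | apply/max_idPl].
Qed.

Lemma subn_subn_int (a b : nat) : (a - b)%N%:Z - (b - a)%N%:Z = a%:Z - b%:Z.
Proof.
have [ab|/ltnW ab] := leqP a b.
  by rewrite (eqP ab) -subzn // sub0r opprB.
by rewrite (eqP ab) -subzn // subr0.
Qed.

Section Seeds.
Variables r n : nat.
Implicit Types (q : 'M[nat]_(r + n)) (k : 'I_r).

(** The arrows between frozen vertices, which mutation of endoquivers
    leaves undetermined, do not influence the others. *)
Definition agree q q' : Prop :=
  forall i j : 'I_(r + n), ~~ ((r <= i) && (r <= j))%N -> q i j = q' i j.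

Lemma agree_mut q q' k : agree q q' ->
  agree (quiver_mut (lshift n k) q) (quiver_mut (lshift n k) q').
Proof.
move=> qq' i j ij; rewrite !mxE.
have mut (l : 'I_(r + n)) : q l (lshift n k) = q' l (lshift n k) /\
    q (lshift n k) l = q' (lshift n k) l.
  by split; apply: qq'; rewrite /= [(r <= k)%N]leqNgt ltn_ord ?andbF.
have ji : ~~ ((r <= j) && (r <= i))%N by rewrite andbC.
by rewrite !(mut _).1 !(mut _).2 !qq'.
Qed.

(** Without 2-cycles, sgn(b_ik) max(b_ik b_kj, 0) is the number of paths
    i -> k -> j minus the number of paths j -> k -> i. *)
Lemma exchange_mut q k (M : 'M[int]_(r + r, r)) :
  (forall i j : 'I_r, q (lshift n i) (lshift n j) = 0%N
      \/ q (lshift n j) (lshift n i) = 0%N) ->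
  (forall i j, M (lshift r i) j
      = (q (lshift n i) (lshift n j))%:Z - (q (lshift n j) (lshift n i))%:Z) ->
  forall i j, matrix_mut k M (lshift r i) j
      = (quiver_mut (lshift n k) q (lshift n i) (lshift n j))%:Z
        - (quiver_mut (lshift n k) q (lshift n j) (lshift n i))%:Z.
Proof.
move=> no2 HM i j; rewrite !mxE !eq_lshift [(j == k) || _]orbC.
case: ifP => _; first by rewrite HM opprB.
rewrite sgz_max_mul !HM subn_subn_int !PoszD !PoszM.
move: (no2 i k) (no2 j k).
set a := q _ _; set a' := q _ (lshift n i); set b := q _ _; set b' := q _ (lshift n j).
move=> aa' bb'; rewrite [in RHS]opprD [RHS]addrACA; congr (_ + _).
case: aa' => ->; last first.
  by rewrite subr0 max_arrows ?muln0 ?PoszM ?mulr0 ?subr0 //; case: bb'; [right|left].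
rewrite sub0r mul0r sub0r oppr_ge0 opprB; case: ifP => a'0.
  have -> : a' = 0%N by apply/eqP; rewrite -leqn0 -lez_nat.
  by rewrite mulr0 oppr0 mul0r.
by rewrite max_arrows // mulNr mulrC.
Qed.

Lemma lower_mut k (M : 'M[int]_(r + r, r)) i j : j != k ->
  matrix_mut k M (rshift r i) j = M (rshift r i) j + M (rshift r i) k *
    Num.max (if 0 <= M (rshift r i) k then M (lshift r k) j else - M (lshift r k) j) 0.
Proof. by move=> jk; rewrite !mxE eq_rlshift (negbTE jk) sgz_max_mul. Qed.

Lemma lower_mut_pivot k (M : 'M[int]_(r + r, r)) i :
  matrix_mut k M (rshift r i) k = - M (rshift r i) k.
Proof. by rewrite !mxE eqxx orbT. Qed.

(** Linear independence of the c-vectors passes through mutations, and it keeps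
    them nonzero, so that a c-vector cannot have both signs. *)
Definition free_c_vectors (M : 'M[int]_(r + r, r)) : Prop :=
  forall v : 'I_r -> int,
    (forall i, \sum_k M (rshift r i) k * v k = 0) -> forall k, v k = 0.

Lemma free_c_vectors_mut k (M M' : 'M[int]_(r + r, r)) (f : 'I_r -> int) :
  (forall i, M' (rshift r i) k = - M (rshift r i) k) ->
  (forall i j, j != k ->
     M' (rshift r i) j = M (rshift r i) j + M (rshift r i) k * f j) ->
  free_c_vectors M -> free_c_vectors M'.
Proof.
move=> M'k M'j freeM v Mv.
pose w j := if j == k then \sum_(l | l != k) f l * v l - v k else v j.
have w0 : forall j, w j = 0.
  apply: freeM => i; rewrite -[RHS](Mv i) [LHS](bigD1 k) // [RHS](bigD1 k) //= M'k.
  rewrite /w eqxx mulrBr mulNr [RHS]addrC addrAC; congr (_ - _).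
  rewrite mulr_sumr -big_split /=; apply: eq_bigr => l lk.
  by rewrite (negbTE lk) M'j // mulrDl mulrA addrC.
have vj j : j != k -> v j = 0 by move=> jk; have := w0 j; rewrite /w (negbTE jk).
move=> j; have [->|/vj//] := eqVneq j k; have := w0 k; rewrite /w eqxx big1 => [|l /vj->].
  by rewrite sub0r => /eqP; rewrite oppr_eq0 => /eqP.
by rewrite mulr0.
Qed.

Lemma free_c_vectors_col (M : 'M[int]_(r + r, r)) k :
  free_c_vectors M -> exists i, M (rshift r i) k != 0.
Proof.
move=> freeM; apply: contrapT => /forallNP M0.
have := freeM (fun j => (j == k)%:R) _ k; rewrite eqxx => H.
suff : (1 : int) = 0 by [].
apply: H => i; rewrite (bigD1 k) //= eqxx mulr1 big1 => [|j /negbTE->]; last by rewrite mulr0.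
by rewrite addr0; apply/eqP/negPn/negP; exact: M0.
Qed.

Lemma greenP (M : 'M[int]_(r + r, r)) k :
  reflect (forall i, 0 <= M (rshift r i) k) (green M k).
Proof. by apply: (iffP forallP) => H i; have := H i; rewrite mxE. Qed.

End Seeds.

Lemma labels_betweenP r (s t : seq 'I_r) : exists p s' t',
  [/\ s = p ++ s', t = p ++ t' & labels_between s t = rev s' ++ t'].
Proof.
elim: s t => [|i s IHs] [|j t]; try by exists [::]; eexists; eexists.
have [ij|ij] := eqVneq i j; last by
  exists [::], (i :: s), (j :: t); split=> //=; rewrite (negbTE ij).
have [p [s' [t' [-> -> e]]]] := IHs t; exists (j :: p), s', t'.
by rewrite ij; split=> //=; rewrite eqxx.
Qed.

(** * Seeds of the mutation family *)

Section IndexExistence.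
Variables (K : closedFieldType) (C : exactCat K).
Hypotheses (KS : krull_schmidt C) (frob : frobenius C) (fin : stably_hom_finite C).
Variables (S : suspension C)
  (phi : forall X Y, hom Y (sus S (sus S X)) -> hom X Y -> K).
Hypothesis cy : CY2_duality phi.

(** The kernel of an approximation [A -> X] has no extensions by [T], so it lies
    in add(T) as well. *)
Lemma index_of_ex (I : finType) (F : I -> C) X : cluster_tilting F ->
  exists x : K0 (dsum F), index_of X x.
Proof.
move=> tilt; have [_ _ rig add] := tilt.
have addP (P : C) : projective P -> in_add (dsum F) P.
  move=> projP; apply: add.
  exact: (ext1_zero_sym frob cy (ext1_zero_projective projP)).
have [A [g [addA [N [k kg]] lift_g]]] := deflation_approx X frob fin addP.
have addN : in_add (dsum F) N.
  apply: add; apply: ext_approx_kernel kg _ lift_g.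
  exact: (ext1_zero_add frob cy (in_add_self _) addA rig).
exists (K0class (exist _ A addA) - K0class (exist _ N addN)).
exact: (index_of_intro frob cy rig (T1 := exist _ A addA) (T2 := exist _ N addN) kg).
Qed.

End IndexExistence.

Section Mutation.
Variables (K : closedFieldType) (C : exactCat K).
Hypotheses (KS : krull_schmidt C) (frob : frobenius C) (fin : stably_hom_finite C).
Variables (S : suspension C)
  (phi : forall X Y, hom Y (sus S (sus S X)) -> hom X Y -> K).
Hypothesis cy : CY2_duality phi.
Hypothesis cluster : cluster_structure C.
Variables (r n : nat) (T0 : 'I_(r + n) -> C).
Hypotheses (T0_tilting : cluster_tilting T0)
  (T0_nonproj : forall i : 'I_r, ~ projective (T0 (lshift n i))).
Variable Q0 : 'M[nat]_(r + n).
Hypothesis Q0_endoquiver : endoquiver T0 Q0.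
Variable T : tree r -> 'I_(r + n) -> C.
Hypothesis T_family : mutation_family T0 T.
Implicit Types (t : tree r) (k : 'I_r).

Lemma edge_sym k t t' : edge k t t' -> edge k t' t.
Proof. by case; [right | left]. Qed.

Lemma tree_ind_rcons (P : tree r -> Prop) : P (tree_root r) ->
  (forall t t' k, sval t' = rcons (sval t) k -> P t -> P t') -> forall t, P t.
Proof.
move=> P0 PS [s]; elim/last_ind: s => [|s k IHs] st.
  by rewrite (_ : exist _ _ _ = tree_root r) //; exact: val_inj.
have s' : sorted [rel i j | i != j] s.
  by move: st; rewrite -cats1 => /cat_sorted2[].
exact: (PS (exist _ s s') _ k) (IHs s').
Qed.

Lemma edge_mutated k t t' : edge k t t' ->
  mutated_summand (T t) (lshift n k) (T t' (lshift n k)).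
Proof. by move=> e; case: T_family => _ /(_ _ _ _ e)[]. Qed.

Lemma edge_replace k t t' : edge k t t' ->
  T t' = replace (T t) (lshift n k) (T t' (lshift n k)).
Proof.
move=> e; apply: funext => j; rewrite /replace; case: eqVneq => [->//|jk].
by case: T_family => _ /(_ _ _ _ e)[+ _]; exact.
Qed.

Lemma family_root : T (tree_root r) = T0.
Proof. by apply: funext => j; case: T_family. Qed.

Lemma family_tilting t : cluster_tilting (T t).
Proof.
elim/tree_ind_rcons: t => [|t t' k tt' _]; first by rewrite family_root.
have e : edge k t t' by left.
by rewrite (edge_replace e); case: (edge_mutated e).
Qed.

(** A projective [T t' k] would be a summand of [T t], since it has no
    extensions with it. *)
Lemma family_nonproj t (i : 'I_r) : ~ projective (T t (lshift n i)).
Proof.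
elim/tree_ind_rcons: t => [|t t' k tt' IHt]; first by rewrite family_root.
have e : edge k t t' by left.
rewrite (edge_replace e) /replace eq_lshift; case: eqVneq => // _ projX.
have [ind nXk tilt'] := edge_mutated e.
have tilt := family_tilting t.
have locF i' : local_end (T t i') := tilting_local KS tilt i'.
have [l Xl] := add_local_summand locF (indecomposable_local KS ind)
  (in_add_factor (projective_in_add frob cy tilt projX)).
have [lk|lk] := eqVneq l (lshift n k); first by subst l.
case: tilt' => _ noniso _ _; case: (noniso (lshift n k) l); first by rewrite eq_sym.
by rewrite /replace eqxx (negbTE lk).
Qed.

Lemma family_frozen t (i : 'I_(r + n)) : projective (T t i) -> (r <= i)%N.
Proof.
by case: (split_ordP i) => j -> /=; [move/family_nonproj | rewrite leq_addr].
Qed.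

Lemma endoquiver_no_cycles t q : endoquiver (T t) q ->
  (forall i, q i i = 0%N) /\ (forall i j, q i j = 0%N \/ q j i = 0%N).
Proof.
move=> endo; have [q' [endo' loop cyc]] := cs_quiver cluster (family_tilting t).
suff -> : q = q' by [].
apply/matrixP => i j; apply: quot_dim_uniq (endo i j) (endo' i j).
exact: subspace_rad2.
Qed.

Lemma endoquiver_mut k t t' q qt : edge k t t' ->
  endoquiver (T t) qt -> agree q qt ->
  exists qt', endoquiver (T t') qt' /\ agree (quiver_mut (lshift n k) q) qt'.
Proof.
move=> e endo qqt; have [qt' [endo' _ _]] := cs_quiver cluster (family_tilting t').
exists qt'; split=> // i j ij.
rewrite (agree_mut k qqt) //; apply/esym.
apply: (cs_quiver_mut cluster (family_tilting t) (family_nonproj (i := k)) (edge_mutated e)) => //.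
  by rewrite -(edge_replace e).
by move=> [/family_frozen ri /family_frozen rj]; rewrite ri rj in ij.
Qed.

Lemma tree_quiver_endo t : exists qt, endoquiver (T t) qt /\ agree (tree_quiver Q0 t) qt.
Proof.
elim/tree_ind_rcons: t => [|t t' k tt' [qt [endo ag]]].
  by exists Q0; rewrite family_root.
have e : edge k t t' by left.
have [qt' [endo' ag']] := endoquiver_mut e endo ag; exists qt'; split=> //.
by rewrite /tree_quiver tt' -cats1 foldl_cat.
Qed.

Variable t1 : tree r.

(** The categorical meaning of a seed [(q, M, G)] at [t]: [q] is the endoquiver of
    [T t], the c-vectors in [M] collect the coindices of the [T t1 i] with
    respect to [T t], and [G] the indices of the [T t j] with respect to
    [T t1]. *)
Record seed_at t (s : 'M[nat]_(r + n) * 'M[int]_(r + r, r) * 'M[int]_(r + n)) : Prop :=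
  SeedAt {
  seed_quiver : exists qt, endoquiver (T t) qt /\ agree s.1.1 qt;
  seed_upper : forall i j, s.1.2 (lshift r i) j
    = (s.1.1 (lshift n i) (lshift n j))%:Z - (s.1.1 (lshift n j) (lshift n i))%:Z;
  seed_lower : forall i k, coindex_coef (dsum (T t)) (T t (lshift n k))
    (T t1 (lshift n i)) (s.1.2 (rshift r i) k);
  seed_free : free_c_vectors s.1.2;
  seed_index : forall j, index_of (T t j)
    (\sum_i summand_class (T t1) i *~ s.2 i j) }.

Definition seed_step : 'M[nat]_(r + n) * 'M[int]_(r + r, r) * 'M[int]_(r + n) ->
    'I_r -> 'M[nat]_(r + n) * 'M[int]_(r + r, r) * 'M[int]_(r + n) :=
  fun '(q, M, G) k =>
    (quiver_mut (lshift n k) q, matrix_mut k M, gvec_mut k q M G).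

Lemma seed_at_init : seed_at t1 (tree_quiver Q0 t1, init_mx (tree_quiver Q0 t1), 1%:M).
Proof.
split=> /= [|i j|i k|v Mv k|j].
- exact: tree_quiver_endo.
- by rewrite /init_mx col_mxEu !mxE.
- rewrite /init_mx col_mxEd mxE.
  have locF i' : local_end (T t1 i') := tilting_local KS (family_tilting t1) i'.
  have m0 A : mult A (zero_ob C) 0 by apply: mult_zero; exact: zero_obP.
  exists (T t1 (lshift n i)), (zero_ob C), (idm _), 0, (i == k), 0%N; split.
  + by apply: confl_id_zero; exact: zero_obP.
  + exact: in_add_summand.
  + by apply: in_add_zero; exact: zero_obP.
  + split=> //; case: eqVneq => [->|ik]; first exact: mult_self.
    apply: mult_noniso => //; case: (family_tilting t1) => _ + _ _; apply.
    by rewrite eq_lshift eq_sym.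
  + by rewrite subr0; case: (i == k).
- have := Mv k; rewrite (bigD1 k) //= /init_mx col_mxEd mxE eqxx mul1r big1 ?addr0 //.
  by move=> l lk; rewrite col_mxEd mxE eq_sym (negbTE lk) mul0r.
- rewrite (bigD1 j) //= mxE eqxx big1 ?addr0 => [|i ij]; last by rewrite mxE (negbTE ij).
  have [_ _ rig _] := family_tilting t1.
  exact: (index_of_add frob cy rig (exist _ _ (in_add_summand (T t1) j))).
Qed.

Lemma seed_index_algebra (V : zmodType) (I J : finType) (x : I -> V) (G : I -> J -> int)
    (d : J -> nat) (k : J) :
  \sum_i x i *~ (- G i k + \sum_l G i l *+ d l)
  = \sum_l (\sum_i x i *~ G i l) *+ d l - \sum_i x i *~ G i k.
Proof.
under eq_bigr => i _ do rewrite mulrzDr mulrNz addrC.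
rewrite big_split /= sumrN; congr (_ - _).
under [RHS]eq_bigr => l _ do rewrite -sumrMnl.
rewrite [RHS]exchange_big /=; apply: eq_bigr => i _.
rewrite (big_morph (fun z => x i *~ z) (mulrzDr (x i)) (mulr0z (x i))).
by apply: eq_bigr => l _; rewrite [RHS]pmulrn -mulrzA -mulr_natr natz.
Qed.

(** The part of a mutation step that is common to both signs: [E] is the middle
    term of whichever exchange conflation Hom(T, -) keeps exact, [d] counts its
    summands, and [grn] is the color of [k] that this determines. *)
Lemma seed_at_mut t t' k q M G (grn : bool) (d : 'I_(r + n) -> nat) E (s : seq 'I_(r + n)) :
  edge k t t' -> seed_at t (q, M, G) ->
  (forall l, d l = if grn then q (lshift n k) l else q l (lshift n k)) ->
  (forall i, if grn then 0 <= M (rshift r i) k else M (rshift r i) k <= 0) ->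
  (forall i, coindex_coef (dsum (T t')) (T t' (lshift n k)) (T t1 (lshift n i))
      (- M (rshift r i) k)) ->
  (forall i j, j != k -> coindex_coef (dsum (T t')) (T t' (lshift n j))
      (T t1 (lshift n i)) (M (rshift r i) j + M (rshift r i) k * (d (lshift n j))%:Z)) ->
  E \cong sum_over (T t) s -> (forall l, count_mem l s = d l) ->
  (forall x y, index_of (T := dsum (T t1)) (T t (lshift n k)) x ->
     index_of (T t' (lshift n k)) y -> index_of E (x + y)) ->
  seed_at t' (seed_step (q, M, G) k).
Proof.
move=> e st dE signM coefk coefj Es cnt addE.
have [[qt [endo ag]] upM lowM freeM indG] := st; rewrite /= in ag upM lowM freeM indG.
have [_ no2qt] := endoquiver_no_cycles endo.
have no2 (i j : 'I_r) : q (lshift n i) (lshift n j) = 0%N \/ q (lshift n j) (lshift n i) = 0%N.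
  by rewrite !ag ?no2qt //= [(r <= i)%N]leqNgt ltn_ord ?andbF.
have lowk i := lower_mut_pivot k M i.
have lowj i j : j != k -> matrix_mut k M (rshift r i) j
    = M (rshift r i) j + M (rshift r i) k * (d (lshift n j))%:Z.
  move=> jk; rewrite lower_mut // upM dE; congr (_ + _); have := signM i.
  case: (grn) => [->|sM]; first by rewrite max_arrows.
  case: ifP => M0; last by rewrite opprB max_arrows.
  have -> : M (rshift r i) k = 0 by apply/eqP; rewrite eq_le sM.
  by rewrite !mul0r.
have grnE : green M k = grn.
  apply/greenP; case: grn {dE} signM => // sM H.
  have [i /eqP[]] := free_c_vectors_col k freeM.
  by apply/eqP; rewrite eq_le sM H.
split=> /=.
- exact: endoquiver_mut e endo ag.
- exact: exchange_mut.
- move=> i j; have [->|jk] := eqVneq j k; first by rewrite lowk.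
  by rewrite lowj //; exact: coefj.
- exact: (free_c_vectors_mut (f := fun j => (d (lshift n j))%:Z)) freeM.
move=> j; have [->|jk] := eqVneq j (lshift n k); last first.
  have -> : T t' j = T t j by case: T_family => _ /(_ _ _ _ e)[+ _]; exact.
  by under eq_bigr => i _ do rewrite mxE (negbTE jk).
have [_ _ rig _] := family_tilting t1.
have [y indX] := index_of_ex frob fin cy (T t' (lshift n k)) (family_tilting t1).
have := index_of_iso frob cy rig (iso_sym Es) (index_of_sum_over frob cy rig s indG).
move/(index_of_uniq (addE _ _ (indG (lshift n k)) indX)) => xy.
suff <- : y = \sum_i summand_class (T t1) i *~ gvec_mut k q M G i (lshift n k) by [].
under eq_bigr => i _ do rewrite mxE eqxx grnE.
transitivity (\sum_i summand_class (T t1) i *~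
    (- G i (lshift n k) + \sum_l G i l *+ d l)).
  rewrite seed_index_algebra.
  under eq_bigr => l _ do rewrite -cnt.
  by rewrite -xy addrC addKr.
by apply: eq_bigr => i _; case: grn dE {signM grnE} => dE; under eq_bigr => l _ do rewrite dE.
Qed.

(** By [exchange_dichotomy] one of the conflations [X' -> E1 -> X] and
    [X -> E2 -> X'] stays exact under Hom(T, -). In the first case
    [coindex_mutation] computes the coindices after the mutation and shows that
    the c-vector at [k] is negative; in the second case, it is applied to the
    mutation from [t'] back to [t] and shows that the c-vector is positive. *)
Lemma seed_at_step t t' k s : edge k t t' -> seed_at t s -> seed_at t' (seed_step s k).
Proof.
case: s => [[q M] G] e st.
have [[qt [endo ag]] _ lowM _ _] := st; rewrite /= in ag lowM.
have tilt := family_tilting t; have tilt' := family_tilting t'.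
have [_ _ rig _] := family_tilting t1.
have [loops no2qt] := endoquiver_no_cycles endo.
have nk := family_nonproj (t := t) (i := k).
have nk' := family_nonproj (t := t') (i := k).
have Tt' := edge_replace e; have Tt := edge_replace (edge_sym e).
have extt := tilting_ext frob cy tilt.
have uniq A Y z z' : split_local A ->
  coindex_coef (dsum (T t)) A Y z -> coindex_coef (dsum (T t)) A Y z' -> z = z'.
  exact: coindex_coef_uniq.
have splitF (i : 'I_r) : split_local (T t (lshift n i)).
  by apply: (nonprojective_split_local fin); [exact: tilting_local | exact: family_nonproj].
have agk l : q (lshift n k) l = qt (lshift n k) l /\ q l (lshift n k) = qt l (lshift n k).
  by split; rewrite ag //= [(r <= k)%N]leqNgt ltn_ord ?andbF.
have [exR exL] := cs_exchange cluster tilt nk (edge_mutated e).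
have [E1 [f1 [g1 [s1 [fg1 ks1 Es1 cnt1]]]]] :=
  exchange_right KS frob fin cy tilt endo (loops _) nk exR.
have [E2 [f2 [g2 [s2 [fg2 ks2 Es2 cnt2 endk]]]]] :=
  exchange_left KS frob fin cy tilt endo (loops _) nk exL.
have extE2 : Ext1_zero E2 (T t (lshift n k)).
  apply: extt; last exact: in_add_summand.
  by apply: in_add_iso (iso_sym Es2) _; apply: in_add_sum_over => i _; exact: in_add_summand.
have liftT X Y (g : hom X Y) : (forall h : hom (dsum (T t1)) Y, exists h', g \oc h' = h) ->
    forall i (h : hom (T t1 i) Y), exists h', g \oc h' = h.
  move=> lift_g i h; have [h' gh'] := lift_g (h \oc dproj (T t1) i).
  by exists (h' \oc dinj (T t1) i); rewrite compA gh' -compA dproj_inj compm1.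
have [lift1|lift2] := exchange_dichotomy frob cy fg1 fg2 rig extE2 endk.
- have tiltR : cluster_tilting (replace (T t) (lshift n k) (T t' (lshift n k))).
    by rewrite -Tt'.
  have mut i := coindex_mutation KS frob fin cy tilt tiltR nk fg1 ks1 Es1
    (liftT _ _ _ lift1 (lshift n i)).
  have Mk i c : coindex_coef (dsum (T t)) (T t (lshift n k)) (T t1 (lshift n i)) (- c%:Z) ->
      M (rshift r i) k = - c%:Z by apply: uniq (splitF k) (lowM i k).
  apply: (seed_at_mut (grn := false) (d := fun l => q l (lshift n k)) e st _ _ _ _ Es1).
  + by [].
  + by move=> i; have [c [/Mk-> _ _]] := mut i; rewrite oppr_le0.
  + by move=> i; have [c [/Mk-> + _]] := mut i; rewrite opprK -Tt'.
  + move=> i j jk; have [c [/Mk-> _ cj]] := mut i.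
    have jk' : lshift n j != lshift n k by rewrite eq_lshift.
    have [z [z1 z2]] := cj _ jk'.
    have -> : T t' (lshift n j) = T t (lshift n j) by rewrite Tt' /replace (negbTE jk').
    rewrite (uniq _ _ _ _ (splitF j) (lowM i j) z1) mulNr -PoszM (agk _).2 -cnt1.
    by move: z2; rewrite -Tt'.
  + by move=> l; rewrite cnt1 (agk _).2.
  + move=> x y indF indX; rewrite addrC.
    exact: (index_of_confl frob cy rig fg1 lift1 indX indF).
- have tiltR : cluster_tilting (replace (T t') (lshift n k) (T t (lshift n k))).
    by rewrite -Tt.
  have Es2' : E2 \cong sum_over (T t') s2 by rewrite Tt' (sum_over_replace _ _ ks2).
  have mut i := coindex_mutation KS frob fin cy tilt' tiltR nk' fg2 ks2 Es2'
    (liftT _ _ _ lift2 (lshift n i)).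
  have Mk i (c : nat) : coindex_coef (dsum (replace (T t') (lshift n k) (T t (lshift n k))))
      (T t (lshift n k)) (T t1 (lshift n i)) c%:Z -> M (rshift r i) k = c%:Z.
    by rewrite -Tt; apply: uniq (splitF k) (lowM i k).
  apply: (seed_at_mut (grn := true) (d := fun l => q (lshift n k) l) e st _ _ _ _ Es2).
  + by [].
  + by move=> i; have [c [_ /Mk-> _]] := mut i.
  + by move=> i; have [c [+ /Mk-> _]] := mut i.
  + move=> i j jk; have [c [_ /Mk-> cj]] := mut i.
    have jk' : lshift n j != lshift n k by rewrite eq_lshift.
    have [z [z1 z2]] := cj _ jk'.
    have Tj : T t' (lshift n j) = T t (lshift n j) by rewrite Tt' /replace (negbTE jk').
    rewrite -Tt Tj in z2; rewrite (uniq _ _ _ _ (splitF j) (lowM i j) z2).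
    by rewrite -PoszM (agk _).1 -cnt2 subrK.
  + by move=> l; rewrite cnt2 (agk _).1.
  + by move=> x y indF indX; exact: (index_of_confl frob cy rig fg2 lift2 indF indX).
Qed.

Lemma seed_at_descend s0 s t t' : sval t' = sval t ++ s ->
  seed_at t s0 -> seed_at t' (foldl seed_step s0 s).
Proof.
elim: s t s0 => [|k s IHs] t s0 tt'.
  by rewrite cats0 in tt'; rewrite (val_inj tt' : t' = t).
move=> st; have sorted_tk : sorted [rel i j | i != j] (rcons (sval t) k).
  by have := svalP t'; rewrite tt' -cat_rcons => /cat_sorted2[].
apply: (IHs (exist _ (rcons (sval t) k) sorted_tk) (seed_step s0 k)); first by rewrite tt' cat_rcons.
by apply: seed_at_step st; left.
Qed.

Lemma seed_at_ascend s0 s t t' : sval t = sval t' ++ s ->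
  seed_at t s0 -> seed_at t' (foldl seed_step s0 (rev s)).
Proof.
elim/last_ind: s t s0 => [|s k IHs] t s0 tt'.
  by rewrite cats0 in tt'; rewrite (val_inj tt' : t = t').
move=> st; have sorted_ts : sorted [rel i j | i != j] (sval t' ++ s).
  by have := svalP t; rewrite tt' -rcons_cat -cats1 => /cat_sorted2[].
rewrite rev_rcons /=; apply: (IHs (exist _ (sval t' ++ s) sorted_ts) (seed_step s0 k)) => //.
by apply: seed_at_step st; right; rewrite tt' rcons_cat.
Qed.

Lemma index_of_gvector t2 j : index_of (T t2 j)
  (\sum_i summand_class (T t1) i *~ gvector Q0 t1 t2 i j).
Proof.
have [p [s' [t' [e1 e2 lab]]]] := labels_betweenP (sval t1) (sval t2).
have sp : sorted [rel i j | i != j] p.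
  by have := svalP t1; rewrite e1 => /cat_sorted2[].
have st := seed_at_descend (t := exist _ p sp) e2
  (seed_at_ascend (t' := exist _ p sp) e1 seed_at_init).
have := seed_index st j; rewrite /gvector /seed_along lab foldl_cat.
exact.
Qed.

End Mutation.

Theorem theorem2p7 (K : closedFieldType) (C : exactCat K)
    (C_krull_schmidt : krull_schmidt C)
    (C_pseudocompact : pc_enrichment C)
    (C_frobenius : frobenius C)
    (C_2CY : stably_2CY C)
    (C_cluster : cluster_structure C)
    (r n : nat)
    (T0 : 'I_(r + n) -> C)
    (T0_tilting : cluster_tilting T0)
    (T0_nonproj : forall i : 'I_r, ~ projective (T0 (lshift n i)))
    (T0_proj : forall i : 'I_n, projective (T0 (rshift r i)))
    (Q0 : 'M[nat]_(r + n))
    (Q0_endoquiver : endoquiver T0 Q0)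
    (T : tree r -> 'I_(r + n) -> C)
    (T_family : mutation_family T0 T)
    (t1 t2 : tree r) (j : 'I_(r + n)) :
  index_of (T t2 j)
    (\sum_i summand_class (T t1) i *~ gvector Q0 t1 t2 i j).
Proof.
have [fin [S [phi cy]]] := C_2CY.
exact: (index_of_gvector C_krull_schmidt C_frobenius fin cy C_cluster T0_tilting
  T0_nonproj Q0_endoquiver T_family).
Qed.
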